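(* Let $K_7^{=}$ denote the graph obtained from the complete graph $K_7$ by deleting two independent (i.e. vertex-disjoint) edges. Every $5$-connected graph with $n\ge 6$ vertices and at least $4n-7$ edges contains $K_7^{=}$ as a minor.
   Context: Graphs are finite and simple. A graph $H$ is a minor of a graph $G$ if a graph isomorphic to $H$ can be obtained from a subgraph of $G$ by repeatedly contracting edges (discarding loops and parallel edges). A graph is $k$-connected if it has at least $k+1$ vertices and deleting any set of at most $k-1$ vertices leaves a connected graph. *)

(* Defs.v *)
From mathcomp Require Import all_boot.

Set Implicit Arguments.
Unset Strict Implicit.
Unset Printing Implicit Defensive.

Record sgraph := SGraph {
  vertex :> finType;
  adj : rel vertex;
  adj_sym : symmetric adj;
  adj_irrefl : irreflexive adj }.

Arguments adj {s} x y : rename.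

Definition edges (G : sgraph) : {set {set G}} :=
  [set e | [exists x : G, exists y : G, adj x y && (e == [set x; y])]].

Definition isomorphic (G H : sgraph) : Prop :=
  exists2 f : G -> H, bijective f & forall x y, adj (f x) (f y) = adj x y.

(* [S] is a subgraph of [G] up to the names of its vertices; not necessarily
   an induced one. *)
Definition subgraph (S G : sgraph) : Prop :=
  exists2 f : S -> G, injective f & forall x y, adj x y -> adj (f x) (f y).

Section Induced.
Variables (G : sgraph) (A : {set G}).

Definition induced_adj : rel {x : G | x \in A} :=
  fun u v => adj (val u) (val v).

Lemma induced_adj_sym : symmetric induced_adj.
Proof. by move=> u v; rewrite /induced_adj adj_sym. Qed.

Lemma induced_adj_irrefl : irreflexive induced_adj.
Proof. by move=> u; rewrite /induced_adj adj_irrefl. Qed.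

Definition induced : sgraph := SGraph induced_adj_sym induced_adj_irrefl.
End Induced.

Definition connected (G : sgraph) : Prop :=
  0 < #|G| /\ forall x y : G, connect adj x y.

Definition k_connected (k : nat) (G : sgraph) : Prop :=
  k.+1 <= #|G| /\ forall S : {set G}, #|S| < k -> connected (induced (~: S)).

(* Merge [y] into [x]: the vertex [x] of [contract x y] stands for the merged
   vertex and inherits the neighbours of [y]. This is the contraction of the
   edge [xy] only when [adj x y], which [contracts_to] below requires. *)
Section Contract.
Variables (G : sgraph) (x y : G).

Definition contract_adj : rel {z : G | z != y} :=
  fun u v => (u != v) &&
    [|| adj (val u) (val v),
        (val u == x) && adj y (val v) |
        (val v == x) && adj (val u) y].

Lemma contract_adj_sym : symmetric contract_adj.
Proof.
move=> u v; rewrite /contract_adj eq_sym (adj_sym (val u)).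
by rewrite (adj_sym y) (adj_sym (val u) y) [in X in _ || X]orbC.
Qed.

Lemma contract_adj_irrefl : irreflexive contract_adj.
Proof. by move=> u; rewrite /contract_adj eqxx. Qed.

Definition contract : sgraph := SGraph contract_adj_sym contract_adj_irrefl.
End Contract.

Inductive contracts_to : sgraph -> sgraph -> Prop :=
| contracts_refl (G : sgraph) : contracts_to G G
| contracts_step (G : sgraph) (x y : G) (H : sgraph) :
    adj x y -> contracts_to (contract x y) H -> contracts_to G H.

Definition minor (H G : sgraph) : Prop :=
  exists S K : sgraph, [/\ subgraph S G, contracts_to S K & isomorphic K H].

Section Complete.
Variable n : nat.

Definition complete_adj : rel 'I_n := fun i j => i != j.

Lemma complete_adj_sym : symmetric complete_adj.
Proof. by move=> i j; rewrite /complete_adj eq_sym. Qed.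

Lemma complete_adj_irrefl : irreflexive complete_adj.
Proof. by move=> i; rewrite /complete_adj eqxx. Qed.

Definition complete : sgraph := SGraph complete_adj_sym complete_adj_irrefl.
End Complete.

Section DeleteEdge.
Variables (G : sgraph) (x y : G).

Definition del_edge_adj : rel G :=
  fun u v => [&& adj u v, (u, v) != (x, y) & (u, v) != (y, x)].

Lemma del_edge_adj_sym : symmetric del_edge_adj.
Proof.
move=> u v; rewrite /del_edge_adj adj_sym !xpair_eqE; congr (_ && _).
by rewrite andbC ![(u == _) && _]andbC.
Qed.

Lemma del_edge_adj_irrefl : irreflexive del_edge_adj.
Proof. by move=> u; rewrite /del_edge_adj adj_irrefl. Qed.

Definition del_edge : sgraph := SGraph del_edge_adj_sym del_edge_adj_irrefl.
End DeleteEdge.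

(* $K_7^=$: the deleted edges are 01 and 23. *)
Definition K7_minus2 : sgraph :=
  let K7' := @del_edge (complete 7) (@Ordinal 7 0 isT) (@Ordinal 7 1 isT) in
  @del_edge K7' (@Ordinal 7 2 isT) (@Ordinal 7 3 isT).

(* Main.v *)
(* Let C2 be K_8 minus a 4-cycle: four pairwise adjacent vertices, all adjacent to
   two disjoint edges (the blob pairs).

   First, n >= 3 vertices and 4n - 8 edges force K_7^= or C2.  In a minimal
   counterexample every edge lies in four triangles, and a separator can be
   filled from both sides by contracting the far side onto one of its vertices;
   comparing edge counts shows 4-connectivity.  If c has degree at most 7 and a
   component of G - N[c] sees five neighbours of c, a finite check gives K_7^=;
   otherwise it sees exactly four, the same filling shows that they form a
   clique, and behind that clique lie c and a connected set W, both adjacent to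
   all of it.  Two such ends joined by four disjoint paths (Menger) make C2.

   Secondly, a 5-connected graph with a C2 minor has K_7^=.  Spread the model over
   all vertices; contracting an edge inside one of the four central bags
   preserves the situation unless some 5-separator between the blob pairs
   contains that edge.  These separators form a chain in which consecutive ones
   differ by moving a single vertex along one of five disjoint strands.  When two
   of the strands are joined to blobs at the first and at a later separator and
   the other three span two edges, K_7^= appears; otherwise the adjacencies of
   strands and colours evolve in a finite game, and an exhaustive search shows
   that the four central bags never become pairwise adjacent. *)

Require Import Defs.
From HB Require Import structures.
From Stdlib Require Import Classical.
From mathcomp Require Import all_boot zify.

Set Implicit Arguments.
Unset Strict Implicit.
Unset Printing Implicit Defensive.

(** * Connected sets and models *)

(** C2 is a genuine second outcome: it has 8 vertices and 24 = 4*8 - 8 edges, and after the deletion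
    of any vertex or the contraction of any edge two missing pairs still share a vertex, so it has
    no K_7^= minor. Hence 5-connectivity must enter, but contraction does not preserve it. The
    second half keeps only what survives: no fewer than five vertices separate one blob pair from
    the other. Such a separator meets all four central bags, so one of size five meets exactly one
    bag twice. This doubled pair is where the chain of separators advances, and the edge joining its
    two vertices supplies contacts missing when K_7^= is assembled. Edges are counted as ordered
    pairs, so the bound reads 8n - 16, and by parity the next smaller value is 8n - 18. Filling a
    separator of k <= 3 vertices from both sides, averaged over the absorbing vertex, would give (k
    - 4)(k - 5) <= 0, which is false. At k = 4 the averaged inequality is an equality whatever the
    separator induces; a third filling, by [W] beside [c], forces the clique. *)

HB.lock Definition nb (T : finType) (e : rel T) (X : {set T}) : {set T} :=
  [set y | (y \notin X) && [exists x in X, e x y]].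

Section Sets.
Variable T : finType.
Implicit Types (e : rel T) (X Y A B D : {set T}) (x y z : T).

Definition touches e X Y := [exists x in X, [exists y in Y, e x y]].

Lemma touchesP e X Y :
  reflect (exists x y, [/\ x \in X, y \in Y & e x y]) (touches e X Y).
Proof.
apply: (iffP exists_inP) => [[x xX /exists_inP[y yY exy]]|[x [y [xX yY exy]]]].
  by exists x, y.
by exists x => //; apply/exists_inP; exists y.
Qed.

Lemma touchesC e X Y : symmetric e -> touches e X Y = touches e Y X.
Proof.
move=> se; apply/touchesP/touchesP => -[x [y [xX yY exy]]].
  by exists y, x; rewrite se.
by exists y, x; rewrite se.
Qed.

Lemma touches_sub e (e' : rel T) X Y X' Y' :
  subrel e e' -> X \subset X' -> Y \subset Y' -> touches e X Y ->
  touches e' X' Y'.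
Proof.
move=> ee' sX sY /touchesP[x [y [xX yY exy]]]; apply/touchesP.
by exists x, y; rewrite (subsetP sX) // (subsetP sY) // ee'.
Qed.

Lemma touches1 e x y : e x y -> touches e [set x] [set y].
Proof. by move=> exy; apply/touchesP; exists x, y; rewrite !inE. Qed.

(** Connectivity by closed parts instead of paths. The empty set qualifies, so nonemptiness is
    always required separately. *)
Definition conn e X := forall Y, Y \subset X -> Y != set0 ->
  (forall x y, x \in Y -> y \in X -> e x y -> y \in Y) -> X \subset Y.

Lemma conn1 e x : conn e [set x].
Proof.
move=> Y sY /set0Pn[y yY] _; rewrite sub1set.
by move: (subsetP sY _ yY); rewrite inE => /eqP <-.
Qed.

Lemma conn_sub e (e' : rel T) X : subrel e e' -> conn e X -> conn e' X.
Proof.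
move=> ee' cX Y sY Y0 cl; apply: cX => // x y xY yX exy.
by apply: cl xY yX _; apply: ee'.
Qed.

Lemma connU e X Y : symmetric e -> conn e X -> conn e Y ->
  (X :&: Y != set0) || touches e X Y -> conn e (X :|: Y).
Proof.
move=> se cX cY tXY Z sZ /set0Pn[z zZ] cl.
have clX x y : x \in Z -> y \in X -> e x y -> y \in Z.
  by move=> xZ yX; apply: cl => //; rewrite inE yX.
have clY x y : x \in Z -> y \in Y -> e x y -> y \in Z.
  by move=> xZ yY; apply: cl => //; rewrite inE yY orbT.
have hX x : x \in Z -> x \in X -> X \subset Z.
  move=> xZ xX; apply: subset_trans (subsetIl Z X).
  apply: cX (subsetIr _ _) _ _.
    by apply/set0Pn; exists x; rewrite inE xZ.
  by move=> a b; rewrite inE => /andP[aZ _] bX eab; rewrite inE bX (clX a).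
have hY x : x \in Z -> x \in Y -> Y \subset Z.
  move=> xZ xY; apply: subset_trans (subsetIl Z Y).
  apply: cY (subsetIr _ _) _ _.
    by apply/set0Pn; exists x; rewrite inE xZ.
  by move=> a b; rewrite inE => /andP[aZ _] bY eab; rewrite inE bY (clY a).
rewrite subUset.
case/orP: tXY => [/set0Pn[w]|/touchesP[a [b [aX bY eab]]]].
  rewrite inE => /andP[wX wY].
  have: z \in X :|: Y by apply: (subsetP sZ).
  rewrite inE => /orP[zX|zY].
    have sX := hX _ zZ zX; rewrite sX; apply: hY wY; exact: (subsetP sX).
  have sY := hY _ zZ zY; rewrite sY andbT; apply: hX wX; exact: (subsetP sY).
have: z \in X :|: Y by apply: (subsetP sZ).
rewrite inE => /orP[zX|zY].
  have sX := hX _ zZ zX; rewrite sX; apply: (hY b) => //.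
  by apply: clY bY eab; apply: (subsetP sX).
have sY := hY _ zZ zY; rewrite sY andbT; apply: (hX a) => //.
by apply: (clX b) => //; [apply: (subsetP sY)|rewrite se].
Qed.

Lemma conn_hull e X A x : conn e X -> x \in X -> x \in A ->
  (forall u v, e u v -> v \in A) -> X \subset A.
Proof.
move=> cX xX xA cl; apply: subset_trans (subsetIr X A).
apply: cX (subsetIl _ _) _ _; first by apply/set0Pn; exists x; rewrite inE xX.
by move=> a b _ bX eab; rewrite inE bX (cl a).
Qed.

Lemma nbP e X y :
  reflect (y \notin X /\ exists2 x, x \in X & e x y) (y \in nb e X).
Proof.
rewrite nb.unlock inE; apply: (iffP andP) => [[yX /exists_inP[x xX exy]]|[yX [x xX exy]]].
  by split=> //; exists x.
by split=> //; apply/exists_inP; exists x.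
Qed.

Lemma mem_nb e X x y : x \in X -> y \notin X -> e x y -> y \in nb e X.
Proof. by move=> xX yX exy; apply/nbP; split=> //; exists x. Qed.

Lemma nb_notin e X y : y \in nb e X -> y \notin X.
Proof. by case/nbP. Qed.

Lemma nb_closed e X x y : x \in X -> e x y -> y \in X :|: nb e X.
Proof.
move=> xX exy; rewrite inE; case: (boolP (y \in X)) => //= yX.
exact: mem_nb exy.
Qed.

(** An inclusion-minimal closed set containing [b]. A closed part [Y] missing [b] could be removed
    from it, since by symmetry [D :\: Y] is closed as well. *)
Lemma component e A b : symmetric e -> b \in A -> exists D,
  [/\ b \in D, D \subset A, conn e D &
      forall x y, x \in D -> y \in A -> e x y -> y \in D].
Proof.
move=> se bA.
pose good D := [&& b \in D, D \subset A &
  [forall x in D, forall y in A, e x y ==> (y \in D)]].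
have gA : good A.
  rewrite /good bA subxx; apply/forall_inP => x _; apply/forall_inP => y yA.
  by rewrite yA implybT.
have [D /minsetP[/and3P[bD DA /forall_inP clD] minD] _] := minset_exists gA.
have cl x y : x \in D -> y \in A -> e x y -> y \in D.
  by move=> /clD/forall_inP h /h /implyP; apply.
exists D; split=> // Y sY Y0 clY.
case: (boolP (b \in Y)) => bY.
  rewrite -(minD Y) //; apply/and3P; split=> //; first exact: subset_trans DA.
  apply/forall_inP => x xY; apply/forall_inP => y yA; apply/implyP => exy.
  have yD : y \in D by apply: (cl x) => //; apply: (subsetP sY).
  exact: (clY x).
have /esym DY : D :\: Y = D.
  apply: minD; last exact: subsetDl.
  apply/and3P; split; first by rewrite inE bY.
    exact: subset_trans (subsetDl _ _) DA.
  apply/forall_inP => x; rewrite inE => /andP[xY xD].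
  apply/forall_inP => y yA; apply/implyP => exy.
  have yD := cl _ _ xD yA exy.
  rewrite inE yD andbT; apply: contra xY => yY; apply: clY yY xD _.
  by rewrite se.
case/set0Pn: Y0 => y yY; have:= subsetP sY _ yY.
by rewrite DY inE yY.
Qed.

End Sets.

Arguments conn {T} e X.

Lemma conn_bigcup (I T : finType) (h : rel I) (e : rel T) (F : I -> {set T})
  (Y : {set I}) :
  conn h Y -> (forall i, i \in Y -> conn e (F i)) ->
  (forall i, i \in Y -> F i != set0) ->
  (forall i j, i \in Y -> j \in Y -> h i j -> touches e (F i) (F j)) ->
  conn e (\bigcup_(i in Y) F i).
Proof.
move=> cY cF F0 tF Z sZ /set0Pn[z zZ] cl.
have full i : i \in Y -> F i :&: Z != set0 -> F i \subset Z.
  move=> iY ne; apply: subset_trans (subsetIr (F i) Z).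
  apply: (cF i iY) (subsetIl _ _) ne _ => x y; rewrite !inE => /andP[xF xZ] yF.
  by rewrite yF; apply: cl => //; apply/bigcupP; exists i.
have: Y \subset [set i in Y | F i :&: Z != set0].
  apply: cY.
  - by apply/subsetP => i; rewrite inE => /andP[].
  - have /bigcupP[i iY zi] := subsetP sZ _ zZ.
    by apply/set0Pn; exists i; rewrite inE iY; apply/set0Pn; exists z;
      rewrite inE zi.
  move=> i j; rewrite inE => /andP[iY ne] jY hij; rewrite inE jY /=.
  have /touchesP[x [y [xi yj exy]]] := tF _ _ iY jY hij.
  apply/set0Pn; exists y; rewrite inE yj /=; apply: cl exy.
    exact: (subsetP (full i iY ne)).
  by apply/bigcupP; exists j.
move=> sY; apply/subsetP => x /bigcupP[i iY xi].
by have:= subsetP sY _ iY; rewrite inE => /andP[_ /(full i iY)/subsetP->].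
Qed.

(* The target graph has vertices 0, ..., k-1; [h] is only read at pairs i < j. *)
Definition model (T : finType) (e : rel T) (k : nat) (h : rel nat) :=
  exists B : nat -> {set T},
    [/\ forall i, i < k -> B i != set0, forall i, i < k -> conn e (B i) &
        forall i j, i < j -> j < k ->
          [disjoint B i & B j] /\ (h i j -> touches e (B i) (B j))].

Definition hK7 : rel nat := fun i j => ((i, j) != (0, 1)) && ((i, j) != (2, 3)).
(* K_8 minus the 4-cycle between {4,5} and {6,7} *)
Definition hC2 : rel nat := fun i j => ~~ ((3 < i < 6) && (5 < j)).

(** Minor models with an arbitrary set of targets, for the intermediate graphs of the inductions;
    [model_bags] composes them with the numbered targets of [model]. *)
Definition bags (I T : finType) (e : rel T) (A : {set I}) (F : I -> {set T})
    (h : rel I) :=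
  [/\ forall i, i \in A -> F i != set0, forall i, i \in A -> conn e (F i),
      forall i j, i \in A -> j \in A -> i != j -> [disjoint F i & F j] &
      forall i j, i \in A -> j \in A -> h i j -> touches e (F i) (F j)].

Definition sub_rel (I : finType) (A : {set I}) (h : rel I) :
  rel {i | i \in A} := fun i j => h (val i) (val j).

Lemma model_bags (I T : finType) (e : rel T) (A : {set I}) (F : I -> {set T})
    (h : rel I) k g :
  bags e A F h -> model (sub_rel (A:=A) h) k g -> model e k g.
Proof.
move=> [F0 Fc Fd Ft] [B [B0 Bc Bt]].
exists (fun k => \bigcup_(i in B k) F (val i)); split.
- move=> i /B0/set0Pn[x xi]; have /set0Pn[z zF] := F0 _ (valP x).
  by apply/set0Pn; exists z; apply/bigcupP; exists x.
- move=> i ik; apply: conn_bigcup (Bc _ ik) _ _ _ => [j _|j _|j l _ _].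
  + exact/Fc/valP.
  + exact/F0/valP.
  + by apply: Ft; apply: valP.
move=> i j ij jk; have [d t] := Bt _ _ ij jk; split.
  apply/pred0P => z /=; apply/andP => -[/bigcupP[x xi zx] /bigcupP[y yj zy]].
  have xy : val x != val y.
    rewrite (inj_eq val_inj); apply: contraTneq yj => <-.
    by rewrite (disjointFr d xi).
  by have := Fd _ _ (valP x) (valP y) xy; rewrite disjoint_subset =>
    /subsetP/(_ _ zx); rewrite inE zy.
move=> /t/touchesP[x [y [xi yj hxy]]].
have := Ft _ _ (valP x) (valP y) hxy.
by apply: touches_sub => //; [apply: bigcup_sup xi|apply: bigcup_sup yj].
Qed.

(** Submodularity vertex by vertex. Summing gives the form for cardinalities; the pointwise form
    turns equality of the sums into equality at each vertex. *)
Lemma nb_submod (T : finType) (e : rel T) (X Y : {set T}) a :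
  (a \in nb e (X :&: Y)) + (a \in nb e (X :|: Y)) <= (a \in nb e X) + (a \in nb e Y).
Proof.
have meet u : u \in X :&: Y -> e u a -> a \notin X :&: Y ->
    [/\ a \notin X -> a \in nb e X, a \notin Y -> a \in nb e Y &
        (a \in nb e X) || (a \in nb e Y)].
  rewrite !inE => /andP[uX uY] eua; rewrite negb_and => aXY.
  have hX : a \notin X -> a \in nb e X by move=> h; apply: mem_nb eua.
  have hY : a \notin Y -> a \in nb e Y by move=> h; apply: mem_nb eua.
  by split=> //; case/orP: aXY => [/hX->|/hY->]; rewrite ?orbT.
case: (boolP (a \in nb e (X :|: Y))) => [/nbP[]|_].
  rewrite inE negb_or => /andP[aX aY] [u uXY eua].
  case: (boolP (a \in nb e (X :&: Y))) => [/nbP[aXY [w wXY ewa]]|_].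
    by have [-> // -> //] := meet w wXY ewa aXY.
  by move: uXY; rewrite inE => /orP[uX|uY];
    [rewrite (mem_nb uX aX eua)|rewrite (mem_nb uY aY eua); case: (a \in nb e X)].
case: (boolP (a \in nb e (X :&: Y))) => [/nbP[aXY [w wXY ewa]]|_] //.
by have [_ _ /orP[->|->]] := meet w wXY ewa aXY; case: (a \in nb e _).
Qed.

Lemma nb_setU (T : finType) (e : rel T) (X Y : {set T}) a :
  a \in nb e (X :|: Y) -> (a \in nb e X) || (a \in nb e Y).
Proof. by move=> aXY; have := nb_submod e X Y a; rewrite aXY; lia. Qed.

(** * From models to minors *)

Lemma conn_imset (T T' : finType) (e : rel T) (e' : rel T') (p : T -> T')
    (X : {set T}) :
  (forall x y, e x y -> p x = p y \/ e' (p x) (p y)) -> conn e X ->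
  conn e' (p @: X).
Proof.
move=> pe cX Y sY /set0Pn[y yY] cl.
have /imsetP[x0 x0X y0] := subsetP sY _ yY.
have sX : X \subset X :&: p @^-1: Y.
  apply: cX (subsetIl _ _) _ _.
    by apply/set0Pn; exists x0; rewrite !inE x0X -y0.
  move=> x z; rewrite !inE => /andP[xX pxY] zX exz; rewrite zX.
  have [<-//|ez] := pe _ _ exz.
  by apply: cl pxY _ ez; apply: imset_f.
apply/subsetP => _ /imsetP[x xX ->].
by have:= subsetP sX _ xX; rewrite !inE => /andP[].
Qed.

Lemma inj_surj_bij (T T' : finType) (f : T -> T') :
  injective f -> (forall y, exists x, f x = y) -> bijective f.
Proof.
move=> injf surj; apply: inj_card_bij => //; rewrite -(card_codom injf).
by apply/subset_leq_card/subsetP => y _; have [x <-] := surj y; apply: codom_f.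
Qed.

(** While some edge lies inside a fibre it is contracted, which preserves all hypotheses. When none
    does, the connected fibres are single vertices and [f] is an isomorphism. *)
Lemma contracts_to_fibres n (S H : sgraph) (f : S -> H) : #|S| <= n ->
  (forall k, exists x, f x = k) -> (forall k, conn adj [set x | f x == k]) ->
  (forall x y, adj x y -> f x != f y -> adj (f x) (f y)) ->
  (forall k l, adj k l -> exists x y, [/\ f x = k, f y = l & adj x y]) ->
  exists2 K, contracts_to S K & isomorphic K H.
Proof.
elim: n S f => [|n IH] S f Sn surj cf f1 f2.
  exists S; first exact: contracts_refl.
  have no (x : S) : False.
    by move: Sn; rewrite leqn0 => /eqP/card0_eq/(_ x).
  exists f; last by move=> x; case: (no x).
  by apply: inj_surj_bij surj => x; case: (no x).
have [|] := boolP [exists u, exists v, adj u v && (f u == f v)]; last first.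
  move=> noe.
  have injf : injective f.
    move=> x y fxy; apply/eqP.
    have := cf (f x) [set x].
    rewrite sub1set inE eqxx => /(_ isT).
    have -> : [set x] != set0 by apply/set0Pn; exists x; rewrite inE.
    move=> /(_ isT) H1; suff /subsetP/(_ y): [set x0 | f x0 == f x] \subset [set x].
      by rewrite !inE fxy eqxx eq_sym => ->.
    apply: H1 => a b; rewrite !inE => /eqP-> fb axb.
    by case/existsP: noe; exists x; apply/existsP; exists b; rewrite axb eq_sym.
  exists S; first exact: contracts_refl.
  exists f.
    exact: inj_surj_bij.
  move=> x y; apply/idP/idP => [/f2[a [b [/injf<- /injf<-]]]//|axy].
  apply: f1 => //; rewrite (inj_eq injf); apply: contraTneq axy => ->.
  by rewrite adj_irrefl.
case/existsP => u /existsP[v /andP[auv /eqP fuv]].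
have uv : u != v by apply: contraTneq auv => ->; rewrite adj_irrefl.
pose p (x : S) : contract u v := insubd (Sub u uv) x.
have pv : val (p v) = u by rewrite val_insubd eqxx.
have px x : x != v -> val (p x) = x by rewrite val_insubd => ->.
have fp x : f (val (p x)) = f x.
  by have [->|/px->//] := eqVneq x v; rewrite pv.
have padj x y : adj x y -> p x = p y \/ adj (p x) (p y).
  move=> axy; have [->|pxy] := eqVneq (p x) (p y); [by left|right].
  rewrite /adj /= /contract_adj pxy /=.
  have [xv|xv] := eqVneq x v; have [yv|yv] := eqVneq y v.
  - by rewrite xv yv eqxx in pxy.
  - by subst x; rewrite pv (px _ yv) eqxx axy !orbT.
  - by subst y; rewrite pv (px _ xv) eqxx axy !orbT.
  by rewrite !px // axy.
have [||k|x y axy|k l|K cK iK] := IH (contract u v) (fun z => f (val z)).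
- have -> : #|contract u v| = #|[set~ v]|.
    by rewrite card_sig; apply: eq_card => z; rewrite !inE.
  by rewrite cardsC1 -subn1 leq_subLR add1n.
- by move=> k; have [x fx] := surj k; exists (p x); rewrite fp.
- have -> : [set x | f (val x) == k] = p @: [set x | f x == k].
    apply/setP => z; rewrite inE; apply/eqP/imsetP => [fz|[x + ->]].
      exists (val z); first by rewrite inE fz.
      by apply: val_inj; rewrite px // (valP z).
    by rewrite inE fp => /eqP.
  exact: conn_imset padj (cf k).
- have: x != y by apply: contraTneq axy => ->; rewrite adj_irrefl.
  move: axy; rewrite /adj /= /contract_adj => /andP[_].
  case/or3P => [/f1//|/andP[/eqP xu]|/andP[/eqP yu]].
    by rewrite xu fuv => /f1 h _; apply: h.
  by rewrite yu fuv => /f1 h _; apply: h.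
- move=> akl; have [x [y [fx fy axy]]] := f2 _ _ akl.
  exists (p x), (p y); rewrite !fp; split=> //.
  have [pxy|//] := padj _ _ axy.
  by move: akl; rewrite -fx -fy -(fp x) -(fp y) pxy adj_irrefl.
by exists K => //; apply: contracts_step auv cK.
Qed.

Lemma adj_K7_minus2 (i j : 'I_7) : i < j -> @adj K7_minus2 i j = hK7 i j.
Proof.
by case: i => -[|[|[|[|[|[|[|//]]]]]]] ?; case: j => -[|[|[|[|[|[|[|//]]]]]]] ?.
Qed.

Lemma minor_of_model (G : sgraph) : model (@adj G) 7 hK7 -> minor K7_minus2 G.
Proof.
move=> [B [B0 Bc Bt]].
pose H := K7_minus2.
pose P := [set x : G | [exists i : 'I_7, x \in B i]].
pose lab (x : G) : 'I_7 := odflt ord0 [pick i : 'I_7 | x \in B i].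
have labP x : x \in P -> x \in B (lab x).
  rewrite inE /lab; case: pickP => //= no /existsP[i]; by rewrite no.
have labE (i : 'I_7) x : x \in B i -> lab x = i.
  move=> xi; have xl : x \in B (lab x).
    by apply: labP; rewrite inE; apply/existsP; exists i.
  apply/eqP; rewrite -val_eqE /=; apply/negPn; rewrite neq_ltn; apply/negP.
  case/orP => lt.
    have [d _] := Bt _ _ lt (ltn_ord i); by rewrite (disjointFr d xl) in xi.
  have [d _] := Bt _ _ lt (ltn_ord _); by rewrite (disjointFr d xi) in xl.
have PB (i : 'I_7) x : x \in B i -> x \in P.
  by move=> xi; rewrite inE; apply/existsP; exists i.
(* Edges between bags not adjacent in [H] are dropped, so that contraction yields [H] itself and not
   a supergraph of it. *)
pose ea (x y : {x : G | x \in P}) := adj (val x) (val y) &&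
  ((lab (val x) == lab (val y)) || @adj H (lab (val x)) (lab (val y))).
have es : symmetric ea.
  by move=> x y; rewrite /ea adj_sym eq_sym (@adj_sym H).
have ei : irreflexive ea by move=> x; rewrite /ea adj_irrefl.
pose S := SGraph es ei.
have [||||K cK iK] := @contracts_to_fibres #|S| S H (fun x => lab (val x))
  (leqnn _).
- move=> k; have /set0Pn[x xk] := B0 k (ltn_ord k).
  by exists (Sub x (PB _ _ xk)) => /=; apply: labE.
- move=> k Y sY /set0Pn[y yY] cl.
  have inB (z : S) : lab (val z) = k -> val z \in B k.
    by move=> <-; apply: labP (valP z).
  have yk : lab (val y) = k by have := subsetP sY _ yY; rewrite inE => /eqP.
  suff /subsetP h : B k \subset val @: Y.
    apply/subsetP => z; rewrite inE => /eqP zk.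
    by have /imsetP[w wY /val_inj->] := h _ (inB _ zk).
  apply: Bc => //.
  + apply/subsetP => _ /imsetP[z zY ->]; apply: inB.
    by have:= subsetP sY _ zY; rewrite inE => /eqP.
  + by apply/set0Pn; exists (val y); apply: imset_f.
  move=> _ x /imsetP[z zY ->] xk azx.
  have -> : x = val (Sub x (PB _ _ xk) : S) by [].
  apply: imset_f; apply: (cl z) => //; first by rewrite inE /= (labE _ _ xk).
  rewrite /adj /= /ea /= azx (labE _ _ xk) /=.
  by have := subsetP sY _ zY; rewrite inE => ->.
- move=> x y; rewrite {1}/adj /= /ea => /andP[_] /orP[->//|].
  by [].
- move=> k l akl.
  have kl : k != l by apply: contraTneq akl => ->; rewrite adj_irrefl.
  have : touches adj (B k) (B l).
    have [lt|lt] : k < l \/ l < k by move: kl; rewrite -val_eqE /=; lia.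
      by have [_] := Bt _ _ lt (ltn_ord l); apply; rewrite -adj_K7_minus2.
    rewrite touchesC; last exact: adj_sym.
    by have [_] := Bt _ _ lt (ltn_ord k); apply; rewrite -adj_K7_minus2 // adj_sym.
  case/touchesP => x [y [xk yl axy]].
  exists (Sub x (PB _ _ xk)), (Sub y (PB _ _ yl)); split.
  + exact: labE.
  + exact: labE.
  change (is_true (ea (Sub x (PB _ _ xk)) (Sub y (PB _ _ yl)))).
  by rewrite /ea !SubK axy (labE _ _ xk) (labE _ _ yl) akl orbT.
exists S, K; split=> //; exists val; first exact: val_inj.
by move=> x y; rewrite /adj /= /ea => /andP[].
Qed.

(** * Counting edges *)

(* Ordered pairs: each edge counts twice. *)
Definition e2 (T : finType) (A : {set T}) (h : rel T) : nat :=
  \sum_x \sum_y [&& x \in A, y \in A & h x y].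

Lemma sum_pt (T : finType) (z : T) (F : T -> nat) :
  \sum_x \sum_y (x == z) * F y = \sum_y F y.
Proof.
rewrite (bigD1 z) //= [X in _ + X]big1 ?addn0 => [|x /negPf xz].
  by apply: eq_bigr => y _; rewrite eqxx mul1n.
by apply: big1 => y _; rewrite xz.
Qed.

Lemma sum_pt_r (T : finType) (z : T) (F : T -> nat) :
  \sum_x \sum_y (y == z) * F x = \sum_x F x.
Proof. by rewrite exchange_big /= sum_pt. Qed.

Lemma sum_pt2 (T : finType) (z : T) (F : T -> nat) :
  (\sum_y F y).*2 = \sum_x \sum_y (x == z) * F y + \sum_x \sum_y (y == z) * F x.
Proof. by rewrite sum_pt sum_pt_r addnn. Qed.

Lemma card_sum1 (T : finType) (A : {set T}) : #|A| = \sum_x (x \in A).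
Proof. by rewrite -sum1_card big_mkcond; apply: eq_bigr => x _; case: ifP. Qed.

Lemma e2D1 (T : finType) (A : {set T}) (h : rel T) z :
  symmetric h -> irreflexive h -> z \in A ->
  e2 A h = e2 (A :\ z) h + #|[set y in A | h z y]|.*2.
Proof.
move=> hs hi zA; rewrite card_sum1 (sum_pt2 z).
rewrite /e2 -!big_split; apply: eq_bigr => x _ /=; rewrite -!big_split /=.
apply: eq_bigr => y _; rewrite !inE.
have [->|_] := eqVneq x z; have [->|_] := eqVneq y z => /=.
- by rewrite hi !andbF.
- by rewrite zA mul1n mul0n addn0.
- by rewrite zA hs andbF mul0n mul1n.
by rewrite !mul0n !addn0.
Qed.

(** Parity turns the failure of [e2 A h + 18 <= 8 * #|A|] into [8 * #|A| <= e2 A h + 16], the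
    hypothesis of the induction. *)
Lemma e2_even (T : finType) (A : {set T}) (h : rel T) :
  symmetric h -> irreflexive h -> ~~ odd (e2 A h).
Proof.
move=> hs hi; move: {2}#|A| (leqnn #|A|) => n.
elim: n A => [|n IH] A; rewrite ?leqn0.
  move=> /eqP/cards0_eq->; rewrite /e2 big1 // => x _.
  by rewrite big1 // => y _; rewrite inE.
move=> An; have [->|/set0Pn[z zA]] := eqVneq A set0.
  by apply: IH; rewrite cards0.
rewrite (e2D1 hs hi zA) oddD odd_double addbF; apply: IH.
by move: An; rewrite (cardsD1 z A) zA.
Qed.

Lemma e2_deg (T : finType) (A : {set T}) (h : rel T) :
  e2 A h = \sum_(x in A) #|[set y in A | h x y]|.
Proof.
rewrite [RHS]big_mkcond; apply: eq_bigr => x _; case: ifP => xA; last first.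
  by rewrite big1 // => y _.
by rewrite card_sum1; apply: eq_bigr => y _; rewrite inE.
Qed.

Lemma e2_bound (T : finType) (A : {set T}) (h : rel T) :
  irreflexive h -> e2 A h <= #|A| * #|A|.-1.
Proof.
move=> hi; rewrite e2_deg -sum_nat_const; apply: leq_sum => x xA.
rewrite (cardsD1 x A) xA /=; apply/subset_leq_card/subsetP => y.
by rewrite !inE => /andP[-> hxy]; rewrite andbT; apply: contraTneq hxy => ->;
  rewrite hi.
Qed.

Lemma e2_edges (G : sgraph) : 2 * #|edges G| <= e2 setT (@adj G).
Proof.
pose S := [set p : G * G | adj p.1 p.2].
pose f (p : G * G) := [set p.1; p.2].
have -> : e2 setT (@adj G) = #|S|.
  rewrite /e2 pair_big card_sum1; apply: eq_bigr => -[x y] _.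
  by rewrite !inE.
have -> : edges G = f @: S.
  apply/setP => E; rewrite inE; apply/existsP/imsetP => [[x]|[[x y]]].
    by case/existsP=> y /andP[axy /eqP->]; exists (x, y); rewrite ?inE.
  by rewrite inE /= => axy ->; exists x; apply/existsP; exists y; rewrite axy /=.
rewrite -[#|S|]sum1_card (partition_big_imset f) /= mulnC -sum_nat_const.
apply: leq_sum => E /imsetP[[x y]]; rewrite inE /= => axy ->.
have xy : x != y by apply: contraTneq axy => ->; rewrite adj_irrefl.
have ayx : adj y x by rewrite adj_sym.
rewrite (bigD1 (x, y)) /= ?inE ?eqxx ?axy // (bigD1 (y, x)) //=.
by rewrite !inE ayx /f setUC eqxx /= xpair_eqE (negPf xy) andbF.
Qed.

(** No edge joins [D] to the outside of [D :|: nb e D], so every edge lies on one of the two sides,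
    and the edges inside [nb e D] lie on both. *)
Lemma e2_cut (T : finType) (e : rel T) (D : {set T}) : symmetric e ->
  e2 setT e + e2 (nb e D) e <= e2 (~: D) e + e2 (D :|: nb e D) e.
Proof.
move=> es; rewrite /e2 -!big_split; apply: leq_sum => x _ /=.
rewrite -!big_split; apply: leq_sum => y _ /=; rewrite !in_setT /=.
case exy: (e x y); last by rewrite !andbF.
have h1 : x \in D -> y \in D :|: nb e D by move/nb_closed; apply.
have h2 : y \in D -> x \in D :|: nb e D by move/nb_closed; apply; rewrite es.
move: h1 h2 (@nb_notin _ e D x) (@nb_notin _ e D y); rewrite !(in_setU, in_setC).
case: (x \in D) (y \in D) (x \in nb e D) (y \in nb e D) => -[] [] [] //=;
  by [move=> /(_ isT)|move=> _ /(_ isT)|move=> _ _ /(_ isT)|move=> _ _ _ /(_ isT)].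
Qed.

(** The filling of a separator: if [q] and all of [S] see a connected [D], then absorbing [D] into
    [q] realises every edge from [q] to [S]. *)
Definition star (T : finType) (e : rel T) q (S : {set T}) : rel T :=
  fun x y => [|| e x y, (x == q) && (y \in S) | (y == q) && (x \in S)].

Lemma star_sym (T : finType) (e : rel T) q S :
  symmetric e -> symmetric (star e q S).
Proof. by move=> es x y; rewrite /star es; congr (_ || _); rewrite orbC. Qed.

Lemma star_irr (T : finType) (e : rel T) q (S : {set T}) :
  q \notin S -> irreflexive e -> irreflexive (star e q S).
Proof.
move=> qS ei x; rewrite /star ei /= orbb.
by have [->|//] := eqVneq x q; rewrite (negPf qS).
Qed.

Lemma e2_star (T : finType) (e : rel T) (A : {set T}) q (S : {set T}) : symmetric e ->
  q \in A -> q \notin S -> S \subset A ->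
  e2 A e + #|[set y in S | ~~ e q y]|.*2 <= e2 A (star e q S).
Proof.
move=> es qA qS SA; rewrite card_sum1 (sum_pt2 q).
rewrite /e2 -!big_split; apply: leq_sum => x _ /=; rewrite -!big_split /=.
apply: leq_sum => y _; rewrite !inE /star.
have := subsetP SA y; have := subsetP SA x.
have [->|_] := eqVneq x q; have [->|_] := eqVneq y q => /=.
- by rewrite (negPf qS) !muln0 !addn0; case: (e q q); rewrite ?andbF // !andbT leqnn.
- rewrite qA mul1n mul0n addn0 => _.
  by case: (y \in S) => [->//|_]; case: (e q y); rewrite ?andbF ?orbF ?addn0.
- rewrite qA mul1n mul0n add0n es => h _.
  by move: h; case: (x \in S) => [->//|_]; case: (e q x); rewrite ?andbF ?orbF ?addn0.
by rewrite !mul0n !addn0 orbF.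
Qed.

Lemma bags1 (T : finType) (e h : rel T) (A : {set T}) :
  subrel h e -> bags e A (fun x => [set x]) h.
Proof.
move=> he; split=> [i _|i _|i j _ _ ij|i j _ _ hij].
- by apply/set0Pn; exists i; rewrite inE.
- exact: conn1.
- by rewrite disjoints1 inE.
- exact/touches1/he.
Qed.

Definition absorb (T : finType) (F : T -> {set T}) q (D : {set T}) x :=
  if x == q then F x :|: D else F x.

Lemma bags_absorb (T : finType) (e h : rel T) (A : {set T}) F q D (S : {set T}) :
  symmetric e -> bags e A F h -> q \in A -> conn e D -> touches e (F q) D ->
  (forall x, x \in A -> [disjoint F x & D]) ->
  (forall x, x \in S -> touches e (F x) D) ->
  bags e A (absorb F q D) (star h q S).
Proof.
move=> es [F0 Fc Fd Ft] qA cD tq dD tS.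
have sub x : F x \subset absorb F q D x.
  by rewrite /absorb; case: ifP => // _; rewrite subsetUl.
split=> [i iA|i iA|i j iA jA ij|i j iA jA].
- have /set0Pn[x xF] := F0 _ iA; apply/set0Pn; exists x; exact: (subsetP (sub i)).
- rewrite /absorb; case: eqP => [->|_]; last exact: Fc.
  by apply: connU => //; [apply: Fc|rewrite tq orbT].
- rewrite /absorb; case: eqP => [iq|_]; case: eqP => [jq|_].
  + by rewrite iq jq eqxx in ij.
  + by rewrite disjoints_subset subUset -!disjoints_subset Fd //=
      disjoint_sym dD.
  + by rewrite disjoint_sym disjoints_subset subUset -!disjoints_subset
      Fd // 1?eq_sym //= disjoint_sym dD.
  + exact: Fd.
case/or3P => [/Ft t|/andP[/eqP-> /tS t]|/andP[/eqP-> /tS t]].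
- by apply: touches_sub (t iA jA).
- rewrite touchesC //; apply: touches_sub t => //.
  by rewrite /absorb eqxx subsetUr.
- by apply: touches_sub t => //; rewrite /absorb eqxx subsetUr.
Qed.

Lemma card_setC1 (T : finType) (x : T) : #|~: [set x]| = #|[set: T]|.-1.
Proof. by rewrite cardsC1 cardsT. Qed.

Lemma card_setC (T : finType) (A : {set T}) : #|A| + #|~: A| = #|[set: T]|.
Proof. by rewrite cardsC cardsT. Qed.

(** * Menger's theorem *)

(** Disjoint connected sets replace disjoint paths: later on only contacts between them matter. *)
Definition linkage (T : finType) (e : rel T) (A B : {set T}) k
    (C : 'I_k -> {set T}) :=
  [/\ forall i, conn e (C i), forall i, C i :&: A != set0,
      forall i, C i :&: B != set0 & forall i j, i != j -> [disjoint C i & C j]].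

(** Disjoint sets, at least as many as [P] has vertices and each meeting [P], contain exactly one
    vertex of [P] apiece. This is the matching along which two linkages are glued. *)
Lemma linkage_ends (T : finType) (P : {set T}) k (C : 'I_k -> {set T}) :
  (forall i, C i :&: P != set0) -> (forall i j, i != j -> [disjoint C i & C j]) ->
  #|P| <= k -> exists p : 'I_k -> T,
  [/\ forall i, p i \in C i, forall i, p i \in P,
      forall z, z \in P -> exists i, p i = z &
      forall z i, z \in P -> z \in C i -> p i = z].
Proof.
move=> meet dis Pk.
have pick i : exists z, z \in C i :&: P by apply/set0Pn.
pose p i := xchoose (pick i).
have pC i : p i \in C i by have := xchooseP (pick i); rewrite inE => /andP[].
have pP i : p i \in P by have := xchooseP (pick i); rewrite inE => /andP[].
have uniqC z i j : z \in C i -> z \in C j -> i = j.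
  move=> zi zj; apply/eqP; apply: contraTT zj => ij.
  by rewrite (disjointFr (dis _ _ ij) zi).
have injp : injective p.
  by move=> i j pij; apply: (uniqC (p i)); rewrite // pij.
have surj z : z \in P -> exists i, p i = z.
  move=> zP; suff : z \in p @: setT by case/imsetP => i _ ->; exists i.
  suff /eqP -> : p @: setT == P by [].
  rewrite eqEcard card_imset // cardsT card_ord Pk andbT.
  by apply/subsetP => _ /imsetP[i _ ->].
exists p; split=> // z i zP zi; have [j pj] := surj z zP.
by rewrite -pj; congr p; apply: (uniqC z) => //; rewrite -pj.
Qed.

(** The sets [C] stay in [X :|: S] and the sets [D] avoid [X], so they meet only in [S]. A member of
    [C] is continued by the member of [D] with the same vertex of [S], and the one through [x]
    crosses the edge to [y]. *)
Lemma menger_glue (T : finType) (e e' : rel T) (A B X S : {set T}) x y k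
    (C D : 'I_k -> {set T}) :
  symmetric e -> subrel e' e -> e x y -> x \in X -> y \notin X ->
  y \notin S -> [disjoint X & S] -> #|S| < k ->
  linkage (fun u v => [&& e' u v, u \in X :|: S & v \in X :|: S]) A (x |: S) C ->
  linkage (fun u v => [&& e' u v, u \notin X & v \notin X]) (y |: S) B D ->
  exists E : 'I_k -> {set T}, linkage e A B E.
Proof.
move=> es ee' exy xX yX yS dXS Sk [Cc CA CP Cd] [Dc DQ DB Dd].
have xS : x \notin S by rewrite (disjointFr dXS).
have Pk : #|x |: S| <= k by rewrite cardsU1 xS.
have Qk : #|y |: S| <= k by rewrite cardsU1 yS.
have [p [pC pP psurj pE]] := linkage_ends CP Cd Pk.
have [q [qD qQ qsurj qE]] := linkage_ends DQ Dd Qk.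
have CX i : C i \subset X :|: S.
  apply: conn_hull (Cc i) (pC i) _ _ => [|u v /and3P[]//].
  by have := pP i; rewrite !inE => /orP[/eqP->|->]; rewrite ?xX ?orbT.
have DX i : D i \subset ~: X.
  apply: conn_hull (Dc i) (qD i) _ _ => [|u v /and3P[] //]; last by rewrite inE.
  have := qQ i; rewrite !inE => /orP[/eqP->//|h].
  by rewrite (disjointFl dXS h).
pose sg z := if z == x then y else z.
have sgQ z : z \in x |: S -> sg z \in y |: S.
  by rewrite /sg !inE; case: eqP => [_|_ /= ->]; rewrite ?eqxx ?orbT.
have sginj : {in x |: S &, injective sg}.
  move=> u v; rewrite /sg !inE; case: eqP => [->|_]; case: eqP => [->|_] //=.
    by move=> _ vS yv; rewrite -yv (negPf yS) in vS.
  by move=> uS _ uy; rewrite uy (negPf yS) in uS.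
have mt i : exists j, q j == sg (p i).
  by have [j <-] := qsurj _ (sgQ _ (pP i)); exists j.
pose m i := xchoose (mt i).
have qm i : q (m i) = sg (p i) by apply/eqP/(xchooseP (mt i)).
have pinj i j : p i = p j -> i = j.
  move=> pij; apply/eqP; apply: contraT => ij.
  by have := disjointFr (Cd _ _ ij) (pC i); rewrite pij pC.
have minj i j : m i = m j -> i = j.
  by move=> mij; apply/pinj/sginj; rewrite ?pP // -!qm mij.
have CD i j z : z \in C i -> z \in D (m j) -> i = j.
  move=> zC zD; have zX : z \notin X by have := subsetP (DX _) _ zD; rewrite inE.
  have zS : z \in S by have := subsetP (CX _) _ zC; rewrite inE (negPf zX).
  have zP : z \in x |: S by rewrite !inE zS orbT.
  have zQ : z \in y |: S by rewrite !inE zS orbT.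
  have pz := pE _ _ zP zC; have qz := qE _ _ zQ zD.
  apply/pinj/sginj; rewrite ?pP // -(qm j) qz pz /sg.
  by case: eqP => // zx; rewrite -zx zS in xS.
exists (fun i => C i :|: D (m i)); split=> [i|i|i|i j ij].
- apply: connU => //.
  + by apply: conn_sub (Cc i) => u v /and3P[/ee'].
  + by apply: conn_sub (Dc _) => u v /and3P[/ee'].
  have := qm i; rewrite /sg; case: eqP => [px|_] qmi.
    apply/orP; right; apply/touchesP; exists x, y.
    by split=> //; [rewrite -px|rewrite -qmi].
  apply/orP; left; apply/set0Pn; exists (p i).
  by rewrite inE pC -qmi qD.
- have /set0Pn[z zC] := CA i; apply/set0Pn; exists z.
  by move: zC; rewrite !inE => /andP[-> ->].
- have /set0Pn[z zD] := DB (m i); apply/set0Pn; exists z.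
  by move: zD; rewrite !inE => /andP[-> ->]; rewrite orbT.
apply/pred0P => z /=; rewrite !inE; apply/negP => /andP[/orP[zi|zi] /orP[zj|zj]].
- by have := disjointFr (Cd _ _ ij) zi; rewrite zj.
- by rewrite (CD _ _ _ zi zj) eqxx in ij.
- by rewrite (CD _ _ _ zj zi) eqxx in ij.
have mij : m i != m j by apply: contraNneq ij => /minj->.
by have := disjointFr (Dd _ _ mij) zi; rewrite zj.
Qed.

(* Goering's induction: if deleting xy destroys the hypothesis, the violating set
   X splits the problem into two smaller ones, glued along S + x and S + y. *)
Lemma menger (T : finType) (e : rel T) (A B : {set T}) k :
  symmetric e -> irreflexive e ->
  (forall X : {set T}, [disjoint X & B] -> k <= #|nb e X :|: (A :\: X)|) ->
  exists C : 'I_k -> {set T}, linkage e A B C.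
Proof.
pose m (e : rel T) := #|[set p : T * T | e p.1 p.2]|.
move: {2}(m e) (leqnn (m e)) => n; elim: n e A B => [|n IH] e A B en es ei cut.
  have noe u v : e u v = false.
    move: en; rewrite leqn0 => /eqP/cards0_eq/setP/(_ (u, v)).
    by rewrite !inE.
  (* Without edges, the set [~: B] has no neighbours, so the hypothesis leaves [k] vertices in
     [A :&: B]; singletons link them. *)
  have : [disjoint ~: B & B] by rewrite -setI_eq0 setIC setICr.
  move=> /cut; have -> : nb e (~: B) = set0.
    by apply/setP => v; rewrite [RHS]inE; apply/nbP => -[_ [u _]]; rewrite noe.
  rewrite set0U setDE setCK => kAB.
  pose f (i : 'I_k) := enum_val (widen_ord kAB i).
  have fAB i : f i \in A :&: B by apply: enum_valP.
  exists (fun i => [set f i]); split=> [i|i|i|i j ij]; first exact: conn1.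
  - by apply/set0Pn; exists (f i); have:= fAB i; rewrite !inE eqxx => /andP[].
  - by apply/set0Pn; exists (f i); have:= fAB i; rewrite !inE eqxx => /andP[].
  rewrite disjoints1 inE /f (inj_eq enum_val_inj) -val_eqE /=.
  by rewrite -val_eqE in ij.
have [e0|] := leqP (m e) n; first exact: IH.
case: (pickP [pred p : T * T | e p.1 p.2]) => [[x0 y0] /= exy0 mn|no]; last first.
  rewrite /m (_ : [set _ | _] = set0) ?cards0 //.
  by apply/setP => p; rewrite !inE; apply: no.
pose e' u v := [&& e u v, (u, v) != (x0, y0) & (v, u) != (x0, y0)].
have e's : symmetric e' by move=> u v; rewrite /e' es; congr (_ && _); rewrite andbC.
have ee' : subrel e' e by move=> u v /and3P[].
have e'i : irreflexive e' by move=> u; rewrite /e' ei.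
have small (r : rel T) : subrel r e' -> m r <= n.
  move=> re'; rewrite -ltnS; apply: leq_trans en.
  apply: proper_card; apply/properP; split.
    by apply/subsetP => p; rewrite !inE => /re' /ee'.
  exists (x0, y0); rewrite !inE //=; apply/negP => /re'.
  by rewrite /e' eqxx andbF.
have [/forallP ok|] := boolP [forall X : {set T},
    [disjoint X & B] ==> (k <= #|nb e' X :|: (A :\: X)|)].
  have [//||C [Cc CA CB Cd]] := IH e' A B (small _ _) e's e'i.
    by move=> X dXB; apply: (implyP (ok X)).
  by exists C; split=> // i; apply: conn_sub (Cc i).
rewrite negb_forall => /existsP[X]; rewrite negb_imply -ltnNge => /andP[dXB].
set S := _ :|: _ => Sk.
have SE z : (z \in S) = (z \in nb e' X) || (z \in A :\: X) by rewrite inE.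
clearbody S.
have kS := leq_trans Sk (cut _ dXB).
(* [S] is too small to contain the cut that [X] had in [e]. A vertex of that cut outside [S] must be
   an end of the deleted edge, which therefore leaves [X]. *)
have [x [y [xX yX exy e'P]]] : exists x y, [/\ x \in X, y \notin X, e x y &
    forall u v, e u v -> [\/ e' u v, u = x /\ v = y | u = y /\ v = x]].
  have [z] : exists z, z \in (nb e X :|: (A :\: X)) :\: S.
    apply/set0Pn; rewrite setD_eq0; apply: contraL kS => /subset_leq_card.
    by rewrite -leqNgt.
  rewrite inE => /andP[zS]; rewrite inE => /orP[|zA]; last first.
    by rewrite SE zA orbT in zS.
  case/nbP => zX [u uX euz].
  have ne' : ~~ e' u z.
    by apply: contra zS => e'uz; rewrite SE (mem_nb uX zX e'uz).
  exists u, z; split=> // a b eab.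
  have [e'ab|ne2] := boolP (e' a b); first by apply: Or31.
  move: ne' ne2; rewrite /e' euz eab !andTb !xpair_eqE -!negb_or !negbK.
  case/orP => /andP[/eqP-> /eqP->] /orP[] /andP[/eqP-> /eqP->];
    by [apply: Or32|apply: Or33].
have yS : y \notin S.
  apply/negP => yS; have : nb e X :|: (A :\: X) \subset S.
    apply/subsetP => z; rewrite inE => /orP[|zA]; last by rewrite SE zA orbT.
    case/nbP => zX [u uX /e'P[e'uz|[_ ->]//|[uy _]]].
      by rewrite SE (mem_nb uX zX e'uz).
    by rewrite uy (negPf yX) in uX.
  by move/subset_leq_card; rewrite leqNgt kS.
have dXS : [disjoint X & S].
  apply/pred0P => z /=; apply/andP => -[zX]; rewrite SE => /orP[/nb_notin|].
    by rewrite zX.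
  by rewrite inE zX.
have [||||C lC] := IH (fun u v => [&& e' u v, u \in X :|: S & v \in X :|: S]) A (x |: S).
- by apply: small => u v /and3P[].
- by move=> u v; rewrite e's [(u \in _) && _]andbC.
- by move=> u; rewrite e'i.
(* Here the original hypothesis is applied to [X1 :&: X]. *)
- move=> X1 dX1; have xX1 : x \notin X1 by rewrite (disjointFl dX1) ?inE ?eqxx.
  have SX1 z : z \in S -> z \notin X1.
    by move=> zS; rewrite (disjointFl dX1) ?inE ?zS ?orbT.
  have dX2 : [disjoint X1 :&: X & B] by apply: disjointWl (subsetIr _ _) dXB.
  apply: leq_trans (cut _ dX2) _; apply/subset_leq_card/subsetP => z.
  rewrite inE => /orP[/nbP[zX2 [u]]|].
    rewrite inE => /andP[uX1 uX] /e'P[e'uz||]; last 2 first.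
    + by case=> ux; rewrite -ux uX1 in xX1.
    + by case=> uy; rewrite -uy uX in yX.
    have zXS : z \in X :|: S.
      by have := nb_closed uX e'uz; rewrite !inE SE => /orP[->//|->]; rewrite orbT.
    have zX1 : z \notin X1.
      apply: contra zX2 => zX1; rewrite inE zX1; move: zXS; rewrite inE.
      by case/orP => // /SX1; rewrite zX1.
    rewrite inE (@mem_nb _ _ _ u) // e'uz zXS andbT /=.
    by rewrite inE uX.
  rewrite inE => /andP[zX2 zA]; rewrite inE; apply/orP; right.
  rewrite inE zA andbT; apply: contra zX2 => zX1; rewrite inE zX1.
  apply: contraT => zX; have zS : z \in S by rewrite SE inE zX zA orbT.
  by have := SX1 _ zS; rewrite zX1.
have [||||D lD] := IH (fun u v => [&& e' u v, u \notin X & v \notin X]) (y |: S) B.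
- by apply: small => u v /and3P[].
- by move=> u v; rewrite e's [(u \notin _) && _]andbC.
- by move=> u; rewrite e'i.
(* Here the original hypothesis is applied to [X :|: X1]. *)
- move=> X1 dX1; have dX2 : [disjoint X :|: X1 & B].
    by rewrite disjoints_subset subUset -!disjoints_subset dXB.
  apply: leq_trans (cut _ dX2) _; apply/subset_leq_card/subsetP => z.
  have inQ : z \notin X -> z \notin X1 -> z \in y |: S ->
      z \in nb (fun u v => [&& e' u v, u \notin X & v \notin X]) X1
         :|: ((y |: S) :\: X1).
    by move=> zX zX1 zQ; rewrite inE; apply/orP; right; rewrite inE zX1.
  rewrite inE => /orP[/nbP[]|]; last first.
    rewrite !inE negb_or => /andP[/andP[zX zX1] zA]; have := inQ zX zX1.
    by rewrite !inE SE inE zX zA !orbT; apply.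
  rewrite inE negb_or => /andP[zX zX1] [u uXX euz].
  have [uX|uX] := boolP (u \in X).
    apply: inQ => //; case: (e'P _ _ euz) => [e'uz|[_ ->]|[uy _]].
    + by rewrite in_setU1 SE (mem_nb uX zX e'uz) orbT.
    + by rewrite !inE eqxx.
    + by rewrite uy (negPf yX) in uX.
  have uX1 : u \in X1 by move: uXX; rewrite inE (negPf uX).
  rewrite inE (@mem_nb _ _ _ u) //= uX zX !andbT.
  by case: (e'P _ _ euz) => [//|[ux _]|[_ zx]]; [rewrite ux xX in uX|rewrite zx xX in zX].
exact: menger_glue es ee' exy xX yX yS dXS Sk lC lD.
Qed.

(** * Exhaustive search over small graphs *)

Definition touching_groups (g : rel nat) (s t : seq nat) :=
  has (fun a => has (g a) t) s.

(** Each group is a star centred at its first element, so its connectivity is a single [all]. *)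
Definition groups_ok (m : nat) (g : rel nat) k (h : rel nat) (gr : seq (seq nat)) :=
  [&& size gr == k, uniq (flatten gr), all (gtn m) (flatten gr),
      all (fun s => if s is i :: t then all (g i) t else false) gr &
      all (fun j => all (fun i => h i j ==>
        touching_groups g (nth [::] gr i) (nth [::] gr j)) (iota 0 j)) (iota 0 k)].

Lemma uniq_flatten_nth (gr : seq (seq nat)) i j x : uniq (flatten gr) ->
  i < j -> x \in nth [::] gr i -> x \notin nth [::] gr j.
Proof.
elim: gr i j => [|s gr IH] [|i] [|j] //=; rewrite ?nth_nil //.
  rewrite cat_uniq => /and3P[_ /hasPn nh _] _ xs.
  apply/negP => xj; suff /nh : x \in flatten gr by rewrite xs.
  apply/flattenP; exists (nth [::] gr j) => //; apply: mem_nth.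
  by rewrite ltnNge; apply/negP => /(nth_default [::]) h; rewrite h in xj.
by rewrite cat_uniq ltnS => /and3P[_ _ u]; apply: (IH i j u).
Qed.

Lemma model_groups (T : finType) (e : rel T) (C : nat -> {set T}) m (g : rel nat)
    k h gr : symmetric e ->
  (forall i, i < m -> C i != set0) -> (forall i, i < m -> conn e (C i)) ->
  (forall i j, i < m -> j < m -> i != j -> [disjoint C i & C j]) ->
  (forall i j, i < m -> j < m -> g i j -> touches e (C i) (C j)) ->
  groups_ok m g k h gr -> model e k h.
Proof.
move=> es C0 Cc Cd Ct /and5P[/eqP sz un /allP ltm /allP st /allP ht].
pose U (s : seq nat) := [set x | has (fun a => x \in C a) s].
have UP s x : reflect (exists2 a, a \in s & x \in C a) (x \in U s).
  by rewrite inE; apply: hasP.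
have lt i a : i < k -> a \in nth [::] gr i -> a < m.
  move=> ik ai; apply: ltm; apply/flattenP; exists (nth [::] gr i) => //.
  by apply: mem_nth; rewrite sz.
exists (fun i => U (nth [::] gr i)); split=> [i ik|i ik|i j ij jk].
- have := st (nth [::] gr i); rewrite mem_nth ?sz // => /(_ isT).
  case E: (nth [::] gr i) => [//|a s] _.
  have /set0Pn[x xa] : C a != set0 by apply/C0/(lt i); rewrite // E inE eqxx.
  by apply/set0Pn; exists x; apply/UP; exists a; rewrite ?inE ?eqxx.
- have := st (nth [::] gr i); rewrite mem_nth ?sz // => /(_ isT).
  have := lt i; case: (nth [::] gr i) => [//|a s] /(_ _ ik) la.
  have am : a < m by apply: la; rewrite inE eqxx.
  elim: s la => [|b s IH] la /= => [_|/andP[gab gas]].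
    rewrite (_ : U _ = C a); first exact: Cc.
    by apply/setP => x; rewrite inE /= orbF.
  have bm : b < m by apply: la; rewrite !inE eqxx orbT.
  rewrite (_ : U _ = U (a :: s) :|: C b); last first.
    by apply/setP => x; rewrite !inE /= orbA orbAC.
  apply: connU => //; first 2 last.
  + apply/orP; right; apply: touches_sub (Ct _ _ am bm gab) => //.
    by apply/subsetP => x xa; apply/UP; exists a; rewrite ?inE ?eqxx.
  + apply: IH => // z; rewrite inE => /orP[/eqP->//|zs].
    by apply: la; rewrite !inE zs !orbT.
  + exact: Cc.
split.
  apply/pred0P => x /=; apply/andP => -[/UP[a ai xa] /UP[b bj xb]].
  have ab : a != b.
    by apply: contraTneq bj => <-; apply: uniq_flatten_nth un ij ai.
  have := Cd _ _ (lt _ _ (ltn_trans ij jk) ai) (lt _ _ jk bj) ab.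
  by move/disjointFr/(_ xa); rewrite xb.
have jk' : j \in iota 0 k by rewrite mem_iota.
have ij' : i \in iota 0 j by rewrite mem_iota.
have /allP/(_ _ ij')/implyP hh := ht _ jk'.
move=> /hh/hasP[a ai /hasP[b bj gab]].
have := Ct _ _ (lt _ _ (ltn_trans ij jk) ai) (lt _ _ jk bj) gab.
by apply: touches_sub => //; apply/subsetP => x xa; apply/UP; [exists a|exists b].
Qed.

(* Exhaustive search over the graphs on x_0, ..., x_(d-1), by deciding one pair
   after the other; a branch is cut when [bad] holds. *)
Definition dec := seq ((nat * nat) * bool).

Fixpoint search (bad good : dec -> bool) (pre : dec) (rem : seq (nat * nat)) :=
  if bad pre then true else
  if rem is p :: rem' then
    search bad good ((p, true) :: pre) rem' && search bad good ((p, false) :: pre) rem'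
  else good pre.

Definition consistent d (E : rel nat) (pre : dec) :=
  all (fun pb => [&& pb.1.1 < pb.1.2, pb.1.2 < d & E pb.1.1 pb.1.2 == pb.2]) pre.

Lemma searchP d bad good (E : rel nat) pre rem : search bad good pre rem ->
  all (fun p => p.1 < p.2 < d) rem -> consistent d E pre ->
  exists2 pre', consistent d E pre' & bad pre' || good pre'.
Proof.
elim: rem pre => [|p rem IH] pre /=; case: ifP => b.
- by move=> _ _ c; exists pre => //; rewrite b.
- by move=> g _ c; exists pre => //; rewrite g orbT.
- by move=> _ _ c; exists pre => //; rewrite b.
case/andP => st sf /andP[/andP[p12 pd] ar] c.
by case Ep: (E p.1 p.2); [apply: (IH _ st)|apply: (IH _ sf)]; rewrite //= p12 pd Ep c.
Qed.

Definition pairs d : seq (nat * nat) := [seq (i, j) | j <- iota 0 d, i <- iota 0 j].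

Definition non_nb (pre : dec) i := flatten
  [seq if pb.2 then [::] else if pb.1.1 == i then [:: pb.1.2] else
       if pb.1.2 == i then [:: pb.1.1] else [::] | pb <- pre].

(** [uniq] is evaluated at run time, which spares an invariant saying that no pair is decided
    twice. *)
Definition bad_at D (pre : dec) i :=
  let s := non_nb pre i in if D < size s then uniq s else false.

(** Only the ends of the pair decided last can newly exceed the bound. *)
Definition bad_deg D (pre : dec) :=
  if pre is (i, j, false) :: _ then
    if bad_at D pre i then true else bad_at D pre j
  else false.

Fixpoint known (pre : dec) i j :=
  if pre is (a, b, v) :: pre' then
    if a == i then if b == j then v else known pre' i j else known pre' i j
  else false.

Definition triangle d (g : rel nat) : seq bitseq :=
  [seq [seq g i j | i <- iota 0 j] | j <- iota 0 d].

Definition trel (M : seq bitseq) : rel nat := fun i j =>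
  if i < j then nth false (nth [::] M j) i else nth false (nth [::] M i) j.

(** Vertices below [d] are the neighbours of the centre, [d] is the centre and [d.+1] the outer set,
    known to touch 0, ..., 4. *)
Definition glocal d (pre : dec) : rel nat :=
  let M := triangle d (known pre) in fun i j =>
  if j < d then if i < d then trel M i j else if i == d then true else j < 5
  else if i < d then if j == d then true else i < 5 else false.

(* Lazy, unlike [has], under call by value. *)
Fixpoint first_some (A B : Type) (f : A -> option B) (s : seq A) : option B :=
  if s is x :: s' then if f x is Some y then Some y else first_some f s' else None.

Fixpoint lhas (A : Type) (a : A -> bool) s :=
  if s is x :: s' then if a x then true else lhas a s' else false.

Fixpoint nonadj (g : rel nat) (gr : seq (seq nat)) :=
  if gr is s :: gr' then
    [seq (s, t) | t <- gr' & ~~ lhas (fun a => lhas (g a) t) s] ++ nonadj g gr'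
  else [::].

(** [hK7] lacks exactly 01 and 23, so at most two nonadjacent pairs are tolerated, they must be
    disjoint, and they are moved to the front. *)
Definition order_groups (g : rel nat) (gr : seq (seq nat)) :=
  match nonadj g gr with
  | [::] => Some gr
  | [:: (a, b)] => Some (a :: b :: [seq s <- gr | s \notin [:: a; b]])
  | [:: (a, b); (c, d)] => if (a \in [:: c; d]) || (b \in [:: c; d]) then None else
      Some [:: a, b, c, d & [seq s <- gr | s \notin [:: a; b; c; d]]]
  | _ => None
  end.

Definition singles n (s : seq nat) := [seq [:: i] | i <- iota 0 n & i \notin s].

(* For d = 7, vertex 7 is the centre and vertex 8 the outer set D; these few
   contractions, found by a greedy search, settle every admissible graph. *)
Definition cand_local d : seq (seq (seq nat)) :=
  if d == 5 then [:: singles 7 [::]] else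
  if d == 6 then [seq [:: 7; z] :: singles 7 [:: z] | z <- iota 0 5] else
  [seq let: (x, y, z) := t in [:: 8; z] :: [:: x; y] :: singles 8 [:: x; y; z] |
     t <- [:: (5, 6, 0); (1, 5, 2); (1, 6, 3); (3, 5, 4); (3, 6, 4); (5, 6, 4);
              (4, 5, 1); (5, 6, 1); (1, 3, 2); (2, 5, 0)]] ++
  singles 9 [:: 5; 6] ::
  [seq let: (x, y, z, t) := t in
       [:: x; y] :: [:: z; t] :: singles 9 [:: x; y; z; t] |
     t <- [:: (2, 5, 3, 6); (0, 5, 1, 6); (4, 5, 2, 6); (3, 5, 4, 6)]].

Definition good_local d cand (pre : dec) :=
  let g := glocal d pre in
  if first_some (fun gr => if all (fun s => if s is i :: t then all (g i) t else false) gr then order_groups g gr else None) cand is Some gr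
  then groups_ok d.+2 g 7 hK7 gr else false.

(** The bound in [bad_deg] is d - 5 in all three cases: each of the d neighbours of the centre is
    adjacent to at least four of the other d - 1. *)
Lemma search_local5 : search (bad_deg 0) (good_local 5 (cand_local 5)) [::] (pairs 5).
Proof. by vm_cast_no_check (erefl true). Qed.

Lemma search_local6 : search (bad_deg 1) (good_local 6 (cand_local 6)) [::] (pairs 6).
Proof. by vm_cast_no_check (erefl true). Qed.

Lemma search_local7 : search (bad_deg 2) (good_local 7 (cand_local 7)) [::] (pairs 7).
Proof. by vm_cast_no_check (erefl true). Qed.

Definition bad_count m (pre : dec) :=
  let s := [seq pb.1 | pb <- pre & ~~ pb.2] in if m < size s then uniq s else false.

Definition gplain d (pre : dec) : rel nat :=
  let M := triangle d (known pre) in fun i j => if i < d then if j < d then trel M i j else false else false.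

Definition good7 (pre : dec) :=
  let g := gplain 7 pre in
  if order_groups g (singles 7 [::]) is Some gr then groups_ok 7 g 7 hK7 gr else false.

Lemma search7 : search (bad_count 1) good7 [::] (pairs 7).
Proof. by vm_cast_no_check (erefl true). Qed.

Definition gcone d (pre : dec) : rel nat :=
  let M := triangle d (known pre) in fun i j =>
  if i < d then if j < d then trel M i j else j == d else if i == d then j < d else false.

Definition cand8 : seq (seq (seq nat)) :=
  [seq [:: p.1; p.2] :: singles 8 [:: p.1; p.2] | p <- pairs 7].

(** Looks for a 4-cycle a b c d of nonadjacent pairs; its diagonals {a, c} and {b, d} become the
    blob pairs {4, 5} and {6, 7}. *)
Definition order_C2 (g : rel nat) :=
  let nn i := [seq j <- iota 0 7 | (j != i) && ~~ g i j] in
  first_some (fun a => if nn a is [:: b; d] then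
    if nn b is [:: a'; c'] then let c := if a' == a then c' else a' in
      Some (singles 8 [:: a; b; c; d] ++ [:: [:: a]; [:: c]; [:: b]; [:: d]]) else None
      else None) (iota 0 7).

(** Eight vertices with 24 edges miss four pairs. None of these contains the cone vertex, and each
    of the other seven vertices is in at most two. *)
Definition bad8 pre := if bad_deg 2 pre then true else bad_count 4 pre.

Definition good8 (pre : dec) :=
  let g := gcone 7 pre in
  if first_some (fun gr =>
      if all (fun s => if s is i :: t then all (g i) t else false) gr
      then order_groups g gr else None) cand8 is Some gr
  then groups_ok 8 g 7 hK7 gr else
  if order_C2 g is Some gr then groups_ok 8 g 8 hC2 gr else false.

Lemma search8 : search bad8 good8 [::] (pairs 7).
Proof. by vm_cast_no_check (erefl true). Qed.

(** * Soundness of the searches *)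

Lemma knownP d E pre i j : consistent d E pre -> known pre i j ->
  [/\ i < j, j < d & E i j].
Proof.
elim: pre => [//|[[a b] v] pre IH] /= /andP[/and3P[ab bd /eqP <-] c].
case: (a =P i) => [ai|_]; last exact: (IH c).
by case: (b =P j) => [bj|_]; [rewrite -ai -bj|exact: (IH c)].
Qed.

Lemma trianglE d E pre i j : consistent d E pre -> i < d -> j < d ->
  symmetric E -> trel (triangle d (known pre)) i j -> E i j.
Proof.
move=> c id jd Es; rewrite /trel /triangle; case: ifP => ij.
  rewrite (nth_map 0) ?size_iota // nth_iota // (nth_map 0) ?size_iota //.
  by rewrite nth_iota // => /(knownP c)[].
have [ji|ji] := ltnP j i.
  rewrite (nth_map 0) ?size_iota // nth_iota // (nth_map 0) ?size_iota //.
  by rewrite nth_iota // => /(knownP c)[_ _]; rewrite Es.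
rewrite (nth_map 0) ?size_iota // nth_iota // add0n nth_default //.
by rewrite size_map size_iota.
Qed.

Lemma non_nbP d E pre i j : symmetric E -> consistent d E pre ->
  j \in non_nb pre i -> [/\ i != j, i < d, j < d & ~~ E i j].
Proof.
move=> Es c /flattenP[s /mapP[[[a b] v] pr ->]] /=.
have /= /and3P[ab bd /eqP Eab] := allP c _ pr.
case: v pr Eab => // _ Eab; case: eqP => [<-|_].
  rewrite inE => /eqP->; rewrite Eab neq_ltn ab bd; split=> //; exact: ltn_trans bd.
case: eqP => [<-|//]; rewrite inE => /eqP->; rewrite Es Eab neq_ltn ab bd orbT.
split=> //; exact: ltn_trans bd.
Qed.

Definition rel_on (T : finType) (e : rel T) (x : nat -> T) : rel nat :=
  fun i j => e (x i) (x j).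

Lemma bad_degF (T : finType) (e : rel T) (x : nat -> T) (N : {set T}) d pre :
  symmetric e -> irreflexive e -> #|N| = d ->
  (forall i, i < d -> x i \in N) ->
  (forall i j, i < d -> j < d -> x i = x j -> i = j) ->
  (forall i, i < d -> 4 <= #|[set y in N | e (x i) y]|) ->
  consistent d (rel_on e x) pre -> bad_deg (d - 5) pre = false.
Proof.
move=> es ei dN xN xinj deg c.
have Es : symmetric (rel_on e x) by move=> i j; rewrite /rel_on es.
have at_ i : i < d -> bad_at (d - 5) pre i = false.
  move=> id; rewrite /bad_at; case: ifP => // sz; apply/negP => un.
  have nnP j : j \in non_nb pre i -> _ := non_nbP Es c.
  pose s := [seq x j | j <- i :: non_nb pre i].
  have ind j : j \in i :: non_nb pre i -> j < d.
    by rewrite inE => /orP[/eqP->//|/nnP[]].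
  have us : uniq s.
    rewrite map_inj_in_uniq /= ?un ?andbT.
      by apply/negP => /nnP[]; rewrite eqxx.
    by move=> a b /ind ad /ind bd; apply: xinj.
  have : #|[set y in s] :|: [set y in N | e (x i) y]| <= #|N|.
    apply/subset_leq_card/subsetP => y; rewrite !inE => /orP[|/andP[]//].
    by case/orP => [/eqP->|/mapP[j /nnP[_ _ jd _] ->]]; apply: xN.
  rewrite cardsU (_ : _ :&: _ = set0); last first.
    apply/setP => y; rewrite inE [RHS]inE; apply/negP; rewrite !inE /= => /andP[].
    case/orP => [/eqP->|/mapP[j /nnP[_ _ _ nE] ->]]; first by rewrite ei andbF.
    by move: nE; rewrite /rel_on => /negPf->; rewrite andbF.
  have -> : #|[set y in s]| = (size (non_nb pre i)).+1.
    by rewrite cardsE (card_uniqP us) size_map.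
  by rewrite cards0 subn0 dN; have := deg i id; lia.
rewrite /bad_deg; case: pre c at_ => [//|[[i j] [//|]] pre] /=.
by case/andP => /and3P[ij jd _] _ at_; rewrite !at_ // (ltn_trans ij).
Qed.

Lemma bad_countF (T : finType) (e : rel T) (x : nat -> T) d m pre :
  symmetric e -> irreflexive e ->
  (forall i j, i < d -> j < d -> x i = x j -> i = j) ->
  #|T| * #|T|.-1 < m.+1.*2 + e2 setT e ->
  consistent d (rel_on e x) pre -> bad_count m pre = false.
Proof.
move=> es ei xinj cnt c; rewrite /bad_count.
pose fl := [seq pb.1 | pb <- pre & ~~ pb.2]; rewrite -/fl.
case: ifP => // sz; apply/negP => un.
have flP p : p \in fl -> [/\ p.1 < p.2, p.2 < d & ~~ e (x p.1) (x p.2)].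
  case/mapP => pb; rewrite mem_filter => /andP[/negPf v pr] ->.
  by have /and3P[? ? /eqP] := allP c _ pr; rewrite v /rel_on => ->.
clearbody fl.
pose sw (p : T * T) := (p.2, p.1).
pose f (p : nat * nat) := (x p.1, x p.2).
pose Z := map f fl ++ map (sw \o f) fl.
have flt p : p \in fl -> p.1 < d by case/flP => ? ? _; apply: ltn_trans (_ : _ < p.2) _.
have flt2 p : p \in fl -> p.2 < d by case/flP.
have uZ : uniq Z.
  rewrite cat_uniq !map_inj_in_uniq ?un /= ?andbT.
  - apply/hasPn => _ /mapP[p pfl ->]; apply/negP => /mapP[q qfl] [/xinj h1 /xinj h2].
    have [p12 _ _] := flP _ pfl; have [q12 _ _] := flP _ qfl.
    move: p12; rewrite (h1 (flt2 _ pfl) (flt _ qfl)) (h2 (flt _ pfl) (flt2 _ qfl)).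
    by move=> qq; have := ltn_trans q12 qq; rewrite ltnn.
  - move=> [a b] [a' b'] pfl qfl [/xinj h2 /xinj h1].
    by rewrite (h1 (flt _ pfl) (flt _ qfl)) (h2 (flt2 _ pfl) (flt2 _ qfl)).
  move=> [a b] [a' b'] pfl qfl [/xinj h1 /xinj h2].
  by rewrite (h1 (flt _ pfl) (flt _ qfl)) (h2 (flt2 _ pfl) (flt2 _ qfl)).
have: #|[set p in Z]| + e2 setT e <= #|T| * #|T|.-1.
  have -> : #|T| * #|T|.-1 = \sum_(x : T) \sum_(y : T) (x != y).
    rewrite -sum_nat_const; apply: eq_bigr => a _.
    rewrite -(cardC1 a) cardE -sum1_size /= [RHS](eq_bigr (fun y => (y \in predC1 a) : nat)).
      by rewrite -big_mkcond /= big_enum sum1_card -sum1_card.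
    by move=> y _; rewrite inE eq_sym.
  rewrite card_sum1 (eq_bigr (fun p => ((p.1, p.2) \in [set p in Z]) : nat)); last by case.
  rewrite -(pair_big predT predT (fun a b => ((a, b) \in [set p in Z]) : nat)) /=.
  rewrite /e2 -big_split; apply: leq_sum => a _; rewrite -big_split.
  apply: leq_sum => b _; rewrite !inE /=.
  case: (boolP ((a, b) \in Z)) => [|_]; last first.
    by have [->|_] := eqVneq a b; [rewrite ei|case: (e a b)].
  rewrite mem_cat => /orP[] /mapP[p pfl] [-> ->]; have [lt lt2 /negPf E] := flP _ pfl.
    rewrite E addn0 lt0b; apply/eqP => /xinj h.
    by move: lt; rewrite (h (flt _ pfl) lt2) ltnn.
  rewrite es E addn0 lt0b; apply/eqP => /xinj h.
  by move: lt; rewrite (h lt2 (flt _ pfl)) ltnn.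
rewrite cardsE (card_uniqP uZ) size_cat !size_map; move: sz cnt; lia.
Qed.

Lemma pairs_lt d : all (fun p => p.1 < p.2 < d) (pairs d).
Proof.
apply/allP => p /allpairsPdep[j [i [+ + ->]]]; rewrite !mem_iota /=.
by rewrite !add0n => -> ->.
Qed.

Lemma dense7_model (T : finType) (e : rel T) : symmetric e -> irreflexive e ->
  #|T| = 7 -> 40 <= e2 setT e -> model e 7 hK7.
Proof.
move=> es ei T7 e40.
have [x0 _] : exists x0 : T, x0 \in setT by apply/card_gt0P; rewrite cardsT T7.
pose x := nth x0 (enum T); have sz : size (enum T) = 7 by rewrite -cardE T7.
have xinj i j : i < 7 -> j < 7 -> x i = x j -> i = j.
  by move=> i7 j7 /eqP; rewrite nth_uniq ?sz ?enum_uniq // => /eqP.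
have Es : symmetric (rel_on e x) by move=> i j; rewrite /rel_on es.
have [||pre c bg] := @searchP 7 _ _ (rel_on e x) [::] _ search7.
- exact: pairs_lt.
- by [].
case/orP: bg => [|].
- rewrite (bad_countF es ei xinj _ c) // T7; move: e40; lia.
rewrite /good7; case: order_groups => // gr.
apply: (model_groups (C := fun i => [set x i])) => // [i _|i _|i j i7 j7 ij|i j i7 j7].
- by apply/set0Pn; exists (x i); rewrite inE.
- exact: conn1.
- by rewrite disjoints1 inE; apply: contraNneq ij => /xinj->.
by rewrite /gplain i7 j7 => /(trianglE c i7 j7 Es); apply: touches1.
Qed.

Lemma cone8_model (T : finType) (e : rel T) c : symmetric e -> irreflexive e ->
  #|T| = 8 -> e2 setT e = 48 -> (forall y, y != c -> e c y) ->
  (forall y, y != c -> 4 <= #|[set z in ~: [set c] | e y z]|) ->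
  model e 7 hK7 \/ model e 8 hC2.
Proof.
move=> es ei T8 e48 ce deg; pose N := ~: [set c].
have N7 : #|N| = 7 by rewrite cardsC1 T8.
pose x := nth c (enum N); have sz : size (enum N) = 7 by rewrite -cardE N7.
have xinj i j : i < 7 -> j < 7 -> x i = x j -> i = j.
  by move=> i7 j7 /eqP; rewrite nth_uniq ?sz ?enum_uniq // => /eqP.
have xN i : i < 7 -> x i \in N by move=> i7; rewrite -mem_enum mem_nth ?sz.
have xc i : i < 7 -> x i != c by move=> /xN; rewrite !inE.
have Es : symmetric (rel_on e x) by move=> i j; rewrite /rel_on es.
pose C i := if i < 7 then [set x i] else [set c].
have mg k (h g : rel nat) gr : (forall i j, i < 8 -> j < 8 -> g i j -> touches e (C i) (C j)) ->
    groups_ok 8 g k h gr -> model e k h.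
  move=> gt; apply: (@model_groups _ _ C 8) => // [i _|i _|i j i8 j8 ij].
  - rewrite /C; case: ifP => _; apply/set0Pn; [exists (x i)|exists c];
      by rewrite inE.
  - by rewrite /C; case: ifP => _; apply: conn1.
  rewrite /C; case: ifP => i7; case: ifP => j7; rewrite disjoints1 inE.
  - by apply: contraNneq ij => /xinj->.
  - exact: xc.
  - by rewrite eq_sym xc.
  by move: ij i7 j7; lia.
have [||pre co bg] := @searchP 7 _ _ (rel_on e x) [::] _ search8.
- exact: pairs_lt.
- by [].
case/orP: bg => [|].
- rewrite /bad8 -[2]/(7 - 5) (bad_degF (N := N) es ei _ xN xinj _ co) //.
    by rewrite (bad_countF es ei xinj _ co) // T8 e48.
  by move=> i i7; apply/deg/xc.
have gt i j : i < 8 -> j < 8 -> gcone 7 pre i j -> touches e (C i) (C j).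
  move=> i8 j8; rewrite /gcone /C; case: ifP => i7; last first.
    by case: eqP => // _ j7; rewrite j7; apply: touches1; apply: ce; apply: xc.
  case: ifP => j7; first by move/(trianglE co i7 j7 Es); apply: touches1.
  by move=> _; apply: touches1; rewrite es; apply: ce; apply: xc.
rewrite /good8; case: first_some => [gr ok|]; first by left; apply: mg gt ok.
by case: order_C2 => // gr ok; right; apply: mg gt ok.
Qed.

Lemma local_model (T : finType) (e : rel T) c (D : {set T}) :
  symmetric e -> irreflexive e -> 5 <= #|[set y | e c y]| <= 7 ->
  (forall x, e c x -> 4 <= #|[set y in [set y | e c y] | e x y]|) ->
  conn e D -> c \notin D -> [disjoint D & [set y | e c y]] ->
  5 <= #|nb e D :&: [set y | e c y]| -> model e 7 hK7.
Proof.
move=> es ei; set N := [set y | e c y]; move=> dN deg cD cnD dDN five.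
pose d := #|N|; pose S := nb e D :&: N.
(* The neighbours that see [D] come first, so that 0, ..., 4 are among them, as [glocal] assumes. *)
pose xs := enum S ++ enum (N :\: S).
have xsN y : (y \in xs) = (y \in N).
  rewrite mem_cat !mem_enum in_setD in_setI.
  by case: (y \in nb e D); case: (y \in N).
have uxs : uniq xs.
  rewrite cat_uniq !enum_uniq andbT /=; apply/hasPn => y; rewrite !mem_enum.
  by rewrite in_setD => /andP[].
have sz : size xs = d by rewrite /d cardE; apply: perm_size; apply: uniq_perm;
  rewrite ?enum_uniq // => y; rewrite xsN mem_enum.
pose x := nth c xs.
have xinj i j : i < d -> j < d -> x i = x j -> i = j.
  by move=> id jd /eqP; rewrite nth_uniq ?sz // => /eqP.
have xN i : i < d -> x i \in N by move=> id; rewrite -xsN mem_nth ?sz.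
have xe i : i < d -> e c (x i) by move=> /xN; rewrite inE.
have xS i : i < 5 -> touches e [set x i] D.
  move=> i5; have : x i \in S.
    rewrite /x nth_cat -cardE (leq_trans i5 five) -mem_enum mem_nth //.
    by rewrite -cardE (leq_trans i5 five).
  rewrite inE => /andP[/nbP[_ [u uD eu]] _]; apply/touchesP.
  by exists (x i), u; rewrite inE eqxx uD es.
have Es : symmetric (rel_on e x) by move=> i j; rewrite /rel_on es.
have degx i : i < d -> 4 <= #|[set y in N | e (x i) y]| by move/xe/deg.
have D0 : D != set0.
  case/card_gt0P: (leq_trans (isT : 0 < 5) five) => y; rewrite inE => /andP[].
  by case/nbP => _ [u uD _] _; apply/set0Pn; exists u.
pose C i := if i < d then [set x i] else if i == d then [set c] else D.
suff [pre co ok] : exists2 pre, consistent d (rel_on e x) pre &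
    good_local d (cand_local d) pre.
  move: ok; rewrite /good_local; case: first_some => // gr.
  apply: (@model_groups _ _ C d.+2) => // [i _|i _|i j id jd ij|i j id jd].
  - rewrite /C; case: ifP => _; [|case: ifP => // _]; apply/set0Pn;
      by [exists (x i); rewrite inE|exists c; rewrite inE].
  - by rewrite /C; case: ifP => _; [|case: ifP => // _]; apply: conn1.
  - rewrite /C; case: ifP => i1; [|case: ifP => i2]; (case: ifP => j1; [|case: ifP => j2]).
    + by rewrite disjoints1 inE; apply: contraNneq ij => /xinj->.
    + rewrite disjoints1 inE; apply: contraTneq (xe _ i1) => ->; by rewrite ei.
    + by rewrite disjoints1 (disjointFl dDN) // xN.
    + rewrite disjoints1 inE; apply: contraTneq (xe _ j1) => <-; by rewrite ei.
    + by move: ij; rewrite (eqP i2) (eqP j2) eqxx.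
    + by rewrite disjoints1.
    + by rewrite disjoint_sym disjoints1 (disjointFl dDN) // xN.
    + by rewrite disjoint_sym disjoints1.
    + by move: ij id jd i1 i2 j1 j2; lia.
  rewrite /glocal /C; case: ifP => j1; case: ifP => i1 //.
  - by move/(trianglE co i1 j1 Es); apply: touches1.
  - case: ifP => i2; first by move=> _; apply/touches1/xe.
    by rewrite touchesC //; apply: xS.
  case: ifP => j2; first by move=> _; apply: touches1; rewrite es xe.
  exact: xS.
have use D' cand : D' = d - 5 -> search (bad_deg D') (good_local d cand) [::] (pairs d) ->
    exists2 pre, consistent d (rel_on e x) pre & good_local d cand pre.
  move=> -> sr; have [||pre co bg] := @searchP d _ _ (rel_on e x) [::] _ sr.
  - exact: pairs_lt.
  - by [].
  exists pre => //; move: bg.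
  by rewrite (bad_degF (N := N) es ei _ xN xinj _ co).
have [d5|[d6|d7]] : d = 5 \/ d = 6 \/ d = 7 by move: dN; rewrite -/d; lia.
- have h := use 0 (cand_local d); move: h; rewrite d5 => h; exact: (h erefl search_local5).
- have h := use 1 (cand_local d); move: h; rewrite d6 => h; exact: (h erefl search_local6).
have h := use 2 (cand_local d); move: h; rewrite d7 => h; exact: (h erefl search_local7).
Qed.

(** * Minimal counterexamples to the edge bound *)

Lemma bags_star (T : finType) (e : rel T) (A D S : {set T}) q :
  symmetric e -> [disjoint A & D] -> conn e D ->
  q \in A -> S \subset A ->
  (forall x, x \in q |: S -> touches e [set x] D) ->
  bags e A (absorb (fun x => [set x]) q D) (star e q S).
Proof.
move=> es dAD cD qA SA tS; apply: bags_absorb => //.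
- exact: bags1.
- by apply: tS; rewrite setU11.
- by move=> x xA; rewrite disjoints1 (disjointFr dAD).
by move=> x xS; apply: tS; rewrite setU1r.
Qed.

(* A minimal counterexample to: 4n - 8 edges force K_7^= or C2. *)
Record critical (T : finType) (e : rel T) : Prop := Critical {
  cr_sym : symmetric e;
  cr_irr : irreflexive e;
  cr_noK7 : ~ model e 7 hK7;
  cr_noC2 : ~ model e 8 hC2;
  cr_big : 3 <= #|[set: T]|;
  cr_dense : 8 * #|[set: T]| <= e2 setT e + 16;
  cr_min : forall (A : {set T}) F (h : rel T), symmetric h -> irreflexive h ->
    bags e A F h -> 3 <= #|A| -> #|A| < #|[set: T]| \/ e2 A h < e2 setT e ->
    e2 A h + 18 <= 8 * #|A| }.

Section Critical.
Variables (T : finType) (e : rel T).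
Hypothesis cr : critical e.
Let es := cr_sym cr.
Let ei := cr_irr cr.
Implicit Types (x y z : T) (A D S X Y : {set T}).

Definition N x := [set y | e x y].

(** Deleting one edge lowers [e2] by 2, and minimality of the result gives the upper bound. *)
Lemma cr_e2 : e2 setT e + 16 = 8 * #|[set: T]|.
Proof.
apply/eqP; rewrite eqn_leq cr_dense // andbT.
case: (pickP [pred p : T * T | e p.1 p.2]) => [[x y] /= exy|no]; last first.
  rewrite /e2 big1 => [|x _]; first by have := cr_big cr; lia.
  by rewrite big1 // => y _; rewrite !inE; have /= -> := no (x, y).
pose h u v := [&& e u v, (u, v) != (x, y) & (v, u) != (x, y)].
have hs : symmetric h by move=> u v; rewrite /h es; congr (_ && _); rewrite andbC.
have hi : irreflexive h by move=> u; rewrite /h ei.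
have sum1 a b : \sum_(u : T) \sum_(v : T) (u == a) * (v == b) = 1.
  rewrite (sum_pt a (fun v => v == b)) (bigD1 b) //= eqxx big1 // => v /negPf.
  by move->.
have up : e2 setT e <= e2 setT h + 2.
  rewrite -[2]/(1 + 1) -{1}(sum1 x y) -(sum1 y x) /e2 -!big_split.
  apply: leq_sum => u _ /=; rewrite -!big_split; apply: leq_sum => v _ /=.
  rewrite !inE /h !xpair_eqE /=; case: (e u v) => //=.
  by case: (u == x); case: (v == y); case: (u == y); case: (v == x).
have dn : e2 setT h < e2 setT e.
  rewrite -addn1 -(sum1 x y) /e2 -big_split.
  apply: leq_sum => u _ /=; rewrite -!big_split; apply: leq_sum => v _ /=.
  rewrite !inE /h !xpair_eqE /=.
  have [->|_] := eqVneq u x; last by case: (e u v) => //=; case: (_ && _).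
  have [->|_] := eqVneq v y; first by rewrite exy.
  by case: (e x v) => //=; case: (_ && _).
have he : subrel h e by move=> u v /and3P[].
have := cr_min cr hs hi (bags1 setT he) _ (or_intror dn).
by move=> /(_ (cr_big cr)); lia.
Qed.

Lemma cr_sub A : 3 <= #|A| -> #|A| < #|[set: T]| -> e2 A e + 18 <= 8 * #|A|.
Proof. by move=> A3 AT; apply: (cr_min cr es ei (bags1 A (fun _ _ => id))) => //; left. Qed.

Lemma cr_fill A D q S : 3 <= #|A| -> [disjoint A & D] -> conn e D ->
  q \in A -> q \notin S -> S \subset A ->
  (forall x, x \in q |: S -> touches e [set x] D) ->
  e2 A e + #|[set y in S | ~~ e q y]|.*2 + 18 <= 8 * #|A|.
Proof.
move=> A3 dAD cD qA qS SA tS; apply: leq_trans (_ : e2 A (star e q S) + 18 <= _).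
  by rewrite leq_add2r; apply: e2_star.
apply: (cr_min cr) (bags_star es dAD cD qA SA tS) A3 _.
- exact: star_sym.
- exact: star_irr.
left; have /touchesP[_ [d [_ dD _]]] := tS q (setU11 _ _).
apply: proper_card; rewrite properT; apply/negP => /eqP AT.
by have := disjointFl dAD dD; rewrite AT inE.
Qed.

(** Contracting [x z] loses this edge and one more for each common neighbour. The bound 4n - 8 drops
    by four and the contracted graph must lie below it, so at least five edges are lost. *)
Lemma cr_common x z : e x z -> 4 <= #|N x :&: N z|.
Proof.
move=> exz; have xz : x != z by apply: contraTneq exz => ->; rewrite ei.
have := @cr_fill (~: [set z]) [set z] x (N z :\ x) _ _ (@conn1 _ _ _) _ _ _ _.
have := e2D1 es ei (in_setT z); rewrite setTD.
have -> : #|[set y in setT | e z y]| = #|N z| by apply: eq_card => y; rewrite !inE.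
rewrite (cardsD1 x (N z)) inE es exz /= -(cardsID [set y | e x y]).
rewrite [_ :&: [set y | e x y]](_ : _ = N x :&: N z); last first.
  apply/setP => y; rewrite !inE; have [->|_] := eqVneq y x; first by rewrite ei.
  by rewrite andbC.
rewrite [_ :\: [set y | e x y]](_ : _ = [set y in N z :\ x | ~~ e x y]); last first.
  by apply/setP => y; rewrite !inE andbC.
rewrite card_setC1 => eq h; have := cr_big cr; have := cr_e2.
suff : e2 [set~ z] e + #|[set y in N z :\ x | ~~ e x y]|.*2 + 18 <= 8 * #|[set: T]|.-1.
  by move: eq; clear; lia.
have [T4|T3] := leqP 4 #|[set: T]|.
  apply: h; rewrite ?inE ?eqxx ?(xz) ?card_setC1 //.
  - by move: T4; clear; lia.
  - by rewrite disjoint_sym disjoints1 !inE eqxx.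
  - by apply/subsetP => y; rewrite !inE => /andP[_ ezy]; apply: contraTneq ezy => ->;
      rewrite ei.
  move=> y; rewrite !inE => /orP[/eqP->|/andP[_ ezy]]; apply: touches1 => //.
  by rewrite es.
have := e2_bound setT ei.
by have := cr_e2; have := cr_big cr; move: T3; clear; nia.
Qed.

(** The inequality 8n - 16 <= n(n - 1) fails for 3 <= n <= 6, and seven vertices with 20 edges are
    settled by [dense7_model]. *)
Lemma cr_card8 : 8 <= #|[set: T]|.
Proof.
have bd := e2_bound setT ei; have e2T := cr_e2; have n3 := cr_big cr.
rewrite ltn_neqAle leqNgt; apply/andP; split; last first.
  by rewrite -leqNgt; move: bd e2T n3; clear; case: #|[set: T]| => [|[|[|[|[|[|[|n]]]]]]] //; lia.
apply/eqP => n7; case: (cr_noK7 cr); apply: dense7_model => //.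
  by rewrite -cardsT -n7.
by move: e2T; rewrite -n7; lia.
Qed.

Lemma cr_deg x : 5 <= #|N x|.
Proof.
have [/set0Pn[z]|] := boolP (N x != set0).
  rewrite inE => exz; apply: leq_ltn_trans (cr_common exz) _; rewrite (cardsD1 z (N x)) inE exz add1n ltnS.
  apply/subset_leq_card/subsetP => y; rewrite !inE => /andP[-> ezy].
  by rewrite andbT; apply: contraTneq ezy => ->; rewrite ei.
rewrite negbK => /eqP N0; have := cr_e2; rewrite (e2D1 es ei (in_setT x)) setTD.
rewrite (_ : [set y in setT | e x y] = set0) ?cards0; last first.
  by rewrite -N0; apply/setP => y; rewrite !inE.
have := @cr_sub (~: [set x]); rewrite card_setC1.
by have := cr_card8; lia.
Qed.
End Critical.

(** * Small separators and vertices of small degree *)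

Section Separators.
Variables (T : finType) (e : rel T).
Hypothesis cr : critical e.
Let es := cr_sym cr.
Let ei := cr_irr cr.
Implicit Types (x y z : T) (A D S X Y : {set T}).
Local Notation N := (N e).
Local Notation nb := (nb e).

Lemma card_closure X : #|X :|: nb X| = #|X| + #|nb X|.
Proof.
rewrite cardsU (_ : X :&: nb X = set0) ?cards0 ?subn0 //.
by apply/setP => y; rewrite !inE; apply/negP => /andP[yX /nb_notin]; rewrite yX.
Qed.

Lemma nbr_closure X x : x \in X -> N x \subset X :|: nb X.
Proof. by move=> xX; apply/subsetP => y; rewrite inE; apply: nb_closed. Qed.

Lemma nb_sub_disjoint X Y x y : [disjoint Y & X :|: nb X] -> y \in Y ->
  e y x -> x \notin X.
Proof.
move=> d yY eyx; apply: contraFN (disjointFr d yY) => xX.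
by apply: nb_closed xX _; rewrite es.
Qed.

Lemma card3_closed Y x : x \in Y -> N x \subset Y -> 3 <= #|Y|.
Proof. by move=> _ /subset_leq_card; have := cr_deg cr x; lia. Qed.

Lemma cr_fill_left D X q : conn e D -> X != set0 -> [disjoint X & D :|: nb D] ->
  q \in nb D ->
  e2 (~: D) e + #|[set y in nb D :\ q | ~~ e q y]|.*2 + 18 <= 8 * #|~: D|.
Proof.
move=> cD /set0Pn[x xX] dX qD; apply: (cr_fill cr (D := D)) => //.
- have xD : x \in ~: D.
    by have := disjointFr dX xX; rewrite !inE => /norP[].
  apply: (card3_closed xD); apply/subsetP => y; rewrite !inE.
  exact: nb_sub_disjoint dX xX.
- by rewrite disjoint_sym disjoints_subset setCK.
- by rewrite inE (nb_notin qD).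
- by rewrite !inE eqxx.
- by apply/subsetP => y; rewrite !inE => /andP[_ /nb_notin].
move=> y; rewrite setD1K // => /nbP[_ [d dD edy]]; apply/touchesP.
by exists y, d; rewrite inE eqxx es.
Qed.

Lemma cr_fill_right D X q : D != set0 -> conn e X -> [disjoint X & D :|: nb D] ->
  q \in nb D -> (forall s, s \in nb D -> touches e [set s] X) ->
  e2 (D :|: nb D) e + #|[set y in nb D :\ q | ~~ e q y]|.*2 + 18
    <= 8 * #|D :|: nb D|.
Proof.
move=> /set0Pn[d dD] cX dX qD tX; apply: (cr_fill cr (D := X)) => //.
- apply: (card3_closed (x := d)); first by rewrite inE dD.
  exact: nbr_closure.
- by rewrite disjoint_sym.
- by rewrite inE qD orbT.
- by rewrite !inE eqxx.
- by apply/subsetP => y; rewrite !inE => /andP[_ ->]; rewrite orbT.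
by move=> y; rewrite setD1K //; apply: tX.
Qed.

Lemma sum_missing S :
  \sum_(q in S) #|[set y in S :\ q | ~~ e q y]| + e2 S e = #|S| * #|S|.-1.
Proof.
rewrite e2_deg -big_split -sum_nat_const; apply: eq_bigr => q qS /=.
rewrite [in RHS](cardsD1 q S) qS add1n /= -(cardsID [set y | e q y] (S :\ q)) addnC.
congr (_ + _); apply: eq_card => y; rewrite !inE.
  by have [->|] := eqVneq y q; rewrite ?ei ?andbF.
by rewrite andbC.
Qed.

(** Let S be [nb D], k its size and m(q) the number of nonneighbours of [q] in S. The two fillings
    at [q] add up to e2(S) + 4 m(q) + 20 <= 8k. Summing over [q], where the m(q) and e2(S) total k(k
    - 1), and bounding e2(S) by k(k - 1), gives (k - 4)(k - 5) <= 0, which is false for 1 <= k <=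
    3. *)
Lemma cr_sep D X : conn e D -> D != set0 -> conn e X -> X != set0 ->
  [disjoint X & D :|: nb D] -> nb D \subset nb X -> 4 <= #|nb D|.
Proof.
move=> cD D0 cX X0 dX sub; rewrite leqNgt; apply/negP => k3.
have tX s : s \in nb D -> touches e [set s] X.
  move/(subsetP sub)/nbP => [_ [x xX exs]]; apply/touchesP.
  by exists s, x; rewrite inE eqxx es.
have cut := e2_cut D es; have e2T := cr_e2 cr.
have sz : #|~: D| + #|D :|: nb D| = #|[set: T]| + #|nb D|.
  by rewrite card_closure -(card_setC D); lia.
have [S0|] := eqVneq (nb D) set0.
  have /set0Pn[d dD] := D0; have /set0Pn[x xX] := X0.
  have xD : x \in ~: D by have := disjointFr dX xX; rewrite !inE => /norP[].
  have h1 : e2 (~: D) e + 18 <= 8 * #|~: D|.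
    apply: (cr_sub cr); last by move: D0 (card_setC D); rewrite -card_gt0; lia.
    apply: (card3_closed xD); apply/subsetP => y; rewrite !inE.
    exact: nb_sub_disjoint dX xX.
  have h2 : e2 (D :|: nb D) e + 18 <= 8 * #|D :|: nb D|.
    apply: (cr_sub cr).
      by apply: (card3_closed (x := d)); rewrite ?nbr_closure // inE dD.
    apply: proper_card; rewrite properT; apply/negP => /eqP DT.
    by have := disjointFr dX xX; rewrite DT inE.
  by move: h1 h2 cut sz e2T; rewrite S0 cards0; lia.
case/set0Pn => q0 q0D.
have : \sum_(q in nb D) (e2 (nb D) e + 4 * #|[set y in nb D :\ q | ~~ e q y]| + 20)
    <= \sum_(q in nb D) 8 * #|nb D|.
  apply: leq_sum => q qD; have := cr_fill_left cD X0 dX qD.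
  by have := cr_fill_right D0 cX dX qD tX; lia.
rewrite !big_split /= !sum_nat_const.
have := sum_missing (nb D); have := e2_bound (nb D) ei.
have : 0 < #|nb D| by apply/card_gt0P; exists q0.
move: k3; case: #|nb D| => [|[|[|[|k]]]] //; lia.
Qed.

(** [cr_sep] wants connected sides that both see the whole separator. Take a component [X1] of [X],
    then the component [D] of [b] beyond its neighbours: [nb D] lies in [nb X1], hence in [nb X]. *)
Lemma cr_conn4 X b : X != set0 -> b \notin X :|: nb X -> 4 <= #|nb X|.
Proof.
case/set0Pn => x xX bX.
have [X1 [xX1 sX1 cX1 clX1]] := component es xX.
have nX1 : nb X1 \subset nb X.
  apply/subsetP => y /nbP[yX1 [u uX1 euy]].
  apply: (mem_nb (subsetP sX1 _ uX1) _ euy).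
  by apply: contra yX1 => yX; apply: (clX1 _ _ uX1 yX euy).
have bA : b \in ~: (X1 :|: nb X1).
  by rewrite inE; apply: contra bX; apply: subsetP; apply: setUSS.
have [D [bD sD cD clD]] := component es bA.
have dX1 : [disjoint X1 & D :|: nb D].
  apply/pred0P => y /=; apply/negP => /andP[yX1]; rewrite inE => /orP[yD|].
    by have := subsetP sD _ yD; rewrite !inE yX1.
  case/nbP => _ [u uD euy]; have := subsetP sD _ uD.
  by rewrite inE (nb_closed yX1) // es.
have sDX : nb D \subset nb X1.
  apply/subsetP => y /nbP[yD [u uD euy]]; apply: contraT => yX1.
  have yA : y \in ~: (X1 :|: nb X1).
    rewrite !inE negb_or yX1 andbT; apply: contraFN (disjointFl dX1 _) => [h|].
      exact: h.
    by rewrite inE (mem_nb uD yD euy) orbT.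
  by rewrite (clD _ _ uD yA euy) in yD.
apply: leq_trans (subset_leq_card (subset_trans sDX nX1)).
apply: cr_sep cX1 _ dX1 sDX => //; first by apply/set0Pn; exists b.
by apply/set0Pn; exists x.
Qed.

(** Suppose all degrees in [X] are at least 8. Inside [X :|: nb X] a vertex of [nb X] has five
    neighbours, one in [X] and four common with it, so [e2] is at least 8|X| + 5|nb X|. Minimality
    allows 8|X| + 8|nb X| - 18, which would force |nb X| >= 6. *)
Lemma cr_low X b : X != set0 -> b \notin X :|: nb X -> #|nb X| <= 5 ->
  exists2 c, c \in X & #|N c| <= 7.
Proof.
move=> X0 bX k5; case: (pickP [pred c in X | #|N c| <= 7]) => [c /= /andP[cX c7]|no].
  by exists c.
have hi c : c \in X -> 8 <= #|N c|.
  by move=> cX; have /= := no c; rewrite cX /= => /negbT; rewrite -ltnNge.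
have /set0Pn[x xX] := X0.
pose A := X :|: nb X.
have A3 : 3 <= #|A|.
  by apply: (card3_closed (x := x)); rewrite ?nbr_closure // inE xX.
have AT : #|A| < #|[set: T]|.
  apply: proper_card; rewrite properT; apply/negP => /eqP AT.
  by move: bX; rewrite -/A AT inE.
have := cr_sub cr A3 AT; rewrite e2_deg /A card_closure.
rewrite (big_setID X) /= (_ : (X :|: nb X) :&: X = X); last first.
  by apply/setP => y; rewrite !inE; case: (y \in X); rewrite ?andbF.
rewrite (_ : _ :\: X = nb X); last first.
  apply/setP => y; rewrite !inE.
  by case: (boolP (y \in nb X)) => [/nb_notin->//|_]; case: (y \in X).
suff : 8 * #|X| + 5 * #|nb X| <= \sum_(i in X) #|[set y in X :|: nb X | e i y]|
     + \sum_(i in nb X) #|[set y in X :|: nb X | e i y]|.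
  by move: k5; clear; lia.
rewrite mulnC [5 * _]mulnC -!sum_nat_const; apply: leq_add; apply: leq_sum => i iX.
  apply: leq_trans (hi _ iX) _; apply/subset_leq_card/subsetP => y.
  by rewrite !inE => eiy; rewrite eiy andbT; have := nb_closed iX eiy; rewrite inE.
have /nbP[_ [u uX eui]] := iX.
apply: leq_trans (_ : #|u |: (N u :&: N i)| <= _).
  by rewrite cardsU1 !inE ei /= add1n ltnS; apply: cr_common.
apply/subset_leq_card/subsetP => y; rewrite !inE => /orP[/eqP->|/andP[euy eiy]].
  by rewrite uX es eui.
by have := nb_closed uX euy; rewrite eiy inE => ->.
Qed.

Lemma cr_low_vertex : exists v, #|N v| <= 7.
Proof.
case: (pickP [pred v | #|N v| <= 7]) => [v v7|no]; first by exists v.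
have := cr_e2 cr; rewrite e2_deg.
suff : 8 * #|[set: T]| <= \sum_(x in [set: T]) #|[set y in [set: T] | e x y]|.
  by have := cr_card8 cr; lia.
rewrite mulnC -sum_nat_const; apply: leq_sum => v _.
have /= /negbT := no v; rewrite -ltnNge => h; apply: leq_trans h _.
by apply/subset_leq_card/subsetP => y; rewrite !inE.
Qed.

Lemma cr_local c D : #|N c| <= 7 -> conn e D -> c \notin D ->
  [disjoint D & N c] -> #|nb D :&: N c| <= 4.
Proof.
move=> c7 cD cnD dD; rewrite leqNgt; apply/negP => five.
apply: (cr_noK7 cr); apply: local_model five => //; first by rewrite cr_deg.
move=> x ecx; apply: leq_trans (cr_common cr ecx) _.
by apply/subset_leq_card/subsetP => y; rewrite !inE.
Qed.
End Separators.

(** * Separators that are 4-cliques, and the blobs behind them *)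

Lemma card_submod (T : finType) (e : rel T) (X Y : {set T}) :
  #|nb e (X :&: Y)| + #|nb e (X :|: Y)| <= #|nb e X| + #|nb e Y|.
Proof. by rewrite !card_sum1 -!big_split; apply: leq_sum => a _; apply: nb_submod. Qed.

Lemma card_sel4 (T : finType) (Q : {set T}) a b c d (P : pred T) :
  enum Q = [:: a; b; c; d] ->
  #|[set y in Q | P y]| = P a + (P b + (P c + P d)).
Proof.
move=> E; rewrite -sum1dep_card big_mkcondr -big_enum /= E !big_cons big_nil.
by case: (P a); case: (P b); case: (P c); case: (P d).
Qed.

(** Since K_4 has [e2] equal to 12, the hypothesis says: with m missing pairs, those at [q] plus
    those meeting {q1, q2} number at most m. Unless all six pairs are missing, some two vertices
    meet every missing pair, and any [q] in a missing pair breaks the bound; if all six are missing,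
    3 + 5 > 6 breaks it. One filling from each side would not suffice, as two disjoint missing pairs
    would pass. *)
Lemma clique4 (T : finType) (e : rel T) (Q : {set T}) :
  symmetric e -> irreflexive e -> #|Q| = 4 ->
  (forall q q1 q2, q \in Q -> q1 \in Q -> q2 \in Q -> q1 != q2 ->
    e2 Q e + (#|[set y in Q :\ q | ~~ e q y]| + #|[set y in Q :\ q1 | ~~ e q1 y]|
      + #|[set y in Q :\ q2 :\ q1 | ~~ e q2 y]|).*2 <= 12) ->
  {in Q &, forall x y, x != y -> e x y}.
Proof.
move=> es ei; rewrite cardE => Q4 fill.
case E: (enum Q) Q4 => [|a [|b [|c [|d [|]]]]] // _.
have uQ := enum_uniq Q; rewrite E /= !inE !negb_or !andbT in uQ.
case/and3P: uQ => /and3P[ab ac ad] /andP[bc bd] cd.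
have inQ y : (y \in Q) = (y \in [:: a; b; c; d]) by rewrite -E mem_enum.
have g1 q : #|[set y in Q :\ q | ~~ e q y]| =
   (a != q) && ~~ e q a + ((b != q) && ~~ e q b + ((c != q) && ~~ e q c +
     ((d != q) && ~~ e q d))).
  rewrite -(card_sel4 (fun y => (y != q) && ~~ e q y) E); apply: eq_card => y.
  by rewrite !inE andbA [(y != q) && _]andbC -!andbA.
have g2 p q : #|[set y in Q :\ q :\ p | ~~ e q y]| =
   [&& a != p, a != q & ~~ e q a] + ([&& b != p, b != q & ~~ e q b] +
    ([&& c != p, c != q & ~~ e q c] + [&& d != p, d != q & ~~ e q d])).
  rewrite -(card_sel4 (fun y => [&& y != p, y != q & ~~ e q y]) E).
  by apply: eq_card => y; rewrite !inE; case: (y \in Q); rewrite ?andbT ?andbF ?andbA.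
have eE : e2 Q e = (e a b + (e a c + (e a d + (e b c + (e b d + e c d))))).*2.
  rewrite e2_deg -big_enum /= E !big_cons big_nil !(card_sel4 _ E) !ei /=.
  by rewrite (es b a) (es c a) (es d a) (es c b) (es d b) (es d c); clear; lia.
have aQ : a \in Q by rewrite inQ !inE eqxx.
have bQ : b \in Q by rewrite inQ !inE eqxx orbT.
have cQ : c \in Q by rewrite inQ !inE eqxx !orbT.
have dQ : d \in Q by rewrite inQ !inE eqxx !orbT.
have := fill a a b aQ aQ bQ ab; have := fill c a b cQ aQ bQ ab.
have := fill a a c aQ aQ cQ ac; have := fill b a c bQ aQ cQ ac.
have := fill a a d aQ aQ dQ ad; have := fill b a d bQ aQ dQ ad.
have := fill b b c bQ bQ cQ bc; have := fill a b c aQ bQ cQ bc.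
have := fill b b d bQ bQ dQ bd; have := fill a b d aQ bQ dQ bd.
have := fill c c d cQ cQ dQ cd; have := fill a c d aQ cQ dQ cd.
have := fill d a b dQ aQ bQ ab; have := fill d b c dQ bQ cQ bc.
have := fill d a c dQ aQ cQ ac; have := fill c a d cQ aQ dQ ad.
have := fill c b d cQ bQ dQ bd; have := fill b c d bQ cQ dQ cd.
rewrite !g1 !g2 eE !eqxx (eq_sym b a) (eq_sym c a) (eq_sym d a) (eq_sym c b).
rewrite (eq_sym d b) (eq_sym d c) (negPf ab) (negPf ac) (negPf ad) (negPf bc).
rewrite (negPf bd) (negPf cd) /= (es b a) (es c a) (es d a) (es c b) (es d b) (es d c).
move=> h1 h2 h3 h4 h5 h6 h7 h8 h9 h10 h11 h12 h13 h14 h15 h16 h17 h18 x y.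
have : [&& e a b, e a c, e a d, e b c, e b d & e c d].
  move: h1 h2 h3 h4 h5 h6 h7 h8 h9 h10 h11 h12 h13 h14 h15 h16 h17 h18.
  by case: (e a b); case: (e a c); case: (e a d); case: (e b c); case: (e b d);
     case: (e c d).
case/and5P=> eab eac ead ebc /andP[ebd ecd]; rewrite !inQ !inE.
case/or4P => /eqP->; case/or4P => /eqP->; rewrite ?eqxx // => _;
  by rewrite ?(es b a) ?(es c a) ?(es d a) ?(es c b) ?(es d b) ?(es d c).
Qed.

Section Blobs.
Variables (T : finType) (e : rel T).
Hypothesis cr : critical e.
Let es := cr_sym cr.
Let ei := cr_irr cr.
Implicit Types (x y z : T) (A D S X Y : {set T}).
Local Notation N := (N e).
Local Notation nb := (nb e).

(* Both ends of the separator Q are filled in: D absorbs into one vertex of Q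
   on one side, c and W into two vertices of Q on the other. *)
Lemma cr_sep_clique c D W : conn e D -> D != set0 -> c \notin D :|: nb D ->
  conn e W -> W != set0 -> [disjoint W & D :|: nb D] -> c \notin W ->
  #|nb D| = 4 -> (forall q, q \in nb D -> e c q) ->
  (forall q, q \in nb D -> touches e [set q] W) ->
  {in nb D &, forall x y, x != y -> e x y}.
Proof.
move=> cD D0 cDQ cW W0 dW cnW Q4 ecQ tW; apply: clique4 => // q q1 q2 qQ q1Q q2Q q12.
have cX : c \in [set c] by rewrite inE.
have dc : [disjoint [set c] & D :|: nb D] by rewrite disjoints1.
have left : e2 (~: D) e + #|[set y in nb D :\ q | ~~ e q y]|.*2 + 18 <= 8 * #|~: D|.
  by apply: (cr_fill_left cr (X := W)).
pose A := D :|: nb D.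
pose h1 := star e q1 (nb D :\ q1).
have h1s : symmetric h1 by apply: star_sym.
have h1i : irreflexive h1 by apply: star_irr; rewrite ?setD11.
have subA p : nb D :\ p \subset A.
  by apply/subsetP => y; rewrite !inE => /andP[_ ->]; rewrite orbT.
have qA p : p \in nb D -> p \in A by rewrite inE orbC => ->.
have tc x : x \in q1 |: nb D :\ q1 -> touches e [set x] [set c].
  by rewrite setD1K // => /ecQ ecx; apply: touches1; rewrite es.
have b1 : bags e A (absorb (fun x => [set x]) q1 [set c]) h1.
  by apply: bags_star; rewrite ?qA //; [rewrite disjoint_sym|apply: conn1].
have b2 : bags e A (absorb (absorb (fun x => [set x]) q1 [set c]) q2 W)
    (star h1 q2 (nb D :\ q2)).
  have sub x : [set x] \subset absorb (fun x => [set x]) q1 [set c] x.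
    by rewrite /absorb; case: ifP => // _; apply: subsetUl.
  apply: bags_absorb b1 _ cW _ _ _ => //; first exact: qA.
  - exact: touches_sub (sub _) _ (tW _ q2Q).
  - move=> x xA; have dx : [disjoint [set x] & W].
      by rewrite disjoints1 (disjointFl dW).
    rewrite /absorb; case: ifP => // _.
    by rewrite disjoints_subset subUset -!disjoints_subset dx disjoints1.
  by move=> x; rewrite inE => /andP[_ /tW]; apply: touches_sub (sub _) _.
have A3 : 3 <= #|A|.
  have /set0Pn[d dD] := D0.
  by apply: (card3_closed cr (x := d)); rewrite ?nbr_closure // inE dD.
have AT : #|A| < #|[set: T]|.
  apply: proper_card; rewrite properT; apply/negP => /eqP A1.
  by move: cDQ; rewrite -/A A1 inE.
have q2S : q2 \notin nb D :\ q2 by rewrite setD11.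
have := cr_min cr (star_sym _ _ h1s) (star_irr q2S h1i) b2 A3 (or_introl AT).
have := e2_star h1s (qA _ q2Q) q2S (subA q2).
have := e2_star es (qA _ q1Q) (_ : q1 \notin nb D :\ q1) (subA q1).
rewrite setD11 => /(_ isT); rewrite -/h1.
(* The pair [q1 q2] has already been filled by [c], so it is not counted again at [q2]. *)
have -> : [set y in nb D :\ q2 | ~~ h1 q2 y] = [set y in nb D :\ q2 :\ q1 | ~~ e q2 y].
  apply/setP => y; rewrite !inE /h1 /star !inE (eq_sym q2) (negPf q12) q2Q /=.
  rewrite andbT; case: (y == q1); rewrite ?andbF ?orbF //=; by rewrite orbT andbF.
have := e2_cut D es; have := cr_e2 cr; have := card_setC D.
have : #|A| = #|D| + #|nb D| by apply: card_closure.
by rewrite Q4 -/A; move: left; clear; lia.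
Qed.

(** [nb D] has at least four vertices by [cr_conn4] and at most four by [cr_local]. The remaining
    one to three neighbours of [c] form [R], and [W] is either a single vertex of [R] that sees all
    of [nb D] or the whole of [R]. *)
Lemma cr_clique c b : #|N c| <= 7 -> b \notin c |: N c -> exists D W,
  [/\ b \in D, D \subset ~: (c |: N c), nb D \subset N c & #|nb D| = 4] /\
  [/\ W != set0, conn e W, W \subset N c :\: nb D,
      {in nb D &, forall x y, x != y -> e x y} &
      forall q, q \in nb D -> touches e [set q] W].
Proof.
move=> c7 bc; have bA : b \in ~: (c |: N c) by rewrite inE.
have [D [bD sD cD clD]] := component es bA.
have sQ : nb D \subset N c.
  apply/subsetP => y /nbP[yD [u uD euy]]; apply: contraT => yN.
  have : y \in ~: (c |: N c).
    rewrite !inE negb_or; apply/andP; split; last by move: yN; rewrite inE.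
    apply: contraTneq (subsetP sD _ uD) => yc.
    by rewrite !inE negbK -yc es euy orbT.
  by move/(clD _ _ uD)/(_ euy); rewrite (negPf yD).
have cnD : c \notin D by apply/negP => /(subsetP sD); rewrite !inE eqxx.
have dD : [disjoint D & N c].
  apply/pred0P => y /=; apply/andP => -[/(subsetP sD)]; rewrite 2!inE => /norP[_].
  by move/negP.
have cN : c \notin N c by rewrite inE ei.
have cDQ : c \notin D :|: nb D.
  by rewrite inE (negPf cnD) /=; apply: contra cN; apply: subsetP.
have D0 : D != set0 by apply/set0Pn; exists b.
have Q4 : #|nb D| = 4.
  apply/eqP; rewrite eqn_leq (cr_conn4 cr D0 cDQ) andbT.
  have := cr_local cr c7 cD cnD dD; by rewrite (setIidPl sQ).
pose R := N c :\: nb D.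
have cardR : #|N c| = #|nb D| + #|R|.
  by rewrite -(cardsID (nb D) (N c)) (setIidPr sQ).
have R0 : R != set0.
  by rewrite -card_gt0; have := cr_deg cr c; rewrite cardR Q4; clear; lia.
have R3 : #|R| <= 3 by move: c7; rewrite cardR Q4; clear; lia.
have degR x : x \in N c -> 4 <= #|N x :&: nb D| + #|N x :&: R|.
  rewrite inE => ecx; have := cr_common cr ecx.
  rewrite setIC -(cardsID (nb D)) (_ : _ :&: N c :&: _ = N x :&: nb D); last first.
    apply/setP => y; rewrite !(in_setI, in_setD) -andbA; congr (_ && _).
    by case: (boolP (y \in nb D)); rewrite ?andbF // => /(subsetP sQ)->.
  rewrite (_ : _ :\: _ = N x :&: R) //.
  by apply/setP => y; rewrite !(in_setI, in_setD); case: (y \in nb D); rewrite ?andbF.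
have tR q : q \in nb D -> touches e [set q] R.
  move=> qQ; have := degR q (subsetP sQ _ qQ).
  have : #|N q :&: nb D| <= 3.
    rewrite -ltnS -Q4; apply: proper_card; apply/properP; split; first exact: subsetIr.
    by exists q; rewrite // !inE ei.
  move=> h1 h2; have : 0 < #|N q :&: R| by move: h1 h2; clear; lia.
  case/card_gt0P => y; rewrite inE => /andP[]; rewrite inE => eqy yR.
  by apply/touchesP; exists q, y; rewrite inE eqxx.
suff [W [W0 cW sW tW]] : exists W, [/\ W != set0, conn e W, W \subset R &
    forall q, q \in nb D -> touches e [set q] W].
  exists D, W; split=> //; split=> //.
  apply: (cr_sep_clique cD D0 cDQ cW W0) => //.
  - apply/pred0P => y /=; apply/andP => -[/(subsetP sW)]; rewrite in_setD => /andP[yQ yN].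
    by rewrite inE (negPf yQ) orbF (disjointFl dD yN).
  - by apply/negP => /(subsetP sW); rewrite in_setD (negPf cN) andbF.
  by move=> q /(subsetP sQ); rewrite inE.
case: (pickP [pred a in R | nb D \subset N a]) => [a /= /andP[aR sa]|no].
  exists [set a]; split; first by apply/set0Pn; exists a; rewrite inE.
  - exact: conn1.
  - by rewrite sub1set.
  by move=> q /(subsetP sa); rewrite inE => eaq; apply: touches1; rewrite es.
(* No vertex of [R] sees all of [nb D], so four common neighbours with [c] force a neighbour in [R].
   Without isolated vertices, a disconnected [R] would have at least four vertices. *)
have inR x : x \in R -> exists2 y, y \in R & e x y.
  move=> xR; have xN : x \in N c by move: xR; rewrite in_setD => /andP[].
  have : #|N x :&: nb D| <= 3.
    rewrite -ltnS -Q4; apply: proper_card; rewrite properE subsetIr /=.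
    apply: contraFN (no x) => h /=; rewrite xR; exact: subset_trans h (subsetIl _ _).
  move=> h1; have := degR x xN => h2.
  have : 0 < #|N x :&: R| by move: h1 h2; clear; lia.
  by case/card_gt0P => y; rewrite inE => /andP[]; rewrite inE => exy yR; exists y.
exists R; split=> // Y sY /set0Pn[y yY] cl; apply/negPn/negP => /subsetPn[z zR zY].
have [y' y'R eyy'] := inR _ (subsetP sY _ yY).
have [z' z'R ezz'] := inR _ zR.
have y'Y := cl _ _ yY y'R eyy'.
have z'Y : z' \notin Y by apply: contra zY => h; apply: cl h zR _; rewrite es.
have : 4 <= #|R|; last by rewrite leqNgt ltnS R3.
have -> : 4 = #|[set y; y'] :|: [set z; z']|.
  rewrite cardsU !cards2 (_ : _ :&: _ = set0) ?cards0.
    have yy' : y != y' by apply: contraTneq eyy' => <-; rewrite ei.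
    have zz' : z != z' by apply: contraTneq ezz' => <-; rewrite ei.
    by rewrite yy' zz'.
  apply/setP => w; rewrite !inE; apply/negP => /andP[/orP[]/eqP->/orP[]/eqP E];
    by move: zY z'Y; rewrite -?E ?yY ?y'Y.
apply/subset_leq_card/subsetP => w; rewrite in_setU !in_set2 -orbA.
by case/or4P => /eqP-> //; apply: (subsetP sY).
Qed.
End Blobs.

(* F is one end of a 4-clique separator and holds two disjoint touching
   connected sets, {c} and W, each adjacent to the whole separator. *)
Record blob (T : finType) (e : rel T) (F : {set T}) (c : T) (W : {set T}) : Prop := Blob {
  blob_c : c \in F;
  blob_cW : c \notin W;
  blob_W : W \subset F;
  blob_conn : conn e W;
  blob_W0 : W != set0;
  blob_touch : touches e [set c] W;
  blob_card : #|nb e F| = 4;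
  blob_clique : {in nb e F &, forall x y, x != y -> e x y};
  blob_cQ : forall q, q \in nb e F -> e c q;
  blob_WQ : forall q, q \in nb e F -> touches e [set q] W }.

Section BlobExists.
Variables (T : finType) (e : rel T).
Hypothesis cr : critical e.
Let es := cr_sym cr.
Let ei := cr_irr cr.
Implicit Types (x y z : T) (A D S X Y : {set T}).
Local Notation N := (N e).
Local Notation nb := (nb e).

(** [F] is a smallest subset of [X0] with at most four neighbours and [F'] the side, containing [c],
    of the clique separator obtained from a vertex [c] of small degree in [F]. As [b] stays outside,
    [F :|: F'] has at least four neighbours, so [F :&: F'] has at most four and minimality puts [F]
    inside [F']. The clique is then adjacent to [c] and outside [F], hence equal to [nb F]. *)
Lemma cr_blob b X0 : X0 != set0 -> #|nb X0| <= 4 -> b \notin X0 :|: nb X0 ->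
  exists F c W, blob e F c W /\ F \subset X0.
Proof.
move=> X00 nX0 bX0.
pose good X := [&& X \subset X0, X != set0 & #|nb X| <= 4].
have g0 : good X0 by rewrite /good subxx X00.
case: (arg_minnP (fun X : {set T} => #|X|) g0) => F /and3P[sF F0 nF] minF.
have bF : b \notin F :|: nb F.
  rewrite inE negb_or; have := bX0; rewrite inE negb_or => /andP[bX _].
  have -> : b \notin F by apply: contra bX; apply: (subsetP sF).
  apply: contra bX0 => /nbP[_ [u uF eub]]; exact: nb_closed (subsetP sF _ uF) eub.
have [c cF c7] : exists2 c, c \in F & #|N c| <= 7.
  by apply: (cr_low cr) bF _ => //; apply: leq_trans nF _.
have bc : b \notin c |: N c.
  rewrite !inE negb_or; apply/andP; split.
    by apply: contraNneq bF => ->; rewrite inE cF.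
  by apply: contra bF => ecb; apply: nb_closed cF ecb.
have [D [W [[bD sD sQ Q4] [W0 cW sW clQ tW]]]] := cr_clique cr c7 bc.
pose F' := ~: (D :|: nb D).
have cN : c \notin N c by rewrite inE ei.
have cF' : c \in F'.
  rewrite in_setC in_setU negb_or; apply/andP; split.
    by apply/negP => /(subsetP sD); rewrite !inE eqxx.
  by apply: contra cN; apply: (subsetP sQ).
have nF' y : y \in nb F' -> y \in nb D.
  case/nbP; rewrite in_setC negbK in_setU => yDQ [u].
  rewrite in_setC => uF' euy; case/orP: yDQ => // yD.
  by case/negP: uF'; apply: nb_closed yD _; rewrite es.
have sFF' : F \subset F'.
  have /minF h : good (F :&: F').
    rewrite /good (subset_trans (subsetIl _ _) sF) /=.
    rewrite (_ : _ != set0); last by apply/set0Pn; exists c; rewrite inE cF.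
    have sub := card_submod e F F'.
    have n' : #|nb F'| <= 4 by rewrite -Q4; apply/subset_leq_card/subsetP.
    have : 4 <= #|nb (F :|: F')|.
      apply: (cr_conn4 cr (b := b)); first by apply/set0Pn; exists c; rewrite inE cF.
      rewrite in_setU negb_or in_setU negb_or -andbA; apply/and3P; split.
      + by apply: contra bF => h; rewrite inE h.
      + by rewrite in_setC negbK inE bD.
      apply/negP => /nb_setU/orP[h|/nF' /nb_notin]; last by rewrite bD.
      by move: bF; rewrite inE h orbT.
    by move: nF n' sub; clear; lia.
  by apply/setIidPl/eqP; rewrite eqEcard subsetIl h.
have eQ : nb D = nb F.
  apply/eqP; rewrite eqEcard Q4 nF andbT; apply/subsetP => q qQ.
  have := subsetP sQ _ qQ; rewrite inE; apply: mem_nb cF _.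
  by apply/negP => /(subsetP sFF'); rewrite in_setC in_setU qQ orbT.
have WN w : w \in W -> e c w by move/(subsetP sW); rewrite in_setD inE => /andP[].
exists F, c, W; split=> //; split=> //; rewrite -?eQ //.
- by apply/negP => /WN; rewrite ei.
- apply/subsetP => w wW; have := nb_closed cF (WN _ wW).
  rewrite in_setU -eQ => /orP[//|]; have := subsetP sW _ wW.
  by rewrite in_setD => /andP[/negPf->].
- have /set0Pn[w wW] := W0; apply/touchesP; exists c, w.
  by rewrite inE eqxx wW WN.
by move=> q /(subsetP sQ); rewrite inE.
Qed.
End BlobExists.

Lemma blob_conn_c (T : finType) (e : rel T) F c W q : symmetric e ->
  blob e F c W -> q \in nb e F -> touches e [set q] [set c] /\ touches e [set q] W.
Proof.
move=> es bl qQ; split; last exact: blob_WQ bl _ qQ.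
by apply: touches1; rewrite es (blob_cQ bl).
Qed.

(** Bags 0, ..., 3 are the paths, pairwise adjacent through the clique [nb e F]; the blob pairs are
    {c}, [W] and {c2}, [W2]. *)
Lemma model_C2_blobs (T : finType) (e : rel T) F c W F2 c2 W2 (C : 'I_4 -> {set T}) :
  symmetric e -> blob e F c W -> blob e F2 c2 W2 -> [disjoint F & F2] ->
  (forall i, conn e (C i)) -> (forall i, C i \subset ~: (F :|: F2)) ->
  (forall i, C i :&: nb e F != set0) -> (forall i, C i :&: nb e F2 != set0) ->
  (forall i j, i != j -> [disjoint C i & C j]) -> model e 8 hC2.
Proof.
move=> es b1 b2 dF Cc CF CQ CQ2 Cd.
pose B i := if i < 4 then C (inord i) else
  nth set0 [:: [set c]; W; [set c2]; W2] (i - 4).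
have dis i : [disjoint C i & F] /\ [disjoint C i & F2].
  rewrite !disjoints_subset; split; apply: subset_trans (CF i) _;
    by rewrite setCS ?subsetUl ?subsetUr.
have tch i : [/\ touches e (C i) [set c], touches e (C i) W,
    touches e (C i) [set c2] & touches e (C i) W2].
  have /set0Pn[q] := CQ i; rewrite inE => /andP[qC qQ].
  have /set0Pn[q2] := CQ2 i; rewrite inE => /andP[q2C q2Q].
  have [t1 t2] := blob_conn_c es b1 qQ; have [t3 t4] := blob_conn_c es b2 q2Q.
  have sub p X : p \in C i -> touches e [set p] X -> touches e (C i) X.
    by move=> pC; apply: touches_sub; rewrite ?sub1set.
  by split; [apply: sub t1|apply: sub t2|apply: sub t3|apply: sub t4].
have sc : [set c] \subset F by rewrite sub1set (blob_c b1).
have sc2 : [set c2] \subset F2 by rewrite sub1set (blob_c b2).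
have sW := blob_W b1; have sW2 := blob_W b2.
have dd (X Y : {set T}) : X \subset F -> Y \subset F2 -> [disjoint X & Y].
  by move=> h1 h2; apply: disjointWl h1 (disjointWr h2 dF).
exists B; split=> [i i8|i i8|i j ij j8].
- rewrite /B; case: ifP => i4.
    by have /set0Pn[q] := CQ (inord i); rewrite inE => /andP[qC _]; apply/set0Pn; exists q.
  have : i - 4 < 4 by move: i4 i8; clear; lia.
  have c0 x : [set x] != set0 :> {set T} by apply/set0Pn; exists x; rewrite inE.
  by case: (i - 4) => [|[|[|[|]]]] //= _;
    [apply: (blob_W0 b1)|apply: (blob_W0 b2)].
- rewrite /B; case: ifP => i4; first exact: Cc.
  have : i - 4 < 4 by move: i4 i8; clear; lia.
  by case: (i - 4) => [|[|[|[|]]]] //= _;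
    [apply: conn1|apply: (blob_conn b1)|apply: conn1|apply: (blob_conn b2)].
have [j4|j4] := ltnP j 4.
  rewrite /B j4 (ltn_trans ij j4).
  have ne : inord i != inord j :> 'I_4.
    by rewrite -val_eqE /= !inordK ?(ltn_trans ij) // ltn_eqF.
  split=> [|_]; first exact: Cd.
  have /set0Pn[p] := CQ (inord i); rewrite inE => /andP[pC pQ].
  have /set0Pn[q] := CQ (inord j); rewrite inE => /andP[qC qQ].
  apply/touchesP; exists p, q; split=> //; apply: (blob_clique b1) => //.
  by apply: contraTneq qC => <-; rewrite (disjointFr (Cd _ _ ne) pC).
have [i4|i4] := ltnP i 4.
  have j4F : (j < 4) = false by rewrite ltnNge j4.
  rewrite /B i4 j4F; have [t1 t2 t3 t4] := tch (inord i).
  have [d1 d2] := dis (inord i); have : j - 4 < 4 by move: j4 j8; clear; lia.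
  have mk (X Y : {set T}) (P : bool) : X \subset Y -> [disjoint C (inord i) & Y] ->
      touches e (C (inord i)) X ->
      [disjoint C (inord i) & X] /\ (P -> touches e (C (inord i)) X).
    by move=> XY dY tX; split=> //; apply: disjointWr dY.
  by case: (j - 4) => [|[|[|[|]]]] //= _;
    [apply: mk sc d1 t1|apply: mk sW d1 t2|apply: mk sc2 d2 t3|apply: mk sW2 d2 t4].
have i4F : (i < 4) = false by rewrite ltnNge i4.
have j4F : (j < 4) = false by rewrite ltnNge j4.
rewrite /B i4F j4F /hC2.
have [i5 j5] : i - 4 < 4 /\ j - 4 < 4 by move: ij j8; clear; lia.
have : i - 4 < j - 4 by move: ij i4; clear; lia.
have -> : (3 < i < 6) && (5 < j) = (i - 4 < 2) && (1 < j - 4) by move: i4 j4; clear; lia.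
case: (i - 4) i5 => [|[|[|[|]]]] //; case: (j - 4) j5 => [|[|[|[|]]]] //= _ _ _;
  try by split=> //; apply: dd.
- by split=> [|_]; [rewrite disjoints1 (blob_cW b1)|apply: (blob_touch b1)].
by split=> [|_]; [rewrite disjoints1 (blob_cW b2)|apply: (blob_touch b2)].
Qed.

Lemma critical_false (T : finType) (e : rel T) : ~ critical e.
Proof.
move=> cr; have es := cr_sym cr; have ei := cr_irr cr.
have [v v7] := cr_low_vertex cr.
have vN : v \notin N e v by rewrite inE ei.
(* If [v] sees every other vertex, then n = 8 and [cone8_model] decides; otherwise some [b] lies
   beyond its neighbours and two ends can be found. *)
have [/eqP all|] := boolP (v |: N e v == setT).
  have n8 : #|[set: T]| = 8.
    apply/eqP; rewrite eqn_leq (cr_card8 cr) andbT -all cardsU1 vN; exact: v7.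
  have [||||k7|c2] := @cone8_model T e v es ei.
  - by rewrite -cardsT.
  - by have := cr_e2 cr; rewrite n8; lia.
  - move=> y yv; have : y \in v |: N e v by rewrite all inE.
    by rewrite !inE (negPf yv).
  - move=> y yv; have evy : e v y.
      have : y \in v |: N e v by rewrite all inE.
      by rewrite !inE (negPf yv).
    apply: leq_trans (cr_common cr evy) _; apply/subset_leq_card/subsetP => z.
    by rewrite !inE => /andP[evz ->]; rewrite andbT; apply: contraTneq evz => ->; rewrite ei.
  - exact: (cr_noK7 cr).
  exact: (cr_noC2 cr).
rewrite -subTset => /subsetPn[b _ bv].
have [D [W0 [[bD sD sQ Q4] _]]] := cr_clique cr v7 bv.
have [F [c [W [bl sF]]]] : exists F c W, blob e F c W /\ F \subset ~: (D :|: nb e D).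
  have vX : v \in ~: (D :|: nb e D).
    rewrite in_setC in_setU negb_or; apply/andP; split.
      by apply/negP => /(subsetP sD); rewrite !inE eqxx.
    by apply: contra vN; apply: (subsetP sQ).
  have nX y : y \in nb e (~: (D :|: nb e D)) -> y \in nb e D.
    case/nbP; rewrite in_setC negbK in_setU => yDQ [u].
    rewrite in_setC => uF' euy; case/orP: yDQ => // yD.
    by case/negP: uF'; apply: nb_closed yD _; rewrite es.
  apply: (cr_blob cr (b := b)); first by apply/set0Pn; exists v.
    by rewrite -Q4; apply/subset_leq_card/subsetP.
  rewrite in_setU negb_or in_setC negbK in_setU bD /=.
  by apply/negP => /nX/nb_notin; rewrite bD.
have bF : b \notin F :|: nb e F.
  have bX : b \notin F by apply/negP => /(subsetP sF); rewrite in_setC in_setU bD.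
  rewrite in_setU negb_or bX; apply/negP => /nbP[_ [u /(subsetP sF) + eub]].
  by rewrite in_setC => /negP; apply; apply: nb_closed bD _; rewrite es.
have [F2 [c2 [W2 [bl2 sF2]]]] : exists F2 c2 W2,
    blob e F2 c2 W2 /\ F2 \subset ~: (F :|: nb e F).
  have nX y : y \in nb e (~: (F :|: nb e F)) -> y \in nb e F.
    case/nbP; rewrite in_setC negbK in_setU => yDQ [u].
    rewrite in_setC => uF' euy; case/orP: yDQ => // yD.
    by case/negP: uF'; apply: nb_closed yD _; rewrite es.
  apply: (cr_blob cr (b := c)); first by apply/set0Pn; exists b; rewrite in_setC.
    by rewrite -(blob_card bl); apply/subset_leq_card/subsetP.
  rewrite in_setU negb_or in_setC negbK in_setU (blob_c bl) /=.
  by apply/negP => /nX/nb_notin; rewrite (blob_c bl).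
have dF : [disjoint F & F2].
  rewrite disjoint_sym disjoints_subset; apply: subset_trans sF2 _.
  by rewrite setCS subsetUl.
pose R := ~: (F :|: F2).
have QR q : q \in nb e F -> q \in R.
  move=> qQ; rewrite in_setC in_setU negb_or (nb_notin qQ) /=.
  by apply/negP => /(subsetP sF2); rewrite in_setC in_setU qQ orbT.
have Q2R q : q \in nb e F2 -> q \in R.
  move=> qQ; rewrite in_setC in_setU negb_or (nb_notin qQ) andbT.
  have /nbP[_ [u /(subsetP sF2) + euq]] := qQ.
  by rewrite in_setC; apply: contra => qF; apply: nb_closed qF _; rewrite es.
pose e' u v := [&& e u v, u \in R & v \in R].
have ee' : subrel e' e by move=> u w /and3P[].
have e's : symmetric e' by move=> u w; rewrite /e' es [(u \in _) && _]andbC.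
have e'i : irreflexive e' by move=> u; rewrite /e' ei.
have [|C [Cc CQ CQ2 Cd]] := @menger T e' (nb e F) (nb e F2) 4 e's e'i.
  (* A cut of the graph restricted to [R] contains the neighbourhood of [Y] in [e], so
     4-connectivity yields the hypothesis of Menger's theorem there. *)
  move=> X dX; pose Y := F :|: (X :&: R).
  have c2F2 := blob_c bl2.
  have nY y : y \in nb e Y -> y \in nb e' X :|: (nb e F :\: X).
    case/nbP; rewrite {1}/Y in_setU negb_or => /andP[yF yXR] [u uY euy].
    have [yQ|yQ] := boolP (y \in nb e F).
      have yX : y \notin X by apply: contra yXR => yX; rewrite in_setI yX QR.
      by rewrite in_setU in_setD yQ yX orbT.
    move: uY; rewrite /Y in_setU => /orP[uF|]; first by rewrite (mem_nb uF yF euy) in yQ.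
    rewrite in_setI => /andP[uX uR].
    have yR : y \in R.
      rewrite in_setC in_setU negb_or yF /=; apply/negP => yF2.
      have : u \in nb e F2.
        apply: mem_nb yF2 _ _; last by rewrite es.
        by move: uR; rewrite in_setC in_setU negb_or => /andP[].
      by rewrite (disjointFr dX uX).
    rewrite in_setU (@mem_nb _ _ _ u) //; last by rewrite /e' euy uR.
    by apply: contra yXR => yX; rewrite in_setI yX.
  apply: leq_trans (_ : #|nb e Y| <= _); last exact/subset_leq_card/subsetP.
  apply: (cr_conn4 cr (b := c2)).
    by apply/set0Pn; exists c; rewrite /Y in_setU (blob_c bl).
  rewrite in_setU negb_or; apply/andP; split.
    rewrite /Y in_setU negb_or in_setI; apply/andP; split.
      by rewrite (disjointFl dF).
    by rewrite in_setC in_setU c2F2 orbT andbF.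
  apply/negP => /nY; rewrite in_setU in_setD => /orP[/nbP[_ [u _ /and3P[_ _]]]|].
    by rewrite in_setC in_setU c2F2 orbT.
  by case/andP => _ /QR; rewrite in_setC in_setU c2F2 orbT.
apply: (cr_noC2 cr); apply: (@model_C2_blobs T e F c W F2 c2 W2 C) => // i.
  exact: conn_sub (Cc i).
have /set0Pn[q] := CQ i; rewrite inE => /andP[qC /QR qR].
by apply: conn_hull (Cc i) qC qR _ => u w /and3P[].
Qed.

Lemma e2_sub (T : finType) (A : {set T}) (h : rel T) :
  e2 setT (sub_rel (A:=A) h) = e2 A h.
Proof.
have -> : e2 A h = \sum_(x in A) \sum_(y in A) h x y.
  rewrite [RHS]big_mkcond; apply: eq_bigr => x _; case: ifP => xA; last first.
    by rewrite big1.
  by rewrite [RHS]big_mkcond; apply: eq_bigr => y _; case: ifP.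
rewrite [RHS]big_sub /e2; apply: eq_bigr => x _; rewrite [RHS]big_sub; apply: eq_bigr => y _.
by rewrite !inE.
Qed.

(** Induction on vertices, then on edges: a failure is [critical], and its clause [cr_min] is the
    two induction hypotheses, transported to the subtype of [A]. *)
Lemma dense_model (T : finType) (e : rel T) : symmetric e -> irreflexive e ->
  3 <= #|[set: T]| -> 8 * #|[set: T]| <= e2 setT e + 16 ->
  model e 7 hK7 \/ model e 8 hC2.
Proof.
have [n] := ubnP #|[set: T]|; elim: n => // n IHn in T e *; rewrite ltnS => Tn.
have [m] := ubnP (e2 setT e); elim: m => // m IHm in T e Tn *; rewrite ltnS => em.
move=> es ei T3 dense; apply: NNPP => no.
apply: (@critical_false T e); split=> //.
- by move=> h; apply: no; left.
- by move=> h; apply: no; right.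
move=> A F h hs hi bg A3 small; rewrite leqNgt; apply/negP => big.
pose S := {x | x \in A}; pose h' : rel S := sub_rel h.
have h's : symmetric h' by move=> x y; apply: hs.
have h'i : irreflexive h' by move=> x; apply: hi.
have SA : #|[set: S]| = #|A| by rewrite cardsT card_sig; apply: eq_card.
have eS : e2 setT h' = e2 A h by apply: e2_sub.
have d' : 8 * #|[set: S]| <= e2 setT h' + 16.
  rewrite SA eS; have := e2_even A hs hi; move: big; clear.
  by move=> h1 h2; lia.
have S3 : 3 <= #|[set: S]| by rewrite SA.
suff [k7|c2] : model h' 7 hK7 \/ model h' 8 hC2.
- by apply: no; left; apply: model_bags bg k7.
- by apply: no; right; apply: model_bags bg c2.
case: small => [lt|lt].
  by apply: IHn => //; rewrite SA; apply: leq_trans lt Tn.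
apply: IHm => //; last by rewrite eS; apply: leq_trans lt em.
rewrite SA; apply: leq_trans Tn; apply/subset_leq_card/subsetP => x _; exact: in_setT.
Qed.

(** * The abstract game on five strands *)

(* Index of the unordered pair {a, b} in a bit table. *)
Definition tri a b := if a < b then 'C(b, 2) + a else 'C(a, 2) + b.

Definition tri_tab : seq (seq nat) :=
  Eval compute in [seq [seq tri a b | b <- iota 0 5] | a <- iota 0 5].

Definition tr a b := nth 0 (nth [::] tri_tab a) b.

Definition set_bit (l : bitseq) k := set_nth false l k true.

Definition add_pairs (l : bitseq) (s : seq (nat * nat)) :=
  foldr (fun p l => set_bit l (tr p.1 p.2)) l s.

(* (P, col, H, A): the doubled pair of strands, the colours of the strands, the
   pairs of strands and the pairs of colours known to be adjacent. *)
Definition state := ((nat * nat) * seq nat * bitseq * bitseq)%type.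

Definition others x y := [seq b <- iota 0 5 | (b != x) && (b != y)].

(** At most one of the three pairs is adjacent. Two would share a strand, the configuration that
    [strands_okT] turns into K_7^=. *)
Definition sparse (H : bitseq) (t : seq nat) :=
  if t is [:: a; b; c] then
    let x := nth false H (tr a b) in let y := nth false H (tr a c) in
    let z := nth false H (tr b c) in
    if x then if y then false else ~~ z else if y then ~~ z else true
  else true.

Definition others_tab : seq (seq (seq nat)) :=
  Eval compute in [seq [seq others a b | b <- iota 0 5] | a <- iota 0 5].

Definition oth x y := nth [::] (nth [::] others_tab x) y.

(** Strands 0 and 1 are doubled at the first separator, those of [P] at the current one. One of each
    kind is spent on blobs, and the other three strands are tested. *)
Definition free (s : state) :=
  let: (P, _, H, _) := s in
  all (fun x => all (fun y => if x == y then true else sparse H (oth x y))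
    [:: P.1; P.2]) [:: 0; 1].

Definition full (s : state) := let: (_, _, _, A) := s in
  all (fun k => nth false A k) (iota 0 6).

Fixpoint sublists (T : Type) (s : seq T) : seq (seq T) :=
  if s is x :: s' then let r := sublists s' in [seq x :: t | t <- r] ++ r else [:: [::]].

(** Strand [m] advances to a new vertex with the colour of strand [r]; [sub] lists the further
    strands whose current ends see that vertex. *)
Definition reroute (s : state) m r (sub : seq nat) : state :=
  let: (P, col, H, A) := s in
  let c := nth 0 col r in
  ((if m < r then (m, r) else (r, m)), set_nth 0 col m c,
   add_pairs H ((m, r) :: [seq (m, b) | b <- sub]),
   add_pairs A ((nth 0 col m, c) :: [seq (c, nth 0 col b) | b <- sub])).

Definition moves (s : state) : seq state :=
  let: (P, _, _, _) := s in
  flatten [seq flatten [seq [seq reroute s m r sub | sub <- sublists (oth m r)]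
    | r <- oth P.1 P.2] | m <- [:: P.1; P.2]].

Definition init_col := [:: 0; 0; 1; 2; 3].

(** The pair (0, 1) must not enter the colour table: both strands have colour 0, and [tr 0 0]
    coincides with the index of the colours {0, 1}. *)
Definition init_of (l : seq (nat * nat)) : state :=
  ((0, 1), init_col, add_pairs (nseq 10 false) l,
   add_pairs (nseq 6 false) [seq (nth 0 init_col p.1, nth 0 init_col p.2) | p <- l & p != (0, 1)]).

Definition init_pairs :=
  [:: (0, 2); (0, 3); (0, 4); (1, 2); (1, 3); (1, 4); (2, 3); (2, 4); (3, 4)].

Definition init_states : seq state := [seq init_of ((0, 1) :: l) | l <- sublists init_pairs].

Inductive trie (V : Type) := Leaf | Node of option V & trie V & trie V.
Arguments Leaf {V}.

Fixpoint trie_find (V : Type) (t : trie V) (k : bitseq) : option V :=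
  match t, k with
  | Leaf, _ => None
  | Node v _ _, [::] => v
  | Node _ l r, b :: k' => if b then trie_find l k' else trie_find r k'
  end.

Fixpoint trie_add (V : Type) (t : trie V) (k : bitseq) (x : V) : trie V :=
  match k, t with
  | [::], Leaf => Node (Some x) Leaf Leaf
  | [::], Node _ l r => Node (Some x) l r
  | b :: k', Leaf => if b then Node None (trie_add Leaf k' x) Leaf
                     else Node None Leaf (trie_add Leaf k' x)
  | b :: k', Node v l r => if b then Node v (trie_add l k' x) r else Node v l (trie_add r k' x)
  end.

Definition bits2 n := nth [::] [:: [:: false; false]; [:: false; true]; [:: true; false]; [:: true; true]] n.
Definition enc (s : state) : bitseq :=
  let: (P, col, H, A) := s in
  H ++ A ++ flatten (map bits2 col) ++ nseq (tr P.1 P.2) true.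

Definition explore1 (acc : seq state * trie state) (s : state) :=
  if free s then
    if trie_find acc.2 (enc s) is Some _ then acc
    else (s :: acc.1, trie_add acc.2 (enc s) s)
  else acc.

Definition explore (acc : seq state * trie state * seq state) :=
  let: (frontier, t, seen) := acc in
  let: (new, t') := foldl (fun a s => foldl explore1 a (moves s)) ([::], t) frontier in
  (new, t', frontier ++ seen).

Definition reach : seq state * trie state * seq state :=
  iter 30 explore (let: (n, t) := foldl explore1 ([::], Leaf) init_states in (n, t, [::])).

(** The certificate of the exploration. The stored state itself is compared with [s], so a clash of
    codes, like too few rounds in [reach], could only make the check fail. *)
Definition closed_under_moves (L : seq state) :=
  let t := foldr (fun s t => trie_add t (enc s) s) Leaf L in
  let ok s := if free s then if trie_find t (enc s) is Some s' then s' == s else false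
              else true in
  all ok init_states && all (fun s => if full s then false else all ok (moves s)) L.

Lemma reach_closed : closed_under_moves reach.2.
Proof. by vm_cast_no_check (erefl true). Qed.

Lemma trie_find_add (V : eqType) (t : trie V) k x k' y :
  trie_find (trie_add t k x) k' = Some y -> x = y \/ trie_find t k' = Some y.
Proof.
elim: k t k' => [|b k IH] [|v l r] [|b' k'] /=; try by case: b; auto.
- by case=> ->; left.
- by case: b'.
- by case=> ->; left.
- by right.
- by case: b; case: b' => //= /IH[]; auto; case: (k').
by case: b; case: b'; auto.
Qed.

Lemma reachable_exists : exists R : pred state,
  [/\ {in init_states, forall s, free s -> R s},
      forall s, R s -> ~~ full s &
      forall s s', R s -> s' \in moves s -> free s' -> R s'].
Proof.
have := reach_closed; move: reach.2 => L /andP[/allP ai /allP al].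
exists (mem L).
have ft k s : trie_find (foldr (fun s t => trie_add t (enc s) s) Leaf L) k = Some s -> s \in L.
  elim: L {ai al} k => [|s0 L IH] k /=; first by case: k.
  by move/trie_find_add => [->|/IH sL]; rewrite inE ?eqxx // sL orbT.
split=> [s /ai|s /al|s s' /al].
- case: (free s) => //; case E: (trie_find _ _) => [s'|//] /eqP es _.
  by rewrite -es; apply: ft E.
- by case: (full s).
case: (full s) => // /allP h /h; case: (free s') => //.
case E: (trie_find _ _) => [s2|//] /eqP es _.
by rewrite -es; apply: ft E.
Qed.

Lemma nth_add_pairs l s k :
  nth false (add_pairs l s) k = has (fun p => tr p.1 p.2 == k) s || nth false l k.
Proof.
elim: s => //= p s IH; rewrite /set_bit nth_set_nth /= eq_sym; case: eqP => //=.
Qed.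

Arguments add_pairs : simpl never.

Lemma tr_inj a b c d : a < 5 -> b < 5 -> c < 5 -> d < 5 -> a != b -> c != d ->
  tr a b = tr c d -> (a = c /\ b = d) \/ (a = d /\ b = c).
Proof.
by move: a b c d => [|[|[|[|[|]]]]] [|[|[|[|[|]]]]] [|[|[|[|[|]]]]] [|[|[|[|[|]]]]]
  //= _ _ _ _ _ _; auto.
Qed.

Lemma trC a b : a < 5 -> b < 5 -> tr a b = tr b a.
Proof. by move: a b => [|[|[|[|[|]]]]] [|[|[|[|[|]]]]]. Qed.

Lemma mem_sublists (T : eqType) (s : seq T) p : filter p s \in sublists s.
Proof.
elim: s => //= x s IH; rewrite mem_cat; case: (p x); last by rewrite IH orbT.
by rewrite (map_f (cons x) IH).
Qed.

Lemma mem_moves P col H A m r sub : m \in [:: P.1; P.2] -> r \in oth P.1 P.2 ->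
  sub \in sublists (oth m r) ->
  reroute (P, col, H, A) m r sub \in moves (P, col, H, A).
Proof.
move=> mP rP sS; set s := (P, col, H, A).
have -> : moves s = flatten [seq flatten [seq [seq reroute s m r sub
  | sub <- sublists (oth m r)] | r <- oth P.1 P.2] | m <- [:: P.1; P.2]] by [].
by apply/flatten_mapP; exists m => //; apply/flatten_mapP; exists r => //; apply: map_f.
Qed.

(** * Connecting the two blob pairs *)

Definition fib (T : finType) (lab : T -> nat) i := [set x | lab x == i].
Definition lside (T : finType) (lab : T -> nat) := [set x | (lab x == 4) || (lab x == 5)].
Definition rside (T : finType) (lab : T -> nat) := [set x | (lab x == 6) || (lab x == 7)].

(** Then [nb e X] separates the blob pairs and consists of vertices of central bags. *)
Definition adm (T : finType) (e : rel T) (lab : T -> nat) (X : {set T}) :=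
  (lside lab \subset X) && [disjoint rside lab & X :|: nb e X].

(* A spanning model of C2 whose two blob pairs are not separated by fewer than
   five vertices. *)
Record bridge (T : finType) (e : rel T) (lab : T -> nat) : Prop := Bridge {
  br_sym : symmetric e;
  br_irr : irreflexive e;
  br_lt : forall x, lab x < 8;
  br_ne : forall i, i < 8 -> fib lab i != set0;
  br_conn : forall i, i < 8 -> conn e (fib lab i);
  br_touch : forall i j, i < j -> j < 8 -> hC2 i j -> touches e (fib lab i) (fib lab j);
  br_cut : forall X, adm e lab X -> 5 <= #|nb e X| }.

Definition tight (T : finType) (e : rel T) (lab : T -> nat) (X : {set T}) :=
  adm e lab X && (#|nb e X| == 5).

(** An admissible set downstairs pulls back to an admissible [X], and its neighbourhood contains the
    image of [nb e X], where at most [a] and [b] are identified. Fewer than five vertices could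
    remain only if [X] were tight with both [a] and [b] on its cut. *)
Lemma contract_bridge (T : finType) (e : rel T) (lab : T -> nat) a b :
  bridge e lab -> e a b -> lab a = lab b -> lab a < 4 ->
  (forall X, tight e lab X -> ~~ ((a \in nb e X) && (b \in nb e X))) ->
  let h := star e a (N e b :\ a) in
  bridge (sub_rel (A := ~: [set b]) h) (fun x => lab (val x)).
Proof.
move=> br eab lab_ab lab4 cov h.
have es := br_sym br; have ei := br_irr br.
have ab : a != b by apply: contraTneq eab => ->; rewrite ei.
have ha : a \in ~: [set b] by rewrite !inE.
pose p x : {x | x \in ~: [set b]} := insubd (Sub a ha) x.
have pb : val (p b) = a by rewrite val_insubd !inE eqxx.
have px x : x != b -> val (p x) = x by move=> xb; rewrite val_insubd !inE xb.
have pl x : lab (val (p x)) = lab x.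
  by have [->|/px->//] := eqVneq x b; rewrite pb.
have pK x : p (val x) = x.
  by apply: val_inj; rewrite px //; have := valP x; rewrite !inE.
have pe x y : e x y -> p x = p y \/ sub_rel h (p x) (p y).
  move=> exy; rewrite /sub_rel; have [->|ne] := eqVneq (p x) (p y); [by left|right].
  rewrite /h /star !inE; have [xb|xb] := eqVneq x b; have [yb|yb] := eqVneq y b.
  - by rewrite xb yb eqxx in ne.
  - subst x; rewrite pb (px _ yb) eqxx exy /= andbT.
    by rewrite (_ : y != a) ?orbT //; apply: contraNneq ne => ->; apply/eqP/val_inj; rewrite pb px.
  - subst y; rewrite pb (px _ xb) eqxx (es b x) exy /= andbT.
    by rewrite (_ : x != a) ?orbT //; apply: contraNneq ne => ->; apply/eqP/val_inj; rewrite pb px.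
  by rewrite !px // exy.
have fibE i : fib (fun x => lab (val x)) i = p @: fib lab i.
  apply/setP => x; rewrite inE; apply/idP/imsetP => [lx|[y + ->]].
    by exists (val x); rewrite ?inE ?pK.
  by rewrite inE pl.
split.
- by move=> x y; apply: star_sym.
- by move=> x; apply: star_irr; rewrite ?setD11.
- by move=> x; apply: (br_lt br).
- move=> i i8; have /set0Pn[x xi] := br_ne br i8.
  by rewrite fibE; apply/set0Pn; exists (p x); apply: imset_f.
- by move=> i i8; rewrite fibE; apply: conn_imset pe (br_conn br i8).
- move=> i j ij j8 hij; have /touchesP[x [y [xi yj exy]]] := br_touch br ij j8 hij.
  rewrite !fibE; apply/touchesP; exists (p x), (p y); rewrite !imset_f //.
  split=> //; have [pxy|//] := pe _ _ exy.
  move: xi yj; rewrite !inE -(pl x) pxy pl => /eqP-> /eqP ji.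
  by rewrite ji ltnn in ij.
move=> X' /andP[LX dX]; pose X := [set x | p x \in X'].
have nX y : y \in nb e X -> p y \in nb (sub_rel h) X'.
  case/nbP; rewrite inE => yX [u]; rewrite inE => uX euy.
  have [pu|] := pe _ _ euy; first by rewrite -pu uX in yX.
  exact: mem_nb.
have aX : adm e lab X.
  apply/andP; split; first apply/subsetP => x; rewrite ?inE.
    by move=> lx; apply: (subsetP LX); rewrite inE pl.
  apply/pred0P => x /=; apply/andP => -[]; rewrite !inE => lx h1.
  have : p x \in X' :|: nb (sub_rel h) X'.
    by rewrite inE; case/orP: h1 => [->//|/nX->]; rewrite orbT.
  by rewrite (disjointFr dX) // inE pl.
have c5 := br_cut br aX.
have inj : {in nb e X :\ b &, injective p}.
  move=> x y; rewrite !inE => /andP[xb _] /andP[yb _] pxy.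
  by rewrite -(px _ xb) pxy px.
rewrite leqNgt; apply/negP => c4.
have sub : p @: (nb e X) \subset nb (sub_rel h) X'.
  by apply/subsetP => _ /imsetP[x xX ->]; apply: nX.
have cb : #|nb e X :\ b| <= 4.
  rewrite -(card_in_imset inj) -ltnS; apply: leq_trans c4.
  rewrite ltnS; apply: leq_trans (subset_leq_card sub); apply: subset_leq_card.
  exact/imsetS/subsetDl.
have bX : b \in nb e X.
  by apply: contraLR c5 => bX; rewrite -ltnNge (cardsD1 b) (negPf bX).
have t5 : tight e lab X.
  by rewrite /tight aX eqn_leq c5 (cardsD1 b) bX ltnS cb.
have := cov _ t5; rewrite bX andbT => naX.
suff : #|nb e X| <= #|nb (sub_rel h) X'| by lia.
rewrite -(card_in_imset (f := p) (D := mem (nb e X))) ?subset_leq_card //.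
move=> x y xX yX pxy; have [xb|xb] := eqVneq x b; have [yb|yb] := eqVneq y b.
- by rewrite xb yb.
- have ya : y = a by rewrite -(px _ yb) -pxy xb pb.
  by rewrite ya in yX; rewrite yX in naX.
- have xa : x = a by rewrite -(px _ xb) pxy yb pb.
  by rewrite xa in xX; rewrite xX in naX.
by rewrite -(px _ xb) pxy px.
Qed.

Lemma contract_model (T : finType) (e : rel T) a b k g :
  symmetric e -> irreflexive e -> e a b ->
  model (sub_rel (A := ~: [set b]) (star e a (N e b :\ a))) k g -> model e k g.
Proof.
move=> es ei eab; apply: model_bags; apply: (@bags_star T e (~: [set b]) [set b]).
- exact: es.
- by rewrite disjoint_sym disjoints1 !inE eqxx.
- exact: conn1.
- by rewrite !inE; apply: contraTneq eab => ->; rewrite ei.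
- by apply/subsetP => y; rewrite !inE => /andP[_ eby]; apply: contraTneq eby => ->; rewrite ei.
move=> x; rewrite !inE => /orP[/eqP->|/andP[_ ebx]]; apply: touches1 => //.
by rewrite es.
Qed.

(** * The chain of tight sets when no central edge can be contracted *)

Section Chain.
Variables (T : finType) (e : rel T) (lab : T -> nat).
Hypothesis br : bridge e lab.
Hypothesis noK7 : ~ model e 7 hK7.
Hypothesis cov : forall a b, e a b -> lab a = lab b -> lab a < 4 ->
  exists X, [/\ tight e lab X, a \in nb e X & b \in nb e X].
Let es := br_sym br.
Let ei := br_irr br.
Implicit Types (x y z : T) (X Y Z : {set T}).
Local Notation nb := (nb e).
Local Notation adm := (adm e lab).
Local Notation tight := (tight e lab).
Local Notation L0 := (lside lab).
Local Notation R0 := (rside lab).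

Lemma in_fib i x : (x \in fib lab i) = (lab x == i).
Proof. by rewrite inE. Qed.

(** Given such an edge, merge central bag 0 with the right bag not containing [y]. Among the seven
    resulting bags only the left bag without [x] and the bag of [y] may fail to touch. *)
Lemma no_cross x y : x \in L0 -> y \in R0 -> ~~ e x y.
Proof.
move=> xL yR; apply/negP => exy; apply: noK7.
have [p' pp'] : exists p', [/\ p' < 6, 3 < p', p' != lab x & lab x \in [:: 4; 5]].
  by move: xL; rewrite inE => /orP[/eqP->|/eqP->]; [exists 5|exists 4].
have [q' qq'] : exists q', [/\ q' < 8, 5 < q', q' != lab y & lab y \in [:: 6; 7]].
  by move: yR; rewrite inE => /orP[/eqP->|/eqP->]; [exists 7|exists 6].
pose g i j := (i != j) && [|| ~~ ((3 < i < 6) && (5 < j) || (3 < j < 6) && (5 < i)),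
  (i == lab x) && (j == lab y) | (j == lab x) && (i == lab y)].
apply: (@model_groups _ e (fib lab) 8 g 7 hK7
    [:: [:: p']; [:: lab y]; [:: lab x]; [:: 0; q']; [:: 1]; [:: 2]; [:: 3]]) => //.
- by move=> i; apply: (br_ne br).
- by move=> i; apply: (br_conn br).
- move=> i j _ _ ij; apply/pred0P => z /=; apply/negP; rewrite !in_fib.
  by move=> /andP[/eqP-> /eqP h]; rewrite h eqxx in ij.
- move=> i j i8 j8 /andP[ij /or3P[nc|/andP[/eqP ix /eqP jy]|/andP[/eqP jx /eqP iy]]].
  + have [lt|lt] : i < j \/ j < i by move: ij; clear; lia.
      by apply: (br_touch br) => //; move: nc; rewrite negb_or => /andP[].
    by rewrite touchesC //; apply: (br_touch br) => //; move: nc; rewrite negb_or => /andP[].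
  + by apply/touchesP; exists x, y; rewrite !in_fib ix jy !eqxx.
  by rewrite touchesC //; apply/touchesP; exists x, y; rewrite !in_fib iy jx !eqxx.
case: pp' => p6 p3 pn; case: qq' => q8 q5 qn; rewrite !inE /g.
move: p' q' (lab x) (lab y) p6 p3 q8 q5 pn qn; clear.
move=> [|[|[|[|[|[|]]]]]] // [|[|[|[|[|[|[|[|]]]]]]]] // a b _ _ _ _ pn qn;
  by case/orP => /eqP bE; case/orP => /eqP aE; subst a b.
Qed.

Lemma lab_T x : x \notin L0 -> x \notin R0 -> lab x < 4.
Proof. by rewrite !inE; have := br_lt br x; clear; lia. Qed.

Lemma admI X Y : adm X -> adm Y -> adm (X :&: Y).
Proof.
move=> /andP[LX dX] /andP[LY dY]; rewrite /adm subsetI LX LY /=.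
apply/pred0P => z /=; apply/andP => -[zR]; rewrite in_setU => zXY.
have : z \in X :|: nb X.
  case/orP: zXY => [|/nbP[_ [u]]]; rewrite inE => /andP[]; first by rewrite inE => ->.
  by move=> uX _; apply: nb_closed.
by rewrite (disjointFr dX zR).
Qed.

Lemma admU X Y : adm X -> adm Y -> adm (X :|: Y).
Proof.
move=> /andP[LX dX] /andP[LY dY]; rewrite /adm (subset_trans LX (subsetUl _ _)) /=.
apply/pred0P => z /=; apply/andP => -[zR]; rewrite in_setU => zXY.
have : (z \in X :|: nb X) || (z \in Y :|: nb Y).
  case/orP: zXY => [|/nb_setU]; first by rewrite !in_setU => /orP[]->; rewrite ?orbT.
  by rewrite !in_setU => /orP[]->; rewrite ?orbT.
by rewrite (disjointFr dX zR) (disjointFr dY zR).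
Qed.

Lemma tight_adm X : tight X -> adm X.
Proof. by case/andP. Qed.

Lemma tight_card X : tight X -> #|nb X| = 5.
Proof. by case/andP => _ /eqP. Qed.

(** Both new cuts have at least five vertices and submodularity allows ten in total, so equality
    holds for the sums and therefore at each vertex. *)
Lemma tightIU X Y : tight X -> tight Y ->
  [/\ tight (X :&: Y), tight (X :|: Y) & forall a,
    (a \in nb (X :&: Y)) + (a \in nb (X :|: Y)) = (a \in nb X) + (a \in nb Y)].
Proof.
move=> tX tY; have aI := admI (tight_adm tX) (tight_adm tY).
have aU := admU (tight_adm tX) (tight_adm tY).
have := card_submod e X Y; rewrite (tight_card tX) (tight_card tY) => sub.
have cI := br_cut br aI; have cU := br_cut br aU.
have eI : #|nb (X :&: Y)| = 5 by move: sub cI cU; clear; lia.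
have eU : #|nb (X :|: Y)| = 5 by move: sub cI cU; clear; lia.
split; rewrite ?/tight ?aI ?aU ?eI ?eU //= => a.
apply/eqP; rewrite eqn_leq nb_submod leqNgt; apply/negP => lt.
have : #|nb (X :&: Y)| + #|nb (X :|: Y)| < #|nb X| + #|nb Y|.
  rewrite !card_sum1 -!big_split (bigD1 a) //= [X in _ < X](bigD1 a) //=.
  by rewrite -addSn leq_add //; apply: leq_sum => x _; apply: nb_submod.
by rewrite eI eU (tight_card tX) (tight_card tY).
Qed.

Lemma nbI X Y a : tight X -> tight Y -> a \in nb Y -> a \in X :|: nb X ->
  a \in nb (Y :&: X).
Proof.
move=> tX tY aY aX; have [_ _ /(_ a)] := tightIU tY tX; rewrite aY.
move: aX; rewrite in_setU => /orP[aX|->]; last first.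
  by case: (a \in nb (_ :&: _)) => //; case: (a \in nb _).
have -> : (a \in nb (Y :|: X)) = false.
  by apply/negP => /nb_notin; rewrite in_setU aX orbT.
by case: (a \in nb (_ :&: _)) => //; case: (a \in nb _).
Qed.

Lemma nbU X Y a : a \in nb Y -> a \notin X -> a \in nb (Y :|: X).
Proof.
case/nbP => aY [u uY eua] aX; apply: (@mem_nb _ _ _ u) => //.
  by rewrite in_setU uY.
by rewrite in_setU negb_or aY.
Qed.

Lemma nb_lab X z : adm X -> z \in nb X -> lab z < 4.
Proof.
move=> /andP[LX dX] zX; apply: lab_T.
  by apply: contra (nb_notin zX); apply: (subsetP LX).
by apply/negP => zR; have := disjointFr dX zR; rewrite in_setU zX orbT.
Qed.

Lemma adm_lab X z : adm X -> z \in X -> z \notin L0 -> lab z < 4.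
Proof.
move=> /andP[_ dX] zX zL; apply: lab_T => //.
by apply/negP => zR; have := disjointFr dX zR; rewrite in_setU zX.
Qed.

Lemma T_touch i k : i < 4 -> 3 < k -> k < 8 -> touches e (fib lab i) (fib lab k).
Proof.
move=> i4 k3 k8; apply: (br_touch br) => //; first exact: leq_trans i4 k3.
by rewrite /hC2; move: i4; clear; lia.
Qed.

(** A central bag is connected and touches both bag 4 and bag 6, so it crosses the cut. *)
Lemma adm_hit X i : adm X -> i < 4 -> exists2 z, z \in nb X & lab z = i.
Proof.
move=> aX i4; have /andP[LX dX] := aX.
case: (pickP [pred z in nb X | lab z == i]) => [z /= /andP[zX /eqP zi]|no].
  by exists z.
have step u z : u \in X -> z \in fib lab i -> e u z -> z \in X.
  move=> uX zi euz; have := nb_closed uX euz; rewrite in_setU => /orP[//|zX].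
  by have := no z; rewrite /= zX -in_fib zi.
have /touchesP[x [y [xi y4 exy]]] := @T_touch i 4 i4 isT isT.
have xX : x \in X.
  apply: step (xi) _; last by rewrite es in exy; exact: exy.
  by apply: (subsetP LX); move: y4; rewrite !inE => ->.
have sX : fib lab i \subset X.
  apply: subset_trans (subsetIr (fib lab i) X).
  apply: (br_conn br); rewrite ?subsetIl //; first exact: ltn_trans i4 _.
    by apply/set0Pn; exists x; rewrite in_setI xi.
  by move=> u z; rewrite !in_setI => /andP[_ uX] zi euz; rewrite zi (step u).
have /touchesP[u [w [ui w6 euw]]] := @T_touch i 6 i4 isT isT.
have wR : w \in R0 by move: w6; rewrite !inE => ->.
have := nb_closed (subsetP sX _ ui) euw.
by rewrite (disjointFr dX wR).
Qed.

Lemma hit4 Z : (forall i, i < 4 -> exists2 z, z \in Z & lab z = i) -> 4 <= #|Z|.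
Proof.
move=> h; pose f z : 'I_4 := inord (lab z).
have -> : 4 = #|[set: 'I_4]| by rewrite cardsT card_ord.
apply: leq_trans (leq_imset_card f Z); apply/subset_leq_card/subsetP => i _.
have [z zZ zi] := h i (ltn_ord i); apply/imsetP; exists z => //.
by rewrite /f zi inord_val.
Qed.

(** Five vertices carry all four labels. If [u] were neither [p] nor [q], removing [p] and [u] would
    leave three vertices still carrying four labels. *)
Lemma pair_aux X p q u v : tight X -> p \in nb X -> q \in nb X -> p != q ->
  lab p = lab q -> u \in nb X -> v \in nb X -> u != v -> lab u = lab v ->
  (u == p) || (u == q).
Proof.
move=> tX pX qX pq lpq uX vX uv luv; apply: contraT; rewrite negb_or => /andP[up uq].
suff /hit4 : forall i, i < 4 -> exists2 z, z \in nb X :\ p :\ u & lab z = i.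
  have := cardsD1 u (nb X :\ p); have := cardsD1 p (nb X).
  by rewrite !inE up uX pX (tight_card tX); clear; lia.
have qZ : q \in nb X :\ p :\ u by rewrite !inE qX eq_sym uq eq_sym pq.
move=> i i4; have [z zX zi] := adm_hit (tight_adm tX) i4.
have [zp|zp] := eqVneq z p; first by exists q => //; rewrite -lpq -zp.
have [zu|zu] := eqVneq z u; last by exists z => //; rewrite !inE zu zp.
have [vp|vp] := eqVneq v p; first by exists q => //; rewrite -lpq -vp -luv -zu.
by exists v; [rewrite !inE eq_sym uv vp|rewrite -luv -zu].
Qed.

Lemma pair_uniq X p q u v : tight X -> p \in nb X -> q \in nb X -> p != q ->
  lab p = lab q -> u \in nb X -> v \in nb X -> u != v -> lab u = lab v ->
  (u = p /\ v = q) \/ (u = q /\ v = p).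
Proof.
move=> tX pX qX pq lpq uX vX uv luv.
have := pair_aux tX pX qX pq lpq uX vX uv luv.
have vu : v != u by rewrite eq_sym.
have := pair_aux tX pX qX pq lpq vX uX vu (esym luv).
by case/orP => /eqP hv; case/orP => /eqP hu; subst u v; rewrite ?eqxx in uv; auto.
Qed.

(** The separators of the chain: the doubled pair is an edge. By [cov], every edge inside a central
    bag is the doubled pair of such a set. *)
Definition marked X := tight X && [exists p in nb X, [exists q in nb X,
  e p q && (lab p == lab q)]].

Lemma markedP X : reflect (tight X /\ exists p q,
    [/\ p \in nb X, q \in nb X, e p q & lab p = lab q]) (marked X).
Proof.
apply: (iffP andP) => -[tX].
  case/exists_inP => p pX /exists_inP[q qX /andP[epq /eqP l]].
  by split=> //; exists p, q.
move=> [p [q [pX qX epq l]]]; split=> //; apply/exists_inP; exists p => //.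
by apply/exists_inP; exists q => //; rewrite epq l eqxx.
Qed.

Lemma marked_tight X : marked X -> tight X.
Proof. by case/andP. Qed.

Lemma e_neq x y : e x y -> x != y.
Proof. by apply: contraTneq => ->; rewrite ei. Qed.

Lemma marked_adj X p q : marked X -> p \in nb X -> q \in nb X -> p != q ->
  lab p = lab q -> e p q.
Proof.
case/markedP => tX [p' [q' [p'X q'X ep'q' l']]] pX qX pq l.
case: (pair_uniq tX p'X q'X (e_neq ep'q') l' pX qX pq l) => -[-> ->] //.
by rewrite es.
Qed.

Lemma mate2 v z : lab v = lab z -> v != z -> exists2 w, e v w & lab w = lab v.
Proof.
move=> l vz; case: (pickP [pred w | e v w && (lab w == lab v)]) => [w|no].
  by case/andP => evw /eqP lw; exists w.
have sv : fib lab (lab v) \subset [set v].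
  apply: (br_conn br (br_lt br v)).
  - by rewrite sub1set in_fib.
  - by apply/set0Pn; exists v; rewrite inE.
  move=> x y; rewrite !inE => /eqP-> ly evy.
  by have := no y; rewrite /= evy ly.
have := subsetP sv z; rewrite in_fib l eqxx inE => /(_ isT)/eqP zv.
by rewrite zv eqxx in vz.
Qed.

Lemma mate X v : adm X -> lab v < 4 -> v \notin nb X ->
  exists2 w, e v w & lab w = lab v.
Proof.
move=> aX v4 vX; have [z zX zl] := adm_hit aX v4.
by apply: (mate2 (esym zl)); apply: contraNneq vX => ->.
Qed.

Lemma adm_L0 : adm L0.
Proof.
rewrite /adm subxx; apply/pred0P => z /=; apply/negP => /andP[zR].
rewrite in_setU => /orP[|/nbP[_ [u uL euz]]]; last by rewrite (negPf (no_cross uL zR)) in euz.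
by move: zR; rewrite !inE => /orP[]/eqP->.
Qed.

(** Let [X] be a smallest marked set. A central vertex of [X] and a neighbour in its bag lie on a
    tight cut; intersecting that tight set with [X] gives a smaller marked set. So [X] has no
    central vertex. *)
Lemma marked_L0 : marked L0.
Proof.
have [p [q [pX qX pq l]]] : exists p q, [/\ p \in nb L0, q \in nb L0, p != q & lab p = lab q].
  apply: NNPP => no; have := br_cut br adm_L0; apply/negP; rewrite -ltnNge.
  pose f z : 'I_4 := inord (lab z).
  rewrite -(card_in_imset (f := f) (D := mem (nb L0))).
    by rewrite ltnS; apply: leq_trans (max_card _) _; rewrite card_ord.
  move=> x y xX yX /(congr1 (@nat_of_ord 4)); rewrite /f !inordK ?(nb_lab adm_L0) // => lxy.
  by apply/eqP; apply: contraT => xy; case: no; exists x, y.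
have p4 := nb_lab adm_L0 pX; have [w epw lw] := mate2 l pq.
have [X0 [tX0 pX0 wX0]] := cov epw (esym lw) p4.
have E0 : marked X0 by apply/markedP; split=> //; exists p, w.
case: (arg_minnP (fun X : {set T} => #|X|) E0) => X EX minX.
have tX := marked_tight EX; have aX := tight_adm tX.
suff -> : L0 = X by [].
apply/eqP; rewrite eqEsubset; have /andP[-> _] := aX; apply/subsetP => x xX.
apply: contraT => xL; have x4 := adm_lab aX xX xL.
have xnX : x \notin nb X by apply/negP => /nb_notin; rewrite xX.
have [y exy ly] := mate aX x4 xnX.
have [Y [tY xY yY]] := cov exy (esym ly) x4.
have [tI _ _] := tightIU tY tX.
have xI : x \in nb (Y :&: X) by apply: nbI; rewrite // in_setU xX.
have yI : y \in nb (Y :&: X) by apply: nbI => //; apply: nb_closed exy.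
have EI : marked (Y :&: X) by apply/markedP; split=> //; exists x, y.
have : Y :&: X == X by rewrite eqEcard subsetIr minX.
by move/eqP/setIidPr/subsetP/(_ x xX) => xY'; have := nb_notin xY; rewrite xY'.
Qed.

Definition terminal X := forall Y, marked Y -> X \subset Y -> Y = X.

Record step X g q s r : Prop := Step {
  st_g : g \in nb X; st_q : q \in nb X; st_gq : g != q; st_lgq : lab g = lab q;
  st_s : s \notin X :|: nb X; st_gs : e g s; st_r : r \in nb X; st_rg : r != g;
  st_lsr : lab s = lab r; st_sr : e s r; st_lsg : lab s != lab g;
  st_marked : marked (g |: X); st_nb : nb (g |: X) = s |: (nb X :\ g) }.

(** [Y] is a smallest marked set properly above [X]. By uncrossing, an edge of a central bag lying
    in the closure of [Y] and outside [X] is on one of the two cuts. Hence each vertex of [Y]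
    outside [X] is on [nb X] and doubled there with a vertex outside [Y]; as only one pair is
    doubled, [Y] exceeds [X] by a single vertex. *)
Lemma terminal_or_step X : marked X -> terminal X \/ exists g q s r, step X g q s r.
Proof.
move=> EX; have tX := marked_tight EX; have aX := tight_adm tX.
case: (pickP [pred Y | marked Y && (X \proper Y)]) => [Y0 E0|no]; [right|left]; last first.
  move=> Y EY XY; apply/eqP; rewrite eq_sym eqEsubset XY /=.
  by have := no Y; rewrite /= EY properE XY => /negbFE.
case: (arg_minnP (fun X : {set T} => #|X|) E0) => Y /andP[EY pXY] minY {Y0 E0}.
have tY := marked_tight EY; have aY := tight_adm tY.
have XY := proper_sub pXY.
have between a b : e a b -> lab a = lab b -> lab a < 4 -> a \in Y :|: nb Y ->
    b \in Y :|: nb Y -> a \notin X -> b \notin X ->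
    (a \in nb X) && (b \in nb X) || (a \in nb Y) && (b \in nb Y).
  move=> eab l a4 aYY bYY anX bnX; have [Z [tZ aZ bZ]] := cov eab l a4.
  have [_ tZX _] := tightIU tZ tX; have [tI _ _] := tightIU tZX tY.
  pose W := (Z :|: X) :&: Y.
  have aW : a \in nb W by apply: nbI => //; apply: nbU.
  have bW : b \in nb W by apply: nbI => //; apply: nbU.
  have EW : marked W by apply/markedP; split=> //; exists a, b.
  have XW : X \subset W by rewrite subsetI subsetUr.
  have [WX|] := boolP (W \subset X).
    have WX' : W = X by apply/eqP; rewrite eqEsubset WX.
    by rewrite -WX' aW bW.
  move=> WX; have EW' : marked W && (X \proper W) by rewrite EW properE XW.
  have : W == Y by rewrite eqEcard subsetIr (minY W EW').
  by move/eqP => WY; rewrite -WY aW bW orbT.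
have labYX g : g \in Y -> g \notin X -> lab g < 4.
  move=> gY gX; apply: (adm_lab aY gY); apply: contra gX.
  by have /andP[LX _] := aX; apply: (subsetP LX).
have notnbY g : g \in Y -> g \in nb Y = false.
  by move=> gY; apply/negP => /nb_notin; rewrite gY.
have gnb g : g \in Y -> g \notin X -> g \in nb X.
  move=> gY gX; apply: contraT => gnX.
  have [w egw lw] := mate aX (labYX g gY gX) gnX.
  have wX : w \notin X.
    by apply: contra gnX => wX; apply: (mem_nb wX gX); rewrite es.
  have := between g w egw (esym lw) (labYX g gY gX) _ (nb_closed gY egw) gX wX.
  by rewrite in_setU gY (negPf gnX) notnbY // => /(_ isT).
(* Otherwise the whole bag of [g] would lie in [Y], although [nb Y] meets every central bag. *)
have partner g : g \in Y -> g \notin X -> exists q, [/\ q \in nb X, q \notin Y & lab q = lab g].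
  move=> gY gX; have g4 := labYX g gY gX.
  case: (pickP [pred q in nb X | (q \notin Y) && (lab q == lab g)]) => [q|no].
    by case/and3P => qX qY /eqP lq; exists q.
  have inY q : q \in nb X -> lab q = lab g -> q \in Y.
    move=> qX lq; have := no q; rewrite /= qX lq eqxx andbT.
    by case: (q \in Y).
  have sY : fib lab (lab g) \subset Y.
    apply: subset_trans (subsetIr (fib lab (lab g)) Y).
    apply: (br_conn br (br_lt br g)); first exact: subsetIl.
      by apply/set0Pn; exists g; rewrite in_setI in_fib eqxx.
    move=> u y; rewrite !in_setI !in_fib => /andP[/eqP lu uY] ly euy; rewrite ly /=.
    apply: contraT => yY; have yX : y \notin X by apply: contra yY; apply: (subsetP XY).
    have [uX|uX] := boolP (u \in X).
      by case/negP: yY; apply: (inY y (mem_nb uX yX euy) (eqP ly)).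
    have := between u y euy (etrans lu (esym (eqP ly))) (labYX u uY uX) _
      (nb_closed uY euy) uX yX.
    rewrite in_setU uY (notnbY u uY) /= orbF => /(_ isT) /andP[_ ynX].
    by case/negP: yY; apply: (inY y ynX (eqP ly)).
  have [z zY zl] := adm_hit aY g4.
  by have := subsetP sY z; rewrite in_fib zl eqxx => /(_ isT) zY'; have := nb_notin zY; rewrite zY'.
have /properP[_ [g gY gX]] := pXY.
have [q [qX qY lq]] := partner g gY gX.
have gnX := gnb g gY gX.
have gq : g != q by apply: contraNneq qY => <-.
have YE : Y = g |: X.
  apply/eqP; rewrite eqEsubset subUset sub1set gY XY !andbT.
  apply/subsetP => g' g'Y; rewrite in_setU1; case: (boolP (g' \in X)) => g'X; first by rewrite orbT.
  have [q' [q'X q'Y lq']] := partner g' g'Y g'X.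
  have g'q' : g' != q' by apply: contraNneq q'Y => <-.
  case: (pair_uniq tX gnX qX gq (esym lq) (gnb g' g'Y g'X) q'X g'q' (esym lq')) => -[h1 h2].
    by rewrite h1 eqxx.
  by rewrite h1 (negPf qY) in g'Y.
have subZ : nb X :\ g \subset nb Y.
  apply/subsetP => z; rewrite in_setD1 => /andP[zg /nbP[zX [u uX euz]]].
  apply: (@mem_nb _ _ _ u) => //; first exact: (subsetP XY).
  by rewrite YE in_setU1 negb_or zg.
have card4 : #|nb X :\ g| = 4.
  by have := cardsD1 g (nb X); rewrite gnX (tight_card tX); clear; lia.
have [s sY snX] : exists2 s, s \in nb Y & s \notin nb X :\ g.
  apply/subsetPn; apply/negP => /subset_leq_card.
  by rewrite card4 (tight_card tY).
have nbY : nb Y = s |: (nb X :\ g).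
  apply/esym/eqP; rewrite eqEcard subUset sub1set sY subZ /=.
  by rewrite cardsU1 snX card4 (tight_card tY).
have snY := nb_notin sY.
have sX : s \notin X by apply: contra snY; apply: (subsetP XY).
have sg : s != g by apply: contraNneq snY => ->.
have snbX : s \notin nb X by move: snX; rewrite in_setD1 sg.
have egs : e g s.
  have /nbP[_ [u]] := sY; rewrite {1}YE in_setU1 => /orP[/eqP->//|uX eus].
  by rewrite (mem_nb uX sX eus) in snbX.
have lsg : lab s != lab g.
  apply/eqP => lsg; have := between g s egs (esym lsg) (labYX g gY gX) _ _ gX sX.
  by rewrite !in_setU gY sY orbT (negPf snbX) notnbY // andbF => /(_ isT isT).
have [r [rX rg lr esr]] : exists r, [/\ r \in nb X, r != g, lab s = lab r & e s r].
  have /markedP[_ [a [b [aY' bY eab l]]]] := EY.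
  move: aY' bY; rewrite nbY !in_setU1 !in_setD1.
  case/orP => [/eqP as_|/andP[ag aX']]; case/orP => [/eqP bs|/andP[bg bX]].
  - by move: eab; rewrite as_ bs ei.
  - by exists b; rewrite -as_ l.
  - by exists a; rewrite -bs l es.
  by case: (pair_uniq tX gnX qX gq (esym lq) aX' bX (e_neq eab) l) => -[ea eb];
    [rewrite ea eqxx in ag|rewrite eb eqxx in bg].
exists g, q, s, r; split=> //; rewrite -?YE //.
by rewrite in_setU negb_or sX.
Qed.

Lemma terminal_all X : marked X -> terminal X -> forall v, lab v < 4 -> v \in X :|: nb X.
Proof.
move=> EX term v v4; apply: contraT; rewrite in_setU negb_or => /andP[vX vnX].
have tX := marked_tight EX.
have [w evw lw] := mate (tight_adm tX) v4 vnX.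
have wX : w \notin X by apply: contra vnX => wX; apply: (mem_nb wX vX); rewrite es.
have [Z [tZ vZ wZ]] := cov evw (esym lw) v4.
have [_ tU _] := tightIU tZ tX.
have vU := nbU vZ vX; have wU := nbU wZ wX.
have EU : marked (Z :|: X) by apply/markedP; split=> //; exists v, w.
by move: vU; rewrite (term _ EU (subsetUr _ _)) (negPf vnX).
Qed.
End Chain.

(* The strands are the vertices 0, ..., 4, the left blobs 5 and 6, the right
   ones 7 and 8; blob 5 misses strand a', 6 misses a, 7 misses b', 8 misses b. *)
Definition gstrands a a' b b' x y w : rel nat := fun i j =>
  let base i j :=
    if j < 5 then (i, j) \in [:: (x, w); (y, w); (a, a'); (b, b')]
    else if i < 5 then
      nth false [:: i != a'; i != a; i != b'; i != b] (j - 5)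
    else (i, j) \in [:: (5, 6); (7, 8)] in
  base i j || base j i.

(** Only {x, y} and {6, 8} may remain nonadjacent. Merging [a] with 5 and [b] with 7 repairs the
    other gaps, with the help of the edges a a' and b b'. *)
Definition strands_ok a b b' x y w :=
  uniq [:: a; b; x; y; w] && (b != b') ==>
  groups_ok 9 (gstrands a (1 - a) b b' x y w) 7 hK7
    [:: [:: x]; [:: y]; [:: 6]; [:: 8]; [:: w]; [:: a; 5]; [:: b; 7]].

Lemma all_iota n (P : pred nat) i : all P (iota 0 n) -> i < n -> P i.
Proof. by move=> /allP h ni; apply: h; rewrite mem_iota. Qed.

Lemma strands_okT a b b' x y w : a < 2 -> b < 5 -> b' < 5 -> x < 5 -> y < 5 ->
  w < 5 -> strands_ok a b b' x y w.
Proof.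
have : all (fun a => all (fun b => all (fun b' => all (fun x => all (fun y =>
  all (strands_ok a b b' x y) (iota 0 5)) (iota 0 5)) (iota 0 5)) (iota 0 5))
  (iota 0 5)) (iota 0 2) by vm_cast_no_check (erefl true).
move=> h a2 b5 b5' x5 y5 w5.
have := all_iota (all_iota (all_iota (all_iota (all_iota (all_iota h a2) b5) b5') x5) y5) w5.
by [].
Qed.

Lemma oth_mem x y b : x < 5 -> y < 5 -> (b \in oth x y) = [&& b < 5, b != x & b != y].
Proof.
have -> : oth x y = if (x < 5) && (y < 5) then others x y else oth x y.
  by move: x y => [|[|[|[|[|x]]]]] [|[|[|[|[|y]]]]].
by move=> -> ->; rewrite mem_filter mem_iota /= add0n andbC.
Qed.

Lemma not_free P col H A : P.1 < 5 -> P.2 < 5 -> ~~ free (P, col, H, A) ->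
  exists a b x y w, [/\ a < 2, b \in [:: P.1; P.2], uniq [:: a; b; x; y; w],
    [/\ x < 5, y < 5 & w < 5] & nth false H (tr x w) && nth false H (tr y w)].
Proof.
move=> P1 P2 /allPn[a a2 /allPn[b bP]]; case: eqP => // /eqP ab.
have a5 : a < 2 by move: a2; rewrite !inE => /orP[]/eqP->.
have b5 : b < 5 by move: bP; rewrite !inE => /orP[]/eqP->.
have a5' : a < 5 by apply: leq_trans a5 _.
have om z : z \in oth a b -> [&& z < 5, z != a & z != b] by rewrite oth_mem.
have uo : uniq (oth a b).
  by move: a b a5 b5 {ab a2 bP a5' om} => [|[|a]] [|[|[|[|[|b]]]]].
case E: (oth a b) om uo => [|c [|d [|f [|]]]] //= om.
rewrite !inE negb_or !andbT => /andP[/andP[cd cf] df].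
have /and3P[c5 ca cb] : [&& c < 5, c != a & c != b] by apply: om; rewrite inE eqxx.
have /and3P[d5 da db] : [&& d < 5, d != a & d != b] by apply: om; rewrite !inE eqxx orbT.
have /and3P[f5 fa fb] : [&& f < 5, f != a & f != b] by apply: om; rewrite !inE eqxx !orbT.
rewrite (trC c5 d5) (trC d5 f5).
have dc := trC c5 d5; have fd := trC d5 f5; have fc := trC c5 f5.
case hcd: (nth false H (tr d c)); case hcf: (nth false H (tr c f)) => //=.
- move=> _; exists a, b, d, f, c; split=> //; last by rewrite hcd -fc hcf.
  by rewrite /= !inE !negb_or ab ![a == _]eq_sym ![b == _]eq_sym ca da fa cb db fb df
    ![_ == c]eq_sym cd cf.
- move/negPn => hdf; exists a, b, c, f, d; split=> //; last by rewrite dc hcd hdf.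
  by rewrite /= !inE !negb_or ab ![a == _]eq_sym ![b == _]eq_sym ca da fa cb db fb cd cf
    ![_ == d]eq_sym df.
move/negPn => hdf; exists a, b, c, d, f; split=> //; last by rewrite hcf fd hdf.
by rewrite /= !inE !negb_or ab ![a == _]eq_sym ![b == _]eq_sym ca da fa cb db fb cd cf df.
Qed.

(** * Two connected halves on either side of a separator *)

Section Strands.
Variables (T : finType) (e : rel T) (lab : T -> nat).
Hypothesis br : bridge e lab.
Hypothesis noK7 : ~ model e 7 hK7.
Hypothesis cov : forall a b, e a b -> lab a = lab b -> lab a < 4 ->
  exists X, [/\ tight e lab X, a \in nb e X & b \in nb e X].
Let es := br_sym br.
Let ei := br_irr br.
Implicit Types (x y z : T) (X Y Z U : {set T}).
Local Notation nb := (nb e).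
Local Notation tight := (tight e lab).
Local Notation L0 := (lside lab).
Local Notation R0 := (rside lab).

(* Two touching connected sets in U, both adjacent to all of N(X), except that
   p may miss B2 and q may miss B1. *)
Definition halves X U p q := exists B1 B2,
  [/\ conn e B1, conn e B2, B1 != set0, B2 != set0 & [disjoint B1 & B2]] /\
  [/\ B1 \subset U, B2 \subset U, touches e B1 B2,
    forall z, z \in nb X -> z != p -> touches e [set z] B2 &
    forall z, z \in nb X -> z != q -> touches e [set z] B1].

Lemma halves_sym X U p q : halves X U p q -> halves X U q p.
Proof.
move=> [B1 [B2 [[c1 c2 n1 n2 d] [s1 s2 t h2 h1]]]]; exists B2, B1.
by rewrite disjoint_sym touchesC.
Qed.

(** A vertex alone in its bag on the cut sees both blobs. For the doubled pair, each blob is seen by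
    [p] or [q] and each of [p], [q] sees a blob, so one can be assigned to [p] and the other to
    [q]. *)
Lemma halves_base X U k p q : tight X -> p \in nb X -> q \in nb X -> p != q ->
  lab p = lab q -> k = 4 \/ k = 6 ->
  fib lab k :|: fib lab k.+1 \subset U ->
  (forall l i, k <= l <= k.+1 -> i < 4 ->
    exists w, [/\ w \in nb X, lab w = i & touches e [set w] (fib lab l)]) ->
  (forall z, z \in nb X -> touches e [set z] (fib lab k) \/
     touches e [set z] (fib lab k.+1)) ->
  halves X U p q.
Proof.
move=> tX pX qX pq lpq k46 sU h1 h2.
have k8 : k.+1 < 8 by case: k46 => ->.
have single z l : z \in nb X -> z != p -> z != q -> k <= l <= k.+1 ->
    touches e [set z] (fib lab l).
  move=> zX zp zq kl.
  have [w [wX lw tw]] := h1 l (lab z) kl (nb_lab br (tight_adm tX) zX).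
  have [->//|wz] := eqVneq z w.
  case: (pair_uniq br tX pX qX pq lpq zX wX wz (esym lw)) => -[zE _];
    by rewrite zE eqxx in zp zq *.
have pair l : k <= l <= k.+1 -> touches e [set p] (fib lab l) \/ touches e [set q] (fib lab l).
  move=> kl; have [w [wX lw tw]] := h1 l (lab p) kl (nb_lab br (tight_adm tX) pX).
  have [wp|wp] := eqVneq w p; first by left; rewrite -wp.
  right; have pw : p != w by rewrite eq_sym.
  by case: (pair_uniq br tX pX qX pq lpq pX wX pw (esym lw)) => -[h3 h4];
    [rewrite -h4|rewrite h3 eqxx in pq].
have mk l l' : k <= l <= k.+1 -> k <= l' <= k.+1 -> l != l' ->
    touches e [set p] (fib lab l) -> touches e [set q] (fib lab l') -> halves X U p q.
  move=> kl kl' ll' tp tq; exists (fib lab l), (fib lab l').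
  have l8 : l < 8 by move: kl k8; clear; lia.
  have l8' : l' < 8 by move: kl' k8; clear; lia.
  have sub j : k <= j <= k.+1 -> fib lab j \subset U.
    move=> kj; apply: subset_trans sU; have : j = k \/ j = k.+1 by move: kj; clear; lia.
    by case=> ->; rewrite ?subsetUl ?subsetUr.
  split; split; try by [apply: (br_conn br)|apply: (br_ne br)|apply: sub].
  - apply/pred0P => z /=; apply/negP; rewrite !in_fib => /andP[/eqP-> /eqP h].
    by rewrite h eqxx in ll'.
  - have : (l = k /\ l' = k.+1) \/ (l = k.+1 /\ l' = k) by move: kl kl' ll'; clear; lia.
    have hk : hC2 k k.+1 by case: k46 => ->.
    by case=> -[-> ->]; [|rewrite touchesC //]; apply: (br_touch br).
  - move=> z zX zp; have [->//|zq] := eqVneq z q; exact: single.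
  move=> z zX zq; have [->//|zp] := eqVneq z p; exact: single.
have k0 : k <= k <= k.+1 by rewrite leqnn leqnSn.
have k1 : k <= k.+1 <= k.+1 by rewrite leqnn leqnSn.
have kk : k != k.+1 by rewrite neq_ltn ltnSn.
have kk' : k.+1 != k by rewrite eq_sym.
case: (h2 p pX) => tp; case: (h2 q qX) => tq.
- by case: (pair k.+1 k1) => t; [apply: (mk k.+1 k)|apply: (mk k k.+1)].
- exact: (mk k k.+1).
- exact: (mk k.+1 k).
by case: (pair k k0) => t; [apply: (mk k k.+1)|apply: (mk k.+1 k)].
Qed.

Lemma left_halves p q : p \in nb L0 -> q \in nb L0 -> p != q -> lab p = lab q ->
  halves L0 L0 p q.
Proof.
move=> pL qL pq l; have tL := marked_tight (marked_L0 br noK7 cov).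
apply: (halves_base (k := 4)) => //; first by left.
- by apply/subsetP => x; rewrite !inE.
- move=> j i j45 i4; have j3 : 3 < j by case/andP: j45.
  have j8 : j < 8 by move: j45; clear; lia.
  have /touchesP[w [y [wi yj ewy]]] := T_touch br i4 j3 j8.
  have yL : y \in L0 by move: yj j45; rewrite !inE => /eqP->; clear; lia.
  exists w; split.
  + apply: (mem_nb yL); last by rewrite es.
    by move: wi; rewrite !inE => /eqP->; move: i4; clear; lia.
  + by apply/eqP; rewrite -in_fib.
  by apply/touchesP; exists w, y; rewrite inE eqxx.
move=> z /nbP[_ [u uL euz]]; move: (uL); rewrite inE => /orP[]/eqP lu; [left|right];
  by apply/touchesP; exists z, u; rewrite in_fib lu inE !eqxx es.
Qed.

(** Nothing central lies beyond a terminal cut. So each [z] on it sees a right blob, since otherwise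
    adding [z] to [X] would leave a cut of four vertices. *)
Lemma right_base X p q : marked e lab X -> terminal e lab X -> p \in nb X ->
  q \in nb X -> p != q -> lab p = lab q -> halves X (~: (X :|: nb X)) p q.
Proof.
move=> EX term pX qX pq l; have tX := marked_tight EX; have aX := tight_adm tX.
have [LX dX] := andP aX; have all_T := terminal_all br cov EX term.
have notX y : y \in R0 -> y \in ~: (X :|: nb X).
  by move=> yR; rewrite inE (disjointFr dX yR).
apply: (halves_base (k := 6)) => //; first by right.
- by apply/subsetP => x; rewrite in_setU !in_fib => h; apply: notX; rewrite inE.
- move=> j i j67 i4; have j3 : 3 < j by case/andP: j67 => h _; apply: leq_trans h.
  have j8 : j < 8 by move: j67; clear; lia.
  have /touchesP[w [y [wi yj ewy]]] := T_touch br i4 j3 j8.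
  have yR : y \in R0 by move: yj j67; rewrite !inE => /eqP->; clear; lia.
  have lw : lab w = i by apply/eqP; rewrite -in_fib.
  exists w; split=> //; last by apply/touchesP; exists w, y; rewrite inE eqxx.
  have := all_T w; rewrite lw in_setU => /(_ i4) /orP[wX|//].
  by have := nb_closed wX ewy; have := notX y yR; rewrite inE => /negPf->.
move=> z zX; have z4 := nb_lab br aX zX.
have [u uR ezu] : exists2 u, u \in R0 & e z u; last first.
  by move: (uR); rewrite inE => /orP[]/eqP lu; [left|right];
    apply/touchesP; exists z, u; rewrite in_fib lu inE !eqxx.
case: (pickP [pred u in R0 | e z u]) => [u /andP[uR ezu]|no]; first by exists u.
have noR u : u \in R0 -> e z u = false by move=> uR; have := no u; rewrite /= uR.
have zL : z \notin L0 by apply: contra (nb_notin zX); apply: (subsetP LX).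
have zR : z \notin R0 by rewrite inE; move: z4; clear; lia.
have sub : nb (z |: X) \subset nb X :\ z.
  apply/subsetP => y /nbP[]; rewrite in_setU1 negb_or => /andP[yz yX] [u].
  rewrite in_setD1 yz in_setU1 => /orP[/eqP->|uX euy] /=; last exact: mem_nb euy.
  move=> ezy; have yL : y \notin L0 by apply: contra yX; apply: (subsetP LX).
  have yR : y \notin R0 by apply/negP => /noR; rewrite ezy.
  by have := all_T y (lab_T br yL yR); rewrite in_setU (negPf yX).
have : adm e lab (z |: X).
  rewrite /adm (subset_trans LX (subsetUr _ _)); apply/pred0P => y /=.
  apply/negP => /andP[yR]; rewrite in_setU in_setU1 -orbA => /or3P[/eqP yz|yX|].
  - by rewrite -yz yR in zR.
  - by have := disjointFr dX yR; rewrite in_setU yX.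
  by move/(subsetP sub); rewrite in_setD1 => /andP[_ yX];
    have := disjointFr dX yR; rewrite in_setU yX orbT.
move/(br_cut br); move/subset_leq_card: sub.
by have := cardsD1 z (nb X); rewrite zX (tight_card tX); clear; lia.
Qed.

(** Backwards along the chain: halves for [g |: X] with exceptions [s], [r] become halves for [X]
    with exceptions [g], [q'] once [s] is added to [B1]. Indeed [g] and [r] both see [s], and [s] is
    not on [nb X]. *)
Lemma right_halves X p q : marked e lab X -> p \in nb X -> q \in nb X -> p != q ->
  lab p = lab q -> halves X (~: (X :|: nb X)) p q.
Proof.
have [n] := ubnP #|~: X|; elim: n => // n IH in X p q *; rewrite ltnS => Xn.
move=> EX pX qX pq lpq; have tX := marked_tight EX.
have [term|[g [q' [s [r st]]]]] := terminal_or_step br cov EX; first exact: right_base.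
case: st => gX q'X gq' lgq' sXX egs rX rg lsr esr lsg EY nY.
have gnX := nb_notin gX.
have [snX snbX] : s \notin X /\ s \notin nb X.
  by move: sXX; rewrite in_setU negb_or => /andP[].
suff h : halves X (~: (X :|: nb X)) g q'.
  by case: (pair_uniq br tX gX q'X gq' lgq' pX qX pq lpq) => -[-> ->] //; apply: halves_sym.
have Yn : #|~: (g |: X)| < n.
  apply: leq_trans Xn; apply: proper_card; rewrite properE setCS subsetUr /=.
  by rewrite setCS; apply/negP => /subsetP/(_ g); rewrite setU11 (negPf gnX) => /(_ isT).
have sr : s != r by apply: contraNneq snbX => ->.
have sY : s \in nb (g |: X) by rewrite nY setU11.
have rY : r \in nb (g |: X) by rewrite nY in_setU1 in_setD1 rg rX orbT.
have keep z : z \in nb X -> z != g -> z \in nb (g |: X).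
  by move=> zX zg; rewrite nY in_setU1 in_setD1 zg zX orbT.
have zs z : z \in nb X -> z != s by apply: contraTneq => ->.
have subU : ~: ((g |: X) :|: nb (g |: X)) \subset ~: (X :|: nb X).
  rewrite setCS; apply/subsetP => z; rewrite !in_setU in_set1 => /orP[->|zX].
    by rewrite orbT.
  by have [//|zg] := eqVneq z g; rewrite keep ?orbT.
have [B1 [B2 [[c1 c2 n1 n2 d] [s1 s2 t h2 h1]]]] := IH _ s r Yn EY sY rY sr lsr.
have sB2 : s \notin B2.
  by apply/negP => /(subsetP s2); rewrite in_setC in_setU sY orbT.
exists (s |: B1), B2; split; split=> //.
- by apply: connU => //; [apply: conn1|rewrite (h1 s sY sr) orbT].
- by apply/set0Pn; exists s; rewrite setU11.
- by rewrite disjoints_subset subUset sub1set inE sB2 -disjoints_subset.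
- by rewrite subUset sub1set in_setC sXX (subset_trans s1 subU).
- exact: subset_trans s2 subU.
- by apply: touches_sub t; rewrite ?subsetUr.
- by move=> z zX zg; apply: h2; rewrite ?keep ?zs.
move=> z zX zq'.
have toS w : e s w -> touches e [set w] (s |: B1).
  by move=> esw; apply/touchesP; exists w, s; rewrite setU11 inE eqxx es.
have [->|zg] := eqVneq z g; first by apply: toS; rewrite es.
have [->|zr] := eqVneq z r; first exact: toS.
by apply: touches_sub (h1 z (keep z zX zg) zr); rewrite ?subsetUr.
Qed.
End Strands.

(* Five disjoint connected strands run from the neighbours of the left side to
   those of X; [cs] lists the four labels in the order of the abstract colours. *)
Record strands (T : finType) (e : rel T) (lab : T -> nat) (cs : seq nat)
    (st0 : nat -> T) (X : {set T}) (st : nat -> {set T}) (cur : nat -> T)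
    (s : state) : Prop := Strands {
  sd_conn : forall i, i < 5 -> conn e (st i);
  sd_dis : forall i j, i < 5 -> j < 5 -> i != j -> [disjoint st i & st j];
  sd_sub : forall i, i < 5 -> st i \subset (X :|: nb e X) :\: lside lab;
  sd_ini : forall i, i < 5 -> (st0 i \in st i) && (st0 i \in nb e (lside lab));
  sd_cur : forall i, i < 5 -> (cur i \in st i) && (cur i \in nb e X);
  sd_all : forall z, z \in nb e X -> exists2 i, i < 5 & z = cur i;
  sd_lab01 : lab (st0 0) = lab (st0 1);
  sd_P : [/\ s.1.1.1.1 < 5, s.1.1.1.2 < 5, s.1.1.1.1 != s.1.1.1.2 &
             lab (cur s.1.1.1.1) = lab (cur s.1.1.1.2)];
  sd_col : forall i, i < 5 -> nth 0 s.1.1.2 i = index (lab (cur i)) cs;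
  sd_H : forall a b, a < 5 -> b < 5 -> a != b -> nth false s.1.2 (tr a b) ->
    touches e (st a) (st b);
  sd_A : forall x y, x \in (X :|: nb e X) :\: lside lab ->
    y \in (X :|: nb e X) :\: lside lab -> e x y -> lab x != lab y ->
    nth false s.2 (tr (index (lab x) cs) (index (lab y) cs)) }.

Section Invariant.
Variables (T : finType) (e : rel T) (lab : T -> nat) (cs : seq nat) (st0 : nat -> T).
Hypothesis br : bridge e lab.
Hypothesis noK7 : ~ model e 7 hK7.
Hypothesis cov : forall a b, e a b -> lab a = lab b -> lab a < 4 ->
  exists X, [/\ tight e lab X, a \in nb e X & b \in nb e X].
Hypothesis csP : forall i, i < 4 -> i \in cs.
Hypothesis cs4 : size cs = 4.
Let es := br_sym br.
Let ei := br_irr br.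
Implicit Types (x y z : T) (X Y Z U : {set T}).
Local Notation nb := (nb e).
Local Notation L0 := (lside lab).
Local Notation strands := (strands e lab cs st0).

Lemma cur_inj X st cur s i j : strands X st cur s -> i < 5 -> j < 5 ->
  cur i = cur j -> i = j.
Proof.
move=> sd i5 j5 ij; apply/eqP; apply: contraT => ne.
have /andP[ci _] := sd_cur sd i5; have /andP[cj _] := sd_cur sd j5.
by have := disjointFr (sd_dis sd i5 j5 ne) ci; rewrite ij cj.
Qed.

(** In a state that is not free, the five strands with the left halves at the first cut and the
    right halves at the current one realise [gstrands], hence K_7^=. *)
Lemma strands_free X st cur s : marked e lab X -> strands X st cur s -> free s.
Proof.
move=> EX sd; apply: contraT => nf; case: noK7.
case: s sd nf => [[[P col] H] A] sd nf.
have [/= P1 P2 P12 lP] := sd_P sd.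
have [a [b [x [y [w [a2 bP un [x5 y5 w5] /andP[hx hy]]]]]]] := not_free P1 P2 nf.
have [b' [b5 b5' bb' lb]] : exists b', [/\ b < 5, b' < 5, b != b' & lab (cur b) = lab (cur b')].
  by move: bP; rewrite !inE => /orP[]/eqP->; [exists P.2|exists P.1];
    rewrite // eq_sym.
have a5 : a < 5 by apply: leq_trans a2 _.
have a5' : 1 - a < 5 by move: a2; clear; lia.
have aa' : a != 1 - a by move: a2; clear; lia.
have ini i : i < 5 -> st0 i \in st i by move=> /(sd_ini sd)/andP[].
have iniL i : i < 5 -> st0 i \in nb L0 by move=> /(sd_ini sd)/andP[].
have curS i : i < 5 -> cur i \in st i by move=> /(sd_cur sd)/andP[].
have curX i : i < 5 -> cur i \in nb X by move=> /(sd_cur sd)/andP[].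
have ini_ne i j : i < 5 -> j < 5 -> i != j -> st0 i != st0 j.
  move=> i5 j5 ij; apply: contraTneq (ini i i5) => ->.
  by rewrite (disjointFl (sd_dis sd i5 j5 ij)) ?ini.
have cur_ne i j : i < 5 -> j < 5 -> i != j -> cur i != cur j.
  by move=> i5 j5; apply: contra => /eqP/(cur_inj sd i5 j5)->.
have la : lab (st0 a) = lab (st0 (1 - a)).
  by move: (sd_lab01 sd) a2; case: (a) => [|[|]].
have [A1 [A2 [[cA1 cA2 nA1 nA2 dA] [sA1 sA2 tA h2 h1]]]] :=
  left_halves br noK7 cov (iniL a a5) (iniL _ a5') (ini_ne _ _ a5 a5' aa') la.
have [C1 [C2 [[cC1 cC2 nC1 nC2 dC] [sC1 sC2 tC k2 k1]]]] :=
  right_halves br cov EX (curX b b5) (curX b' b5') (cur_ne _ _ b5 b5' bb') lb.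
have dSA i (Z : {set T}) : i < 5 -> Z \subset L0 -> [disjoint st i & Z].
  move=> i5 ZL; apply/pred0P => z /=; apply/andP => -[/(subsetP (sd_sub sd i5))].
  by rewrite in_setD => /andP[zL _] /(subsetP ZL); rewrite (negPf zL).
have dSC i (Z : {set T}) : i < 5 -> Z \subset ~: (X :|: nb X) -> [disjoint st i & Z].
  move=> i5 ZL; apply/pred0P => z /=; apply/andP => -[/(subsetP (sd_sub sd i5))].
  by rewrite in_setD => /andP[_ zX] /(subsetP ZL); rewrite in_setC zX.
have dAC (Z Z' : {set T}) : Z \subset L0 -> Z' \subset ~: (X :|: nb X) -> [disjoint Z & Z'].
  move=> ZL ZX; apply/pred0P => z /=; apply/andP => -[/(subsetP ZL) zL /(subsetP ZX)].
  have /andP[/andP[/subsetP LX _] _] := marked_tight EX.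
  by rewrite in_setC in_setU (LX _ zL).
pose C i := if i < 5 then st i else nth set0 [:: A1; A2; C1; C2] (i - 5).
have /implyP ok := strands_okT a2 b5 b5' x5 y5 w5.
have CC (Q : {set T} -> Prop) : (forall i, i < 5 -> Q (st i)) -> Q A1 -> Q A2 ->
    Q C1 -> Q C2 -> forall i, i < 9 -> Q (C i).
  move=> q q1 q2 q3 q4 i i9; rewrite /C; case: ifP => [/q//|i5].
  have : i - 5 < 4 by move: i9 i5; clear; lia.
  by case: (i - 5) => [|[|[|[|]]]].
apply: (model_groups (C := C) es _ _ _ _ (ok _)); last by rewrite un.
- by apply: (CC (fun Z => Z != set0)) => // i i5; apply/set0Pn; exists (st0 i); apply: ini.
- by apply: (CC (conn e)) => // i i5; apply: (sd_conn sd).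
- have lt i j : i < j -> j < 9 -> [disjoint C i & C j].
    move=> ij j9; rewrite /C; case: (ltnP j 5) => j5.
      by rewrite (ltn_trans ij j5); apply: (sd_dis sd); rewrite ?(ltn_trans ij j5) // ltn_eqF.
    case: (ltnP i 5) => i5.
      have : j - 5 < 4 by move: j9 j5; clear; lia.
      by case: (j - 5) => [|[|[|[|]]]] //= _; [apply: dSA|apply: dSA|apply: dSC|apply: dSC].
    have : i - 5 < j - 5 by move: ij i5; clear; lia.
    have : j - 5 < 4 by move: j9 j5; clear; lia.
    by case: (i - 5) => [|[|[|[|]]]]; case: (j - 5) => [|[|[|[|]]]] //= _ _; apply: dAC.
  move=> i j i9 j9 ij; have [h|h] : i < j \/ j < i by move: ij; clear; lia.
    exact: lt.
  by rewrite disjoint_sym; apply: lt.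
have tst z i (Z : {set T}) : z \in st i -> touches e [set z] Z -> touches e (st i) Z.
  by move=> zi; apply: touches_sub; rewrite ?sub1set.
have base i j : i < 9 -> j < 9 ->
    (if j < 5 then (i, j) \in [:: (x, w); (y, w); (a, 1 - a); (b, b')]
    else if i < 5 then
      nth false [:: i != 1 - a; i != a; i != b'; i != b] (j - 5)
    else (i, j) \in [:: (5, 6); (7, 8)]) -> touches e (C i) (C j).
  move=> i9 j9; case: ifP => j5.
    rewrite !inE !xpair_eqE; rewrite /C j5.
    have [un1 un2 un3] : [/\ x != w, y != w & true].
      by move: un; rewrite /= !inE !negb_or -!andbA => /and5P[_ _ _ _ /and5P[_ _ _ _ /andP[h /andP[h' _]]]].
    case/or4P => /andP[/eqP-> /eqP->]; rewrite ?x5 ?y5 ?a5 ?b5.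
    + exact: (sd_H sd).
    + exact: (sd_H sd).
    + apply: (tst (st0 a)); first exact: ini.
      apply: touches_sub (touches1 (marked_adj br (marked_L0 br noK7 cov) (iniL a a5)
        (iniL _ a5') (ini_ne _ _ a5 a5' aa') la)) => //; by rewrite sub1set ini.
    apply: (tst (cur b)); first exact: curS.
    apply: touches_sub (touches1 (marked_adj br EX (curX b b5)
        (curX _ b5') (cur_ne _ _ b5 b5' bb') lb)) => //; by rewrite sub1set curS.
  case: ifP => i5.
    rewrite /C i5 j5; have : j - 5 < 4 by move: j9 j5; clear; lia.
    case: (j - 5) => [|[|[|[|]]]] //= _ ne.
    + by apply: (tst (st0 i)); rewrite ?ini // h1 ?iniL ?ini_ne.
    + by apply: (tst (st0 i)); rewrite ?ini // h2 ?iniL ?ini_ne.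
    + by apply: (tst (cur i)); rewrite ?curS // k1 ?curX ?cur_ne.
    by apply: (tst (cur i)); rewrite ?curS // k2 ?curX ?cur_ne.
  by rewrite !inE !xpair_eqE /C => /orP[]/andP[/eqP-> /eqP->].
move=> i j i9 j9 /orP[|h]; first exact: base.
by rewrite touchesC //; apply: base.
Qed.
End Invariant.

(** * Following the chain in the abstract game *)

Section Progress.
Variables (T : finType) (e : rel T) (lab : T -> nat) (cs : seq nat) (st0 : nat -> T).
Hypothesis br : bridge e lab.
Hypothesis noK7 : ~ model e 7 hK7.
Hypothesis cov : forall a b, e a b -> lab a = lab b -> lab a < 4 ->
  exists X, [/\ tight e lab X, a \in nb e X & b \in nb e X].
Hypothesis csP : forall i, i < 4 -> i \in cs.
Hypothesis cs4 : size cs = 4.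
Let es := br_sym br.
Let ei := br_irr br.
Implicit Types (x y z : T) (X Y Z U : {set T}).
Local Notation nb := (nb e).
Local Notation L0 := (lside lab).
Local Notation strands := (strands e lab cs st0).

Lemma index_cs i : i < 4 -> index i cs < 4.
Proof. by move=> /csP; rewrite -index_mem cs4. Qed.

(** At a terminal set all central vertices are in [X :|: nb e X], so every contact between central
    bags has been recorded. *)
Lemma strands_full X st cur s : marked e lab X -> terminal e lab X ->
  strands X st cur s -> full s.
Proof.
move=> EX term sd; have all_T := terminal_all br cov EX term.
have pairA c d : c < 4 -> d < 4 -> c != d -> nth false s.2 (tr c d).
  move=> c4 d4 cd; pose i := nth 0 cs c; pose j := nth 0 cs d.
  have ucs : uniq cs.
    apply: (leq_size_uniq (s1 := iota 0 4)); rewrite ?iota_uniq ?cs4 //.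
    by move=> k; rewrite mem_iota => /csP.
  have lt4 k : k < 4 -> nth 0 cs k < 4.
    move=> k4; have sub : {subset iota 0 4 <= cs}.
      by move=> l; rewrite mem_iota => /csP.
    have sz : size cs <= size (iota 0 4) by rewrite cs4.
    have [_ eqm] := uniq_min_size (iota_uniq 0 4) sub sz.
    have : nth 0 cs k \in cs by rewrite mem_nth ?cs4.
    by rewrite -eqm mem_iota.
  have ij : i != j by rewrite nth_uniq ?cs4.
  have : touches e (fib lab i) (fib lab j).
    have [lt|lt] : i < j \/ j < i by move: ij; clear; lia.
      apply: (br_touch br) => //; first exact: leq_trans (lt4 d d4) _.
      by rewrite /hC2; move: (lt4 c c4); rewrite -/i; clear; lia.
    rewrite touchesC //; apply: (br_touch br) => //; first exact: leq_trans (lt4 c c4) _.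
    by rewrite /hC2; move: (lt4 d d4); rewrite -/j; clear; lia.
  case/touchesP => x [y [xi yj exy]]; move: xi yj; rewrite !in_fib => /eqP xi /eqP yj.
  have inX z : lab z < 4 -> z \in (X :|: nb X) :\: L0.
    by move=> z4; rewrite in_setD all_T // andbT inE; move: z4; clear; lia.
  have := sd_A sd (inX x _) (inX y _) exy; rewrite xi yj.
  by rewrite !index_uniq ?cs4 //; apply; rewrite ?lt4.
move: pairA; case: s {sd} => [[[P col] H] A] /= pairA.
by rewrite (pairA 0 1) // (pairA 0 2) // (pairA 1 2) // (pairA 0 3) // (pairA 1 3) //
  (pairA 2 3).
Qed.

(** Only [s1] enters the closure. Its neighbours there lie on [nb X], since [s1] does not, so they
    are current ends of strands; [g] and the list [sub] account for all new contacts with other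
    labels. *)
Lemma strands_step X st cur s g q s1 r : marked e lab X -> strands X st cur s ->
  step e lab X g q s1 r ->
  exists st' cur' s', strands (g |: X) st' cur' s' /\ s' \in moves s.
Proof.
move=> EX sd stp; have tX := marked_tight EX; have aX := tight_adm tX.
have [gX qX gq lgq s1XX egs rX rg lsr esr lsg EY nY] := stp.
have [s1X s1nX] : s1 \notin X /\ s1 \notin nb X.
  by move: s1XX; rewrite in_setU negb_or => /andP[].
have [P1 P2 P12 lP] := sd_P sd.
have curS i : i < 5 -> cur i \in st i by move=> /(sd_cur sd)/andP[].
have curX i : i < 5 -> cur i \in nb X by move=> /(sd_cur sd)/andP[].
have cinj := @cur_inj _ _ _ _ _ _ _ _ _ _ _ sd.
have [m [m' [m5 m5' mg mq mP]]] : exists m m', [/\ m < 5, m' < 5, cur m = g, cur m' = q &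
    (m, m') = s.1.1.1 \/ (m', m) = s.1.1.1].
  have ne : cur s.1.1.1.1 != cur s.1.1.1.2.
    by apply: contra P12 => /eqP/cinj h; rewrite (h P1 P2).
  case: (pair_uniq br tX gX qX gq lgq (curX _ P1) (curX _ P2) ne lP) => -[h1 h2].
    by exists s.1.1.1.1, s.1.1.1.2; split=> //; left; case: (s.1.1.1).
  by exists s.1.1.1.2, s.1.1.1.1; split=> //; right; case: (s.1.1.1).
have [ri r5 rE] := sd_all sd rX.
have rm : ri != m by apply: contraNneq rg => h; rewrite rE h mg.
have rm' : ri != m'.
  by apply: contraNneq lsg => h; rewrite lsr rE h mq lgq.
pose sub := [seq b <- oth m ri | e s1 (cur b)].
pose st' i := if i == m then s1 |: st m else st i.
pose cur' i := if i == m then s1 else cur i.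
have sub_st i : st i \subset st' i.
  by rewrite /st'; case: eqP => [->|_] //; apply: subsetUr.
have s1Y : s1 \in nb (g |: X) by rewrite nY setU11.
have keep z : z \in nb X -> z != g -> z \in nb (g |: X).
  by move=> zX zg; rewrite nY in_setU1 in_setD1 zg zX orbT.
have cl z : (z \in (g |: X) :|: nb (g |: X)) = (z == s1) || (z \in X :|: nb X).
  rewrite nY !in_setU !in_set1 in_setD1.
  have [->|zg] := eqVneq z g; first by rewrite gX !orbT.
  by rewrite /= orbCA.
have s1st i : i < 5 -> s1 \notin st i.
  move=> i5; apply/negP => /(subsetP (sd_sub sd i5)).
  by rewrite in_setD (negPf s1XX) andbF.
have s1L : s1 \notin L0.
  by apply: contra s1X; have /andP[/subsetP h _] := aX; apply: h.
have subX : (X :|: nb X) :\: L0 \subset ((g |: X) :|: nb (g |: X)) :\: L0.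
  by apply: setSD; apply/subsetP => z h; rewrite cl h orbT.
have in_sub b : b \in sub -> [/\ b < 5, b != m, b != ri & e s1 (cur b)].
  by rewrite mem_filter oth_mem // => /andP[-> /and3P[-> -> ->]].
have colE := sd_col sd.
exists st', cur', (reroute s m ri sub); split; last first.
  case: s {sd P1 P2 P12 lP colE} mP => [[[P col] H] A] /= mP.
  have mPP : m \in [:: P.1; P.2].
    by case: mP => <-; rewrite !inE eqxx ?orbT.
  have rP : ri \in oth P.1 P.2.
    by case: mP => <-; rewrite oth_mem // r5 rm rm'.
  by apply: mem_moves => //; apply: mem_sublists.
have new b a0 b0 : b < 5 -> b != m -> e s1 (cur b) -> a0 < 5 -> b0 < 5 -> a0 != b0 ->
    tr m b = tr a0 b0 -> touches e (st' a0) (st' b0).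
  move=> b5 bm esb a5 b05 ab0 h; have mb : m != b by rewrite eq_sym.
  have t : touches e (st' m) (st' b).
    apply/touchesP; exists s1, (cur b); rewrite /st' eqxx (negPf bm) setU11 curS //.
  case: (tr_inj m5 b5 a5 b05 mb ab0 h) => -[<- <-] //.
  by rewrite touchesC.
split.
- move=> i i5; rewrite /st'; case: eqP => [_|_]; last exact: (sd_conn sd).
  apply: connU => //; [exact: conn1|exact: (sd_conn sd)|].
  apply/orP; right; apply/touchesP; exists s1, g.
  by split; rewrite ?inE // -?mg ?curS // mg es.
- move=> i j i5 j5 ij; rewrite /st'; case: eqP => [im|_]; case: eqP => [jm|_].
  + by rewrite im jm eqxx in ij.
  + rewrite disjoints_subset subUset sub1set inE s1st // -disjoints_subset.
    by apply: (sd_dis sd) => //; rewrite -im.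
  + rewrite disjoint_sym disjoints_subset subUset sub1set inE s1st // -disjoints_subset.
    by apply: (sd_dis sd) => //; rewrite -jm eq_sym.
  + exact: (sd_dis sd).
- move=> i i5; rewrite /st'; case: eqP => [_|_]; last exact: subset_trans (sd_sub sd i5) subX.
  rewrite subUset (subset_trans (sd_sub sd m5) subX) andbT sub1set in_setD s1L.
  by rewrite cl eqxx.
- move=> i i5; have /andP[h ->] := sd_ini sd i5.
  by rewrite (subsetP (sub_st i)).
- move=> i i5; rewrite /cur' /st'; case: eqP => [_|/eqP im]; first by rewrite setU11 s1Y.
  rewrite curS // keep ?curX //; apply: contra im => /eqP ig.
  by apply/eqP/cinj; rewrite // ig mg.
- move=> z; rewrite nY in_setU1 in_setD1 => /orP[/eqP->|/andP[zg zX]].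
    by exists m; rewrite // /cur' eqxx.
  have [i i5 zi] := sd_all sd zX; exists i => //; rewrite /cur'.
  by case: eqP => // im; rewrite zi im mg eqxx in zg.
- exact: (sd_lab01 sd).
- rewrite /reroute; case: (s) => [[[P col] H] A] /=.
  have lr : lab (cur' m) = lab (cur' ri).
    by rewrite /cur' eqxx (negPf rm) lsr rE.
  have mr : m != ri by rewrite eq_sym.
  by case: (m < ri) => /=; split.
- move=> i i5; have := colE i i5; have := colE ri r5.
  case: (s) => [[[P col] H] A] /= cr ci; rewrite nth_set_nth /= /cur'.
  by case: eqP => // _; rewrite cr lsr rE.
- move=> a0 b0 a5 b5 ab0; have := sd_H sd a5 b5 ab0.
  case: (s) => [[[P col] H] A] /= hH; rewrite nth_add_pairs => /orP[|/hH]; last by apply: touches_sub.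
  rewrite /= => /orP[/eqP h|/hasP[_ /mapP[b /in_sub[b5' bm _ esb] ->]] /= /eqP h].
    by apply: (new ri); rewrite // -rE.
  exact: (new b).
have sA := sd_A sd; have cg := colE m m5; have cr := colE ri r5.
have colA b := colE b; move: sA cg cr colA.
case: (s) => [[[P col] H] A] /= sA cg cr colA.
have lab4 z : z \in (X :|: nb X) :\: L0 -> lab z < 4.
  rewrite in_setD in_setU => /andP[zL /orP[zX|zX]]; first exact: (adm_lab br aX).
  exact: (nb_lab br aX).
have with_s z : z \in (X :|: nb X) :\: L0 -> e s1 z -> lab s1 != lab z ->
    nth false (add_pairs A ((nth 0 col m, nth 0 col ri) ::
      [seq (nth 0 col ri, nth 0 col b) | b <- sub]))
      (tr (index (lab s1) cs) (index (lab z) cs)).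
  move=> zXX esz lz; have z4 := lab4 z zXX.
  have zX : z \in nb X.
    have ezs : e z s1 by rewrite es.
    move: zXX; rewrite in_setD in_setU => /andP[_ /orP[zX|//]].
    by rewrite (mem_nb zX s1X ezs) in s1nX.
  have s4 : lab s1 < 4 by rewrite lsr; apply: (nb_lab br aX).
  have i4 k : k < 4 -> index k cs < 5 by move/index_cs => h; apply: leq_trans h _.
  have [i i5 zi] := sd_all sd zX.
  rewrite nth_add_pairs /= cg cr -rE mg -lsr.
  have [im|im] := eqVneq i m.
    by rewrite zi im mg trC ?eqxx // i4 // -mg -im -zi.
  apply/orP; left; apply/orP; right; apply/hasP.
  exists (index (lab s1) cs, index (lab z) cs); last by rewrite /=.
  apply/mapP; exists i; last by rewrite colA // -zi.
  rewrite mem_filter -zi esz oth_mem // i5 im /=.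
  by apply: contraNneq lz => h; rewrite lsr rE zi h.
move=> x y; rewrite !in_setD !cl => /andP[xL hx] /andP[yL hy] exy lxy.
have in_ z : z \notin L0 -> z \in X :|: nb X -> z \in (X :|: nb X) :\: L0.
  by move=> zL zX; rewrite in_setD zL.
case/orP: hx => [/eqP xs|xX]; case/orP: hy => [/eqP ys|yX].
- by rewrite xs ys eqxx in lxy.
- by subst x; apply: with_s => //; apply: in_.
- subst y; rewrite trC; first by apply: with_s; rewrite 1?es 1?eq_sym //; apply: in_.
    by apply: leq_trans (index_cs (lab4 x (in_ x xL xX))) _.
  by apply: leq_trans (index_cs _) _ => //; rewrite lsr; apply: (nb_lab br aX).
by rewrite nth_add_pairs sA ?orbT // in_.
Qed.

Lemma no_strands (R : pred state) X st cur s : (forall s, R s -> ~~ full s) ->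
  (forall s s', R s -> s' \in moves s -> free s' -> R s') ->
  marked e lab X -> strands X st cur s -> ~ R s.
Proof.
move=> nfull cl; have [n] := ubnP #|~: X|; elim: n => // n IH in X st cur s *; rewrite ltnS => Xn.
move=> EX sd rs; have [term|[g [q [s1 [r stp]]]]] := terminal_or_step br cov EX.
  by have := nfull s rs; rewrite (strands_full EX term sd).
have [st' [cur' [s' [sd' ns]]]] := strands_step EX sd stp.
have EY := st_marked stp.
apply: (IH _ _ _ _ _ EY sd').
  apply: leq_trans Xn; apply: proper_card; rewrite properE setCS subsetUr /=.
  rewrite setCS; apply/negP => /subsetP/(_ g); rewrite setU11.
  by rewrite (negPf (nb_notin (st_g stp))) => /(_ isT).
exact: cl rs ns (strands_free br noK7 cov EY sd').
Qed.
End Progress.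

(** * From bridges and 5-connectivity to the conclusion *)

Lemma bridge_covered_K7 (T : finType) (e : rel T) (lab : T -> nat) :
  bridge e lab -> (forall a b, e a b -> lab a = lab b -> lab a < 4 ->
    exists X, [/\ tight e lab X, a \in nb e X & b \in nb e X]) ->
  model e 7 hK7.
Proof.
move=> br cov; apply: NNPP => noK7; pose L := lside lab.
have es := br_sym br; have ei := br_irr br.
have EL := marked_L0 br noK7 cov; have tL := marked_tight EL.
have /markedP[_ [p [q [pL qL epq lpq]]]] := EL; have pq := e_neq br epq.
have qp : q != p by rewrite eq_sym.
have : #|nb e L :\ p :\ q| = 3.
  have := cardsD1 q (nb e L :\ p); have := cardsD1 p (nb e L).
  by rewrite in_setD1 qp qL pL (tight_card tL); clear; lia.
rewrite cardE; case E: (enum _) => [|z2 [|z3 [|z4 [|]]]] // _.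
pose s0 := [:: p; q; z2; z3; z4]; pose ini := nth p s0.
have mE z : (z \in [:: z2; z3; z4]) = (z \in nb e L :\ p :\ q).
  by rewrite -E mem_enum.
have u3 : uniq [:: z2; z3; z4] by rewrite -E enum_uniq.
have us0 : uniq s0.
  rewrite /s0 cons_uniq cons_uniq u3 andbT in_cons negb_or pq !mE.
  by rewrite !in_setD1 !eqxx andbF.
have ms0 z : (z \in s0) = (z \in nb e L).
  rewrite /s0 in_cons in_cons mE !in_setD1.
  by have [->//|_] := eqVneq z p; have [->//|_] := eqVneq z q.
have iniL i : i < 5 -> ini i \in nb e L by move=> i5; rewrite -ms0 mem_nth.
have ini_inj i j : i < 5 -> j < 5 -> ini i = ini j -> i = j.
  by move=> i5 j5 /eqP; rewrite nth_uniq // => /eqP.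
(* Colours are positions in [cs]; the adjacent pair [p], [q] comes first and shares colour 0, in
   agreement with [init_col]. *)
pose cs := [:: lab p; lab z2; lab z3; lab z4].
have csP i : i < 4 -> i \in cs.
  move=> i4; have [z zL <-] := adm_hit br (tight_adm tL) i4.
  move: zL; rewrite -ms0 /s0 /cs !inE => /or4P[|||/orP[]] /eqP->;
    by rewrite ?lpq eqxx ?orbT.
have ucs : uniq cs.
  by apply: (leq_size_uniq (s1 := iota 0 4)) => // i; rewrite mem_iota => /csP.
have cini i : i < 5 -> nth 0 init_col i = index (lab (ini i)) cs.
  have ix j : j < 4 -> index (nth 0 cs j) cs = j by move=> j4; rewrite index_uniq.
  case: i => [|[|[|[|[|//]]]]] _.
  - exact: esym (ix 0 isT).
  - by rewrite -[lab _]/(lab q) -lpq; apply: esym (ix 0 isT).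
  - exact: esym (ix 1 isT).
  - exact: esym (ix 2 isT).
  exact: esym (ix 3 isT).
pose l := [seq pr <- init_pairs | e (ini pr.1) (ini pr.2)].
pose s := init_of ((0, 1) :: l).
have le pr : pr \in (0, 1) :: l -> [/\ pr.1 < 5, pr.2 < 5, pr.1 != pr.2 & e (ini pr.1) (ini pr.2)].
  rewrite inE => /orP[/eqP->//|]; rewrite mem_filter => /andP[-> +].
  by rewrite !inE; do 8 case/orP => [/eqP->//|]; move/eqP->.
have nbD z : z \in (L :|: nb e L) :\: L -> z \in nb e L.
  by rewrite in_setD in_setU => /andP[/negPf->].
have sd : strands e lab cs ini L (fun i => [set ini i]) ini s.
  split.
  - by move=> i _; apply: conn1.
  - by move=> i j i5 j5 ij; rewrite disjoints1 inE; apply: contraNneq ij => /ini_inj->.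
  - move=> i i5; rewrite sub1set in_setD in_setU (iniL i i5) orbT andbT.
    exact: nb_notin (iniL i i5).
  - by move=> i i5; rewrite inE eqxx iniL.
  - by move=> i i5; rewrite inE eqxx iniL.
  - move=> z; rewrite -ms0 => zs; exists (index z s0); last by rewrite /ini nth_index.
    by move: zs; rewrite -index_mem.
  - exact: lpq.
  - by split=> //; exact: lpq.
  - exact: cini.
  - move=> a b a5 b5 ab; rewrite nth_add_pairs nth_nseq if_same orbF => /hasP[pr /le[p1 p2 p12 ep]].
    move=> /eqP h; case: (tr_inj p1 p2 a5 b5 p12 ab h) => -[<- <-].
      exact: touches1.
    by rewrite touchesC //; apply: touches1.
  have lt a b : a < b -> b < 5 -> e (ini a) (ini b) -> lab (ini a) != lab (ini b) ->
      nth false s.2 (tr (nth 0 init_col a) (nth 0 init_col b)).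
    move=> ab b5 eab lab_ab; rewrite nth_add_pairs; apply/orP; left; apply/hasP.
    exists (nth 0 init_col a, nth 0 init_col b); last by rewrite /=.
    apply/mapP; exists (a, b) => //; rewrite mem_filter.
    have ab01 : (a, b) != (0, 1).
      by apply: contraNneq lab_ab => -[-> ->]; rewrite lpq.
    rewrite ab01 inE (negPf ab01) mem_filter eab /=.
    by move: a b ab b5 ab01 {eab lab_ab} => [|[|[|[|[|a]]]]] [|[|[|[|[|b]]]]].
  move=> x y /nbD xL /nbD yL exy lxy.
  have [i i5 xi] : exists2 i, i < 5 & x = ini i.
    by exists (index x s0); rewrite ?/ini ?nth_index ?ms0 // -[5]/(size s0) index_mem ms0.
  have [j j5 yj] : exists2 j, j < 5 & y = ini j.
    by exists (index y s0); rewrite ?/ini ?nth_index ?ms0 // -[5]/(size s0) index_mem ms0.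
  rewrite xi yj in exy lxy *; rewrite -!cini //.
  have [ij|ij] : i < j \/ j < i.
    have : i != j by apply: contraTneq exy => ->; rewrite ei.
    by clear; lia.
    exact: lt.
  rewrite trC; first by apply: lt => //; rewrite 1?es 1?eq_sym.
    by move: i i5 {xi exy lxy ij} => [|[|[|[|[|]]]]].
  by move: j j5 {yj exy lxy ij} => [|[|[|[|[|]]]]].
have [R [ini_R nfull cl]] := reachable_exists.
apply: (no_strands br noK7 cov csP (erefl : size cs = 4) nfull cl EL sd).
apply: ini_R; last exact: (strands_free br noK7 cov EL sd).
by apply/mapP; exists l => //; apply: mem_sublists.
Qed.

Lemma bridge_K7 (T : finType) (e : rel T) (lab : T -> nat) :
  bridge e lab -> model e 7 hK7.
Proof.
have [n] := ubnP #|[set: T]|; elim: n => // n IH in T e lab *; rewrite ltnS => Tn br.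
apply: NNPP => noK7; apply: (noK7); apply: (bridge_covered_K7 br) => a b eab lab_ab lab4.
apply: NNPP => no; apply: noK7.
have cov X : tight e lab X -> ~~ ((a \in nb e X) && (b \in nb e X)).
  by move=> tX; apply/negP => /andP[aX bX]; apply: no; exists X.
apply: (contract_model (br_sym br) (br_irr br) eab).
apply: IH (contract_bridge br eab lab_ab lab4 cov).
rewrite cardsT card_sig; apply: leq_trans Tn; rewrite -(card_setC [set b]).
rewrite cards1 add1n ltnS; apply: subset_leq_card; apply/subsetP => x.
by rewrite !inE.
Qed.

Lemma conn_induced (G : sgraph) (A : {set G}) : connected (induced A) -> conn adj A.
Proof.
move=> [_ cA] Y YA /set0Pn[y yY] cl; apply/subsetP => a aA.
have yA := subsetP YA _ yY.
have h := cA (Sub y yA) (Sub a aA).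
have clY : closed (@adj (induced A)) [pred u | val u \in Y].
  move=> u v; rewrite /adj /= /induced_adj !inE => auv.
  by apply/idP/idP => [uY|vY]; [apply: cl uY (valP v) _|apply: cl vY (valP u) _];
    rewrite // adj_sym.
by have := closed_connect clY h; rewrite !inE /= yY => <-.
Qed.

(** As long as some vertex is uncovered, connectivity gives an edge leaving the union of the bags,
    and its outer end joins the bag of its inner end. *)
Lemma spanning_model (T : finType) (e : rel T) k h : symmetric e -> 0 < k ->
  conn e [set: T] -> model e k h -> exists lab : T -> nat,
  [/\ forall x, lab x < k, forall i, i < k -> fib lab i != set0,
      forall i, i < k -> conn e (fib lab i) &
      forall i j, i < j -> j < k -> h i j -> touches e (fib lab i) (fib lab j)].
Proof.
move=> es k0 cT [B [B0 Bc Bt]].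
pose cover (B : nat -> {set T}) := [set x | has (fun i => x \in B i) (iota 0 k)].
have [n] := ubnP #|~: cover B|; elim: n => // n IH in B B0 Bc Bt *; rewrite ltnS => Bn.
have dis i j : i < k -> j < k -> i != j -> [disjoint B i & B j].
  move=> ik jk; case: ltngtP => // ij _; last rewrite disjoint_sym.
    by have [] := Bt _ _ ij jk.
  by have [] := Bt _ _ ij ik.
have [cT'|] := boolP (cover B == setT).
  pose lab x := find (fun i => x \in B i) (iota 0 k).
  have hs x : has (fun i => x \in B i) (iota 0 k).
    by have := in_setT x; rewrite -(eqP cT') inE.
  have labk x : lab x < k by have := hs x; rewrite has_find size_iota.
  have labB x : x \in B (lab x).
    by have := nth_find 0 (hs x); rewrite nth_iota ?add0n //; apply: labk.
  have fibE i : i < k -> fib lab i = B i.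
    move=> ik; apply/setP => x; rewrite inE; apply/eqP/idP => [<-//|xi].
    apply/eqP; apply: contraT => ne.
    by have := disjointFr (dis _ _ (labk x) ik ne) (labB x); rewrite xi.
  exists lab; split=> // [i ik|i ik|i j ij jk hij]; rewrite ?fibE ?B0 //; first exact: Bc.
    by have [_ t] := Bt _ _ ij jk; apply: t.
  exact: ltn_trans jk.
move=> ncov.
have [x [y [xc yc exy]]] : exists x y, [/\ x \in cover B, y \notin cover B & e x y].
  apply: NNPP => no; case/negP: ncov; rewrite -subTset; apply: cT => //.
    have /set0Pn[x xB] := B0 0 k0; apply/set0Pn; exists x; rewrite inE.
    by apply/hasP; exists 0; rewrite ?mem_iota.
  by move=> x y xc _ exy; apply: contraT => yc; case: no; exists x, y.
move: xc; rewrite inE => /hasP[m]; rewrite mem_iota /= add0n => mk xm.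
have yB i : i < k -> y \notin B i.
  move=> ik; apply: contra yc => yi; rewrite inE; apply/hasP.
  by exists i; rewrite ?mem_iota.
pose B' i := if i == m then y |: B i else B i.
have sub i : B i \subset B' i by rewrite /B'; case: eqP => _ //; apply: subsetUr.
apply: (IH B').
- move=> i ik; have /set0Pn[z zi] := B0 i ik; apply/set0Pn; exists z.
  exact: (subsetP (sub i)).
- move=> i ik; rewrite /B'; case: eqP => [im|_]; last exact: Bc.
  apply: connU => //; [exact: conn1|exact: Bc|].
  apply/orP; right; apply/touchesP; exists y, x.
  by rewrite inE eqxx es exy im xm.
- move=> i j ij jk; have [d t] := Bt _ _ ij jk; have ik := ltn_trans ij jk; split.
    rewrite /B'; case: eqP => [im|_]; case: eqP => [jm|_] //.
    + by move: ij; rewrite im jm ltnn.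
    + by rewrite disjoints_subset subUset sub1set inE yB // -disjoints_subset.
    by rewrite disjoint_sym disjoints_subset subUset sub1set inE yB // -disjoints_subset
      disjoint_sym.
  by move=> /t; apply: touches_sub.
apply: leq_trans Bn; apply: proper_card; apply/properP; split.
  rewrite setCS; apply/subsetP => z; rewrite !inE => /hasP[i ik zi].
  by apply/hasP; exists i => //; apply: (subsetP (sub i)).
exists y; first by rewrite inE.
rewrite inE negbK inE; apply/hasP; exists m; rewrite ?mem_iota //.
by rewrite /B' eqxx setU11.
Qed.

Unset Implicit Arguments.

Theorem theorem1p3 (G : sgraph) :
  6 <= #|G| ->
  k_connected 5 G ->
  4 * #|G| - 7 <= #|edges G| ->
  minor K7_minus2 G.
Proof.
move=> G6 [_ conn5] many; apply: minor_of_model.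
have es := @adj_sym G; have ei := @adj_irrefl G.
have [||//|c2] := dense_model es ei.
- by rewrite cardsT; apply: leq_trans G6.
- by have := e2_edges G; rewrite cardsT; move: many; clear; lia.
have cG : conn (@adj G) [set: G].
  by rewrite -setC0; apply: conn_induced; apply: conn5; rewrite cards0.
have [lab [lt ne cn tc]] := spanning_model es (isT : 0 < 8) cG c2.
apply: (@bridge_K7 _ _ lab); split=> // X /andP[LX dX].
(* With fewer than five neighbours of [X] deleted the graph is connected, so [X] would fill the rest
   and contain right blob vertices. *)
rewrite leqNgt; apply/negP => /conn5/conn_induced cX.
have sX : ~: nb adj X \subset X.
  apply: cX.
  - by apply/subsetP => x xX; rewrite inE; apply/negP => /nb_notin; rewrite xX.
  - have /set0Pn[x x4] := ne 4 isT; apply/set0Pn; exists x; apply: (subsetP LX).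
    by move: x4; rewrite !inE => ->.
  by move=> x y xX; rewrite inE => yX axy; have := nb_closed xX axy;
    rewrite in_setU (negPf yX) orbF.
have /set0Pn[r r6] := ne 6 isT.
have rR : r \in rside lab by move: r6; rewrite !inE => ->.
have := disjointFr dX rR; rewrite in_setU => /norP[rX rnX].
by have := subsetP sX r; rewrite inE rnX (negPf rX) => /(_ isT).
Qed.
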